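(* Let $Q_6(q)=(q,q^5;q^6)_\infty$ and, for real $\delta$, write $Q_6(q)^\delta=\sum_{n\ge0}c_\delta(n)q^n$. Then for every real $\delta\ge3$ the coefficients exhibit the sign pattern $(+-)^3$, i.e. $(-1)^nc_\delta(n)\ge0$ for all $n\ge0$.
   Context: $(a;q)_\infty=\prod_{j\ge0}(1-aq^j)$, $(a,b;q)_\infty=(a;q)_\infty(b;q)_\infty$. For a power series $F(q)=1+O(q)$ and real $\delta$, $F(q)^\delta=\exp(\delta\log F(q))$ as a formal power series. A coefficient sequence $(c(n))_{n\ge0}$ exhibits the sign pattern $s_0\cdots s_{p-1}$ if for every $n$, $c(n)\ge0$ when $s_{n\bmod p}=+$ and $c(n)\le0$ when $s_{n\bmod p}=-$. *)

(* Defs.v *)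
From HB Require Import structures.
From mathcomp Require Import all_boot all_order all_algebra.
From mathcomp Require Import zify.
From mathcomp Require Import all_classical all_reals all_analysis.

Set Implicit Arguments.
Unset Strict Implicit.
Unset Printing Implicit Defensive.

Import Order.TTheory GRing.Theory Num.Theory.
Import numFieldNormedType.Exports.

Local Open Scope ring_scope.

(* A wrapper around coefficient sequences: the bare type nat -> R already
   carries the pointwise product, whereas fps R gets the Cauchy product. *)
Record fps (R : Type) := FPS { coefs :> nat -> R }.

Lemma coefsK (R : Type) : cancel (@coefs R) (@FPS R).
Proof. by case. Qed.

HB.instance Definition _ (R : choiceType) :=
  Choice.copy (fps R) (can_type (@coefsK R)).

Lemma fpsP (R : Type) (f g : fps R) : (forall n, f n = g n) <-> f = g.
Proof.
split=> [fg|-> //]; rewrite -(coefsK f) -(coefsK g).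
by congr FPS; apply/funext.
Qed.

Section FpsRing.
Variable R : comNzRingType.
Implicit Types f g h : fps R.

Definition fps_zero : fps R := FPS (fun _ => 0).
Definition fps_one : fps R := FPS (fun n => (n == 0)%:R).
Definition fps_opp f : fps R := FPS (fun n => - f n).
Definition fps_add f g : fps R := FPS (fun n => f n + g n).
Definition fps_mul f g : fps R :=
  FPS (fun n => \sum_(i < n.+1) f i * g (n - i)%N).
Definition fps_scale (a : R) f : fps R := FPS (fun n => a * f n).

Fact fps_addA : associative fps_add.
Proof. by move=> f g h; apply/fpsP => n /=; rewrite addrA. Qed.
Fact fps_addC : commutative fps_add.
Proof. by move=> f g; apply/fpsP => n /=; rewrite addrC. Qed.
Fact fps_add0 : left_id fps_zero fps_add.
Proof. by move=> f; apply/fpsP => n /=; rewrite add0r. Qed.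
Fact fps_addN : left_inverse fps_zero fps_opp fps_add.
Proof. by move=> f; apply/fpsP => n /=; rewrite addNr. Qed.

HB.instance Definition _ :=
  GRing.isZmodule.Build (fps R) fps_addA fps_addC fps_add0 fps_addN.

Definition fps_trunc (n : nat) f : {poly R} := \poly_(i < n.+1) f i.

Lemma coef_fps_trunc n f i : (i <= n)%N -> (fps_trunc n f)`_i = f i.
Proof. by move=> le_in; rewrite coef_poly ltnS le_in. Qed.

Lemma fps_mul_trunc n f g i :
  (i <= n)%N -> fps_mul f g i = (fps_trunc n f * fps_trunc n g)`_i.
Proof.
move=> le_in; rewrite coefM; apply: eq_bigr => j _.
rewrite !coef_fps_trunc ?(leq_trans _ le_in) ?leq_subr //.
by rewrite -ltnS.
Qed.

Fact fps_mulC : commutative fps_mul.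
Proof.
by move=> f g; apply/fpsP => n; rewrite !(@fps_mul_trunc n) // mulrC.
Qed.

Fact fps_mulA : associative fps_mul.
Proof.
move=> f g h; apply/fpsP => n; rewrite !(@fps_mul_trunc n) //.
transitivity ((fps_trunc n f * (fps_trunc n g * fps_trunc n h))`_n).
  rewrite !coefM; apply: eq_bigr => i _; congr (_ * _).
  by rewrite coef_fps_trunc ?leq_subr // (@fps_mul_trunc n) ?leq_subr.
rewrite mulrA !coefM; apply: eq_bigr => i _; congr (_ * _).
by rewrite coef_fps_trunc -1?ltnS // -(@fps_mul_trunc n) // -ltnS.
Qed.

Fact fps_mul1 : left_id fps_one fps_mul.
Proof.
move=> f; apply/fpsP => n /=; rewrite big_ord_recl /= subn0 mul1r.
by rewrite big1 ?addr0 // => i _; rewrite mul0r.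
Qed.

Fact fps_mulD : left_distributive fps_mul fps_add.
Proof.
move=> f g h; apply/fpsP => n /=; rewrite -big_split /=.
by apply: eq_bigr => i _; rewrite mulrDl.
Qed.

Fact fps_one_neq0 : fps_one != 0.
Proof.
by apply/eqP => /fpsP /(_ 0%N) /= /eqP; rewrite (negPf (oner_neq0 R)).
Qed.

HB.instance Definition _ := GRing.Zmodule_isComNzRing.Build (fps R)
  fps_mulA fps_mulC fps_mul1 fps_mulD fps_one_neq0.

Fact fps_scaleA a b f : fps_scale a (fps_scale b f) = fps_scale (a * b) f.
Proof. by apply/fpsP => n /=; rewrite mulrA. Qed.
Fact fps_scale1 : left_id 1 fps_scale.
Proof. by move=> f; apply/fpsP => n /=; rewrite mul1r. Qed.
Fact fps_scaleDr : right_distributive fps_scale +%R.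
Proof. by move=> a f g; apply/fpsP => n /=; rewrite mulrDr. Qed.
Fact fps_scaleDl f : {morph fps_scale^~ f : a b / a + b}.
Proof. by move=> a b; apply/fpsP => n /=; rewrite mulrDl. Qed.

HB.instance Definition _ := GRing.Zmodule_isLmodule.Build R (fps R)
  fps_scaleA fps_scale1 fps_scaleDr fps_scaleDl.

Fact fps_scaleAl (a : R) f g : a *: (f * g) = (a *: f) * g.
Proof.
apply/fpsP => n /=; rewrite mulr_sumr.
by apply: eq_bigr => i _; rewrite mulrA.
Qed.

HB.instance Definition _ :=
  GRing.Lmodule_isLalgebra.Build R (fps R) fps_scaleAl.
HB.instance Definition _ := GRing.Lalgebra_isComAlgebra.Build R (fps R).

Definition fpsX : fps R := FPS (fun n => (n == 1)%:R).

Local Arguments coefs : simpl never.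

Lemma coefs_fpsX n : fpsX n = (n == 1)%:R. Proof. by []. Qed.
Lemma coefs0 n : (0 : fps R) n = 0. Proof. by []. Qed.
Lemma coefs1 n : (1 : fps R) n = (n == 0)%:R. Proof. by []. Qed.
Lemma coefsN f n : (- f) n = - f n. Proof. by []. Qed.
Lemma coefsD f g n : (f + g) n = f n + g n. Proof. by []. Qed.
Lemma coefsB f g n : (f - g) n = f n - g n. Proof. by []. Qed.
Lemma coefsZ a f n : (a *: f) n = a * f n. Proof. by []. Qed.
Lemma coefsM f g n : (f * g) n = \sum_(i < n.+1) f i * g (n - i)%N.
Proof. by []. Qed.

Lemma coefs_sum (I : Type) (r : seq I) (P : pred I) (F : I -> fps R) n :
  (\sum_(i <- r | P i) F i) n = \sum_(i <- r | P i) F i n.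
Proof. by elim/big_rec2: _ => // i x y _ <-. Qed.

Lemma coefs_fpsXn k n : (fpsX ^+ k) n = (n == k)%:R.
Proof.
elim: k n => [|k IHk] n; first by rewrite expr0.
rewrite exprS coefsM; case: n => [|n].
  by rewrite big_ord_recl big_ord0 /= coefs_fpsX mul0r addr0.
rewrite big_ord_recl coefs_fpsX mul0r add0r big_ord_recl coefs_fpsX mul1r.
rewrite big1 ?addr0; first by rewrite IHk /= subn1.
by move=> i _; rewrite coefs_fpsX mul0r.
Qed.

(* f = O(q) implies f^k = O(q^k). *)
Lemma coefs_expr_small f k n : f 0 = 0 -> (n < k)%N -> (f ^+ k) n = 0.
Proof.
move=> f0; elim: k n => // k IHk n lt_nk; rewrite exprS coefsM big1 // => i _.
case: i => -[|i] lt_in /=; first by rewrite f0 mul0r.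
rewrite IHk ?mulr0 //; lia.
Qed.

End FpsRing.

Arguments fpsX {R}.
Arguments coefs : simpl never.

Section FpsReal.
Variable R : realType.
Implicit Types (f g : fps R) (u : nat -> fps R).

(* Coefficientwise limit.  In all uses below the coefficient sequences are
   eventually constant, so that this is the limit in the (q)-adic topology. *)
Definition fps_lim u : fps R := FPS (fun n => limn (fun N => u N n)).

(* (a; q)_oo, for a and q themselves power series. *)
Definition qpoch (a q : fps R) : fps R :=
  fps_lim (fun N => \prod_(j < N) (1 - a * q ^+ j)).

(* (a, b; q)_oo *)
Definition qpoch2 (a b q : fps R) : fps R := qpoch a q * qpoch b q.

(* Meaningful when f 0 = 1. *)
Definition fps_log f : fps R :=
  fps_lim (fun N => \sum_(1 <= k < N) ((-1) ^+ k.+1 / k%:R) *: (f - 1) ^+ k).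

(* Meaningful when f 0 = 0. *)
Definition fps_exp f : fps R :=
  fps_lim (fun N => \sum_(0 <= k < N) (k`!%:R)^-1 *: f ^+ k).

Definition fps_rpow f (delta : R) : fps R := fps_exp (delta *: fps_log f).

Definition Q6 : fps R := qpoch2 fpsX (fpsX ^+ 5) (fpsX ^+ 6).

Lemma fps_lim_stable u n N0 :
    (forall N, (N0 <= N)%N -> u N n = u N0 n) ->
  fps_lim u n = u N0 n.
Proof.
by move=> uN0; apply: lim_near_cst => /=; [exact: norm_hausdorff|exists N0].
Qed.

Lemma coefs_log f n : f 0 = 1 ->
  fps_log f n = \sum_(1 <= k < n.+1) (-1) ^+ k.+1 / k%:R * ((f - 1) ^+ k) n.
Proof.
move=> f0; rewrite /fps_log (@fps_lim_stable _ _ n.+1) => [|N leN].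
  by rewrite coefs_sum; apply: eq_bigr => k _; rewrite coefsZ.
rewrite !coefs_sum (big_cat_nat _ leN) //= [X in _ + X]big_nat_cond.
rewrite [X in _ + X]big1 ?addr0 // => k /andP[/andP[lt_nk _] _].
by rewrite coefsZ coefs_expr_small ?mulr0 // coefsB f0 subrr.
Qed.

Lemma coefs_exp f n : f 0 = 0 ->
  fps_exp f n = \sum_(0 <= k < n.+1) (k`!%:R)^-1 * (f ^+ k) n.
Proof.
move=> f0; rewrite /fps_exp (@fps_lim_stable _ _ n.+1) => [|N leN].
  by rewrite coefs_sum; apply: eq_bigr => k _; rewrite coefsZ.
rewrite !coefs_sum (big_cat_nat _ leN) //= [X in _ + X]big_nat_cond.
rewrite [X in _ + X]big1 ?addr0 // => k /andP[/andP[lt_nk _] _].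
by rewrite coefsZ coefs_expr_small ?mulr0.
Qed.

Lemma coefs_log0 f : f 0 = 1 -> fps_log f 0 = 0.
Proof. by move=> f0; rewrite coefs_log // big_geq. Qed.

Lemma coefs_qpoch r m n : (0 < r)%N -> (0 < m)%N ->
  qpoch (fpsX ^+ r) (fpsX ^+ m) n =
  (\prod_(j < n) (1 - fpsX ^+ (r + m * j)) : fps R) n.
Proof.
move=> r_gt0 m_gt0.
have eqF N : \prod_(j < N) (1 - fpsX ^+ r * (fpsX ^+ m) ^+ j) =
             \prod_(j < N) (1 - fpsX ^+ (r + m * j)) :> fps R.
  by apply: eq_bigr => j _; rewrite -exprM exprD.
rewrite /qpoch (@fps_lim_stable _ _ n) ?eqF // => N leN; rewrite !eqF.
elim: N leN => [|N IHN]; first by rewrite leqn0 => /eqP ->.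
rewrite leq_eqVlt => /predU1P[-> //|]; rewrite ltnS => leN.
rewrite big_ord_recr /= mulrBr mulr1 coefsB IHN // coefsM.
rewrite [X in _ - X]big1 ?subr0 // => i _; rewrite coefs_fpsXn.
suff -> : (n - i == r + m * N)%N = false by rewrite mulr0.
apply/negbTE; rewrite neq_ltn; apply/orP; left.
have : (N <= m * N)%N by rewrite leq_pmull.
lia.
Qed.

Lemma coefs_Q6_0 : Q6 0 = 1.
Proof.
have := coefs_qpoch (r := 1) (m := 6) 0; rewrite expr1 => q1.
by rewrite /Q6 /qpoch2 coefsM big_ord1 q1 // coefs_qpoch // !big_ord0 mulr1.
Qed.

End FpsReal.

Arguments Q6 {R}.

Inductive sign := Plus | Minus.

Definition has_sign (R : realType) (s : sign) (x : R) : Prop :=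
  match s with Plus => 0 <= x | Minus => x <= 0 end.

(* The period is p = size s, and s is meant to be nonempty. *)
Definition sign_pattern (R : realType) (s : seq sign) (c : nat -> R) : Prop :=
  forall n : nat, has_sign (nth Plus s (n %% size s)) (c n).

(* The pattern (+-)^k *)
Definition alt_pattern (k : nat) : seq sign := flatten (nseq k [:: Plus; Minus]).

Lemma alt_pattern3P (R : realType) (c : nat -> R) :
  sign_pattern (alt_pattern 3) c <-> forall n, 0 <= (-1) ^+ n * c n.
Proof.
have E n : has_sign (nth Plus (alt_pattern 3) (n %% 6)) (c n) <->
           0 <= (-1) ^+ n * c n.
  rewrite -signr_odd.
  have -> : odd n = odd (n %% 6) by rewrite -[LHS]oddb {1}(divn_eq n 6); lia.
  have : (n %% 6 < 6)%N by rewrite ltn_mod.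
  by case: (n %% 6)%N => [|[|[|[|[|[|//]]]]]] _ /=;
     rewrite ?expr0 ?expr1 ?mul1r ?mulN1r ?oppr_ge0.
by split=> h n; apply/E; apply: h.
Qed.

(* Main.v *)
Require Import Defs.
From HB Require Import structures.
From Stdlib Require Import NArith.
From mathcomp Require Import all_boot all_order all_algebra.
From mathcomp Require Import ring lra zify.
From mathcomp Require Import all_classical all_reals all_analysis.
From mathcomp Require Import complex.
Set Implicit Arguments.
Unset Strict Implicit.
Unset Printing Implicit Defensive.
Import Order.TTheory GRing.Theory Num.Theory.
Import numFieldNormedType.Exports.
Local Open Scope ring_scope.

(** After q -> -q the claim is that prod (1 + q^m)^delta, over m = 1, 5 mod 6, has
    nonnegative coefficients for delta >= 3; multiplying by prod (1 + q^m) reduces it to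
    3 <= delta <= 4.

    For n >= 1610 the coefficient is a discrete Fourier integral over the circle of radius
    r, the saddle point, at which delta * sum m r^m / (1 + r^m) = n.  With
    kappa = (r^-3 - r^3) / 2 and X = 3 delta / kappa >= 120, the modulus of the integrand
    is controlled by closed forms of sums of r^m (1 - cos m t), and its phase near 0 by
    the third moment sum m^3 r^m; a step function below the integrand has positive
    integral.

    For n < 1610 write delta = 3 + e and split off one factor 1 + x, x = q^m.  Up to
    nonnegative terms, (1 + x)^(2 + e) is 1 - h with h an explicit series independent of e,
    and the factors 1 - h can be merged into one; this leaves finitely many integer
    inequalities, which are evaluated. *)

(** The analytic half stays finite throughout. Each binomial series is cut to a polynomial, a
    coefficient of the resulting product is an exact average over 2K + 1 nodes of the circle, and
    the truncation error is a relative one, controlled by a differential equation in x = r^m that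
    holds uniformly in the angle. The size of X is the crux. The peak at 0 has width of order kappa
    / (3 sqrt X), whereas a secondary peak at pi / 3, where sin 3t vanishes again, and the rest of
    the circle are damped exponentially in X. At X = 120 the positive part of the step function has
    area about 0.92 in units of that width, and the negative part about 0.80. The mean equation
    gives n <= d (3 / kappa^2 + 9/4); if X < 120 the right side is at most 1600 + 9, whence the
    threshold 1610. Below it the coefficients are polynomials in e, so a finite check needs lower
    bounds free of e. Those used for the negative binomial coefficients of (1 + x)^(2 + e) are
    multiples of 1/64, so after scaling by 64 the check is integral. *)

(** * Formal real powers through a differential equation; reduction to products of binomial
    series *)

Section PowerOde.
Variable R : realType.
Implicit Types (f g h : fps R) (d : R).

Definition eqmodq n f g := forall i, (i <= n)%N -> f i = g i.

Lemma eqmodqM n f f' g g' :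
  eqmodq n f f' -> eqmodq n g g' -> eqmodq n (f * g) (f' * g').
Proof.
move=> ff gg i le_in; rewrite !coefsM; apply: eq_bigr => j _.
have lej : (j <= i)%N by rewrite -ltnS.
by rewrite ff ?gg //; lia.
Qed.

Definition Dq f : fps R := FPS (fun n => n%:R * f n).

Lemma coefsDq f n : Dq f n = n%:R * f n. Proof. by []. Qed.

Lemma DqD f g : Dq (f + g) = Dq f + Dq g.
Proof. by apply/fpsP => n; rewrite coefsD !coefsDq coefsD mulrDr. Qed.

Lemma DqZ a f : Dq (a *: f) = a *: Dq f.
Proof. by apply/fpsP => n; rewrite coefsZ !coefsDq coefsZ mulrCA. Qed.

Lemma Dq1 : Dq 1 = 0.
Proof. by apply/fpsP => -[|n]; rewrite coefsDq coefs0 coefs1 ?mul0r ?mulr0. Qed.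

Lemma DqM f g : Dq (f * g) = Dq f * g + f * Dq g.
Proof.
apply/fpsP => n; rewrite coefsD !coefsM coefsDq coefsM mulr_sumr -big_split.
apply: eq_bigr => i _ /=; rewrite !coefsDq.
have -> : n%:R = (i + (n - i))%:R :> R by rewrite subnKC // -ltnS.
by rewrite natrD; ring.
Qed.

Lemma Dq_sum (I : Type) (r : seq I) (F : I -> fps R) :
  Dq (\sum_(i <- r) F i) = \sum_(i <- r) Dq (F i).
Proof.
elim: r => [|i r IH]; last by rewrite !big_cons DqD IH.
by rewrite !big_nil; apply/fpsP => n; rewrite coefsDq coefs0 mulr0.
Qed.

Lemma DqX f k : Dq (f ^+ k.+1) = k.+1%:R *: (f ^+ k * Dq f).
Proof.
elim: k => [|k IH]; first by rewrite expr1 expr0 mul1r scale1r.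
rewrite exprS DqM IH -scalerAr mulrA -exprS -[k.+2%:R]natr1 scalerDl scale1r.
by rewrite addrC [Dq f * _]mulrC.
Qed.

(** With [Dq] = q d/dq, the equation of g = f^d; together with the constant term it replaces exp and
    log from here on. *)
Definition powode f d g := f * Dq g = d *: (Dq f * g).

Lemma powode_coef f d g n : f 0%N = 1 -> powode f d g ->
  n%:R * g n = \sum_(i < n) (d * i.+1%:R - (n - i.+1)%:R) * f i.+1 * g (n - i.+1)%N.
Proof.
move=> f0 /fpsP /(_ n); rewrite coefsZ !coefsM !big_ord_recl !coefsDq f0.
rewrite mul0r mul0r add0r mul1r subn0 => /(canRL (addrK _)) ->.
rewrite mulr_sumr -sumrB; apply: eq_bigr => i _.
by rewrite !lift0 !coefsDq; ring.
Qed.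

(** The equation is a recurrence for the coefficients of g. Agreement of the bases only up to degree
    n allows infinite products to be cut. *)
Lemma powode_uniq f f' d g g' n : f 0%N = 1 -> g 0%N = g' 0%N ->
  powode f d g -> powode f' d g' -> eqmodq n f f' -> eqmodq n g g'.
Proof.
move=> f0 gg0 og og' ff' i.
elim: i {-2}i (leqnn i) => [|i IH] j; first by rewrite leqn0 => /eqP ->.
move=> le_ji le_jn; case: (posnP j) => [->//|j0].
have f'0 : f' 0%N = 1 by rewrite -ff'.
apply: (@mulfI _ j%:R); first by rewrite pnatr_eq0 -lt0n.
rewrite (powode_coef _ f0 og) (powode_coef _ f'0 og'); apply: eq_bigr => k _.
have := ltn_ord k => ltk; rewrite ff' ?IH //; lia.
Qed.

Lemma powodeM f f' d g g' :
  powode f d g -> powode f' d g' -> powode (f * f') d (g * g').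
Proof.
rewrite /powode !DqM => h h'.
have -> : f * f' * (Dq g * g' + g * Dq g') =
   (f * Dq g) * (f' * g') + (f' * Dq g') * (f * g) by ring.
rewrite h h' -!scalerAl -scalerDr; congr (_ *: _); ring.
Qed.

Lemma coefs0_mul0 f g : (f * g) 0%N = f 0%N * g 0%N.
Proof. by rewrite coefsM big_ord1. Qed.

(** Differentiating the truncated logarithm of 1 + u gives a geometric sum in - u. Multiplied by 1 +
    u it telescopes to Dq u up to (- u)^n Dq u, which starts beyond degree n because Dq u has no
    constant term. *)
Lemma log_ode f : f 0%N = 1 -> f * Dq (fps_log f) = Dq f.
Proof.
move=> f0; set u := f - 1; have u0 : u 0%N = 0 by rewrite coefsB f0 subrr.
have Du : Dq f = Dq u.
  by rewrite -[f](subrK 1) -/u DqD Dq1 addr0.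
apply/fpsP => n.
pose T := \sum_(1 <= k < n.+1) ((-1) ^+ k.+1 / k%:R) *: u ^+ k.
have eT : eqmodq n (fps_log f) T.
  move=> i le_in; rewrite coefs_log // coefs_sum.
  rewrite -ltnS in le_in; rewrite [RHS](big_cat_nat _ le_in) //= [X in _ = _ + X]big1_seq ?addr0.
    by apply: eq_bigr => k _; rewrite coefsZ.
  move=> k /andP[_]; rewrite mem_index_iota => /andP[ltik _].
  by rewrite coefsZ coefs_expr_small // mulr0.
have -> : (f * Dq (fps_log f)) n = (f * Dq T) n.
  by apply: (@eqmodqM n) => // i le_in; rewrite !coefsDq eT.
have -> : f * Dq T = Dq u - (- u) ^+ n * Dq u.
  have -> : f = 1 + u by rewrite addrC subrK.
  rewrite /T Dq_sum; elim: (n) => [|m IH].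
    by rewrite big_nil mulr0 expr0 mul1r subrr.
  rewrite big_nat_recr //= mulrDr IH DqZ DqX scalerA divfK ?pnatr_eq0 //.
  have -> : (-1) ^+ m.+2 *: (u ^+ m * Dq u) = (- u) ^+ m * Dq u.
    by rewrite !exprS !mulN1r opprK scalerAl -mulr_algl -[- u]mulN1r exprMn
      -in_algE rmorphXn rmorphN1.
  by rewrite exprS; ring.
rewrite Du coefsB [X in _ - X]coefsM big1 ?subr0 // => i _.
case: (ltnP i n) => [lt_in|le_ni].
  by rewrite coefs_expr_small ?coefsN ?u0 ?oppr0 // mul0r.
rewrite coefsDq; have -> : (n - i = 0)%N by lia.
by rewrite mul0r mulr0.
Qed.

Lemma exp_ode h : h 0%N = 0 -> Dq (fps_exp h) = Dq h * fps_exp h.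
Proof.
move=> h0; apply/fpsP => n.
pose T m := \sum_(0 <= k < m.+1) (k`!%:R)^-1 *: h ^+ k.
have eT m : eqmodq m (fps_exp h) (T m).
  move=> i le_in; rewrite coefs_exp // coefs_sum.
  rewrite -ltnS in le_in; rewrite [RHS](big_cat_nat _ le_in) //= [X in _ = _ + X]big1_seq ?addr0.
    by apply: eq_bigr => k _; rewrite coefsZ.
  move=> k /andP[_]; rewrite mem_index_iota => /andP[ltik _].
  by rewrite coefsZ coefs_expr_small // mulr0.
have DT m : Dq (T m.+1) = Dq h * T m.
  rewrite /T; elim: m => [|m IH]; last first.
    rewrite big_nat_recr // DqD IH [in RHS]big_nat_recr //= mulrDr; congr (_ + _).
    rewrite DqZ DqX scalerA -scalerAr mulrC; congr (_ *: _); last by rewrite mulrC.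
    by rewrite factS natrM invfM mulVKf ?pnatr_eq0.
  rewrite !big_nat_recr //= !big_nil !add0r expr0 expr1 !invr1 !scale1r.
  by rewrite mulr1 DqD Dq1 add0r.
rewrite coefsDq (eT n.+1) // -coefsDq DT.
by apply: (@eqmodqM n) => // i le_in; rewrite (eT n).
Qed.

Lemma rpow_ode f d : f 0%N = 1 -> powode f d (fps_rpow f d).
Proof.
move=> f0; rewrite /powode /fps_rpow exp_ode; last by rewrite coefsZ coefs_log0 // mulr0.
by rewrite DqZ -scalerAl -scalerAr mulrA log_ode.
Qed.

Lemma rpow0 f d : f 0%N = 1 -> fps_rpow f d 0%N = 1.
Proof.
move=> f0; rewrite coefs_exp ?coefsZ ?coefs_log0 ?mulr0 // big_nat1.
by rewrite expr0 coefs1 fact0 invr1 mulr1.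
Qed.

Definition bc d (k : nat) : R := \prod_(i < k) ((d - i%:R) / i.+1%:R).

Lemma bc0 d : bc d 0 = 1. Proof. by rewrite /bc big_ord0. Qed.

Lemma bcS d k : bc d k.+1 * k.+1%:R = bc d k * (d - k%:R).
Proof. by rewrite /bc big_ord_recr /= -mulrA divfK // pnatr_eq0. Qed.

Definition bser d m : fps R := FPS (fun n => if (m %| n)%N then bc d (n %/ m) else 0).

Lemma mul_Xn k f n : (fpsX ^+ k * f) n = if (k <= n)%N then f (n - k)%N else 0.
Proof.
rewrite coefsM; case: leqP => [le|lt].
  rewrite (bigD1 (inord k)) //= inordK ?ltnS // coefs_fpsXn eqxx mul1r.
  rewrite big1 ?addr0 // => i /eqP; rewrite coefs_fpsXn; case: eqP => [ik|]; last by rewrite mul0r.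
  by case; apply/val_inj; rewrite /= inordK.
rewrite big1 // => i _; rewrite coefs_fpsXn; have := ltn_ord i.
by case: eqP => [->|]; [lia|rewrite mul0r].
Qed.

Lemma bser_ode d m : (0 < m)%N -> powode (1 + fpsX ^+ m) d (bser d m).
Proof.
move=> m0; rewrite /powode DqD Dq1 add0r.
have -> : Dq (fpsX ^+ m) = m%:R *: fpsX ^+ m.
  by apply/fpsP => n; rewrite coefsZ coefsDq coefs_fpsXn; case: eqP => [->|]; rewrite ?mulr0.
rewrite -scalerAl; apply/fpsP => n.
rewrite mulrDl mul1r coefsD !coefsZ !mul_Xn !coefsDq /=.
case: leqP => [le|lt]; last first.
  rewrite !mulr0 addr0; have [->|n0] := posnP n; first by rewrite mul0r.
  by rewrite /coefs /= gtnNdvd // mulr0.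
rewrite /bser /coefs /=.
have -> : (m %| n - m)%N = (m %| n)%N by rewrite dvdn_subl.
case: ifP => [/dvdnP[q qE]|_]; last by rewrite !mulr0 addr0.
move: le; rewrite {}qE; case: q => [|q _]; first by lia.
rewrite mulnK // mulSn addKn mulnK // !natrD !natrM.
have := bcS d q; rewrite -[q.+1%:R]natr1 => E.
apply/eqP; rewrite -subr_eq0; apply/eqP.
transitivity (m%:R * (bc d q.+1 * (q%:R + 1) - bc d q * (d - q%:R))); first by ring.
by rewrite E subrr mulr0.
Qed.

(* The substitution q -> - q. *)
Definition tw f : fps R := FPS (fun n => (-1) ^+ n * f n).

Lemma twM f g : tw (f * g) = tw f * tw g.
Proof.
apply/fpsP => n; rewrite /tw {1}/coefs /= !coefsM mulr_sumr; apply: eq_bigr => i _.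
rewrite /coefs /=; have le : (i <= n)%N by rewrite -ltnS.
by rewrite -{1}(subnKC le) exprD; ring.
Qed.

Lemma Dq_tw f : Dq (tw f) = tw (Dq f).
Proof. by apply/fpsP => n; rewrite /tw /Dq /coefs /=; rewrite mulrCA. Qed.

Lemma tw_ode f d g : powode f d g -> powode (tw f) d (tw g).
Proof.
rewrite /powode !Dq_tw -!twM => ->; apply/fpsP => n.
by rewrite /tw coefsZ /coefs /= mulrCA.
Qed.

(** The m < 6 L with m = 1, 5 mod 6. All are odd, so q -> - q turns 1 - q^m into 1 + q^m. *)
Definition ms (L : nat) : seq nat := flatten [seq [:: (6 * k).+1; (6 * k).+1 + 4]%N | k <- iota 0 L].

Lemma ms_prod (S : comPzSemiRingType) L (F : nat -> S) :
  \prod_(m <- ms L) F m =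
  \prod_(k < L) F (6 * k).+1 * \prod_(k < L) F ((6 * k).+1 + 4)%N.
Proof.
rewrite /ms big_flatten big_map -big_split /= -{1}[L]subn0 -/(index_iota 0 L) big_mkord.
by apply: eq_bigr => k _; rewrite !big_cons big_nil mulr1.
Qed.

Lemma tw_Xn1 m : odd m -> tw (1 - fpsX ^+ m) = 1 + fpsX ^+ m.
Proof.
move=> om; apply/fpsP => n; rewrite /tw {1}/coefs /= coefsB coefsD coefs1 coefs_fpsXn.
case: n => [|n]; first by case: m om => //= m _; rewrite expr0 mul1r subr0 addr0.
rewrite !sub0r add0r; case: eqP => [->|_]; last by rewrite oppr0 mulr0.
by rewrite -signr_odd om expr1 mulrNN mulr1.
Qed.

Lemma tw_prod (I : Type) (r : seq I) (F : I -> fps R) :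
  tw (\prod_(i <- r) F i) = \prod_(i <- r) tw (F i).
Proof.
elim: r => [|i r IH]; last by rewrite !big_cons twM IH.
by rewrite !big_nil; apply/fpsP => -[|n]; rewrite /tw {1}/coefs /= coefs1 ?expr0 ?mul1r ?mulr0.
Qed.

Lemma ms_odd L m : m \in ms L -> odd m.
Proof. by move=> /flattenP[s /mapP[k _ ->]]; rewrite !inE => /orP[] /eqP ->; lia. Qed.

Lemma ms_gt0 L m : m \in ms L -> (0 < m)%N.
Proof. by move=> /ms_odd; case: m. Qed.

Lemma mul_1BXn f k n : (n < k)%N -> (f * (1 - fpsX ^+ k)) n = f n.
Proof. by move=> lt; rewrite mulrBr mulr1 mulrC coefsB mul_Xn leqNgt lt subr0. Qed.

Lemma qpoch_trunc r N n : (0 < r)%N -> (n < r + 6 * N)%N ->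
  qpoch (fpsX ^+ r) (fpsX ^+ 6) n = (\prod_(j < N) (1 - fpsX ^+ (r + 6 * j)) : fps R) n.
Proof.
move=> r0 lt_n; rewrite coefs_qpoch //.
have stable M : (N <= M)%N ->
    (\prod_(j < M) (1 - fpsX ^+ (r + 6 * j)) : fps R) n =
    (\prod_(j < N) (1 - fpsX ^+ (r + 6 * j)) : fps R) n.
  elim: M => [|M IH]; first by rewrite leqn0 => /eqP ->.
  rewrite leq_eqVlt => /predU1P[->//|le].
  by rewrite big_ord_recr /= mul_1BXn ?IH //; lia.
have [le_Nn|lt_nN] := leqP N n; first exact: stable.
have stable' M : (n <= M)%N ->
    (\prod_(j < M) (1 - fpsX ^+ (r + 6 * j)) : fps R) n =
    (\prod_(j < n) (1 - fpsX ^+ (r + 6 * j)) : fps R) n.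
  elim: M => [|M IH]; first by rewrite leqn0 => /eqP ->.
  rewrite leq_eqVlt => /predU1P[->//|le].
  by rewrite big_ord_recr /= mul_1BXn ?IH //; lia.
by rewrite [RHS]stable' // ltnW.
Qed.

(** Both sides solve the power equation with the same constant term and with bases equal up to
    degree n: the first omitted exponent is 6 L + 1. *)
Lemma rpow_Q6_tw d L n : (n <= 6 * L)%N ->
  (-1) ^+ n * fps_rpow Q6 d n = (\prod_(m <- ms L) bser d m) n.
Proof.
move=> le_nL; have Q0 := coefs_Q6_0 R.
transitivity (tw (fps_rpow Q6 d) n); first by [].
apply: (@powode_uniq (tw Q6) (\prod_(m <- ms L) (1 + fpsX ^+ m)) d _ _ n) => //.
- by rewrite /tw /coefs /= expr0 mul1r.
- rewrite {1}/tw {1}/coefs /= expr0 mul1r rpow0 //.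
  elim: (ms L) (@ms_gt0 L) => [|m s IH] H; first by rewrite big_nil coefs1.
  rewrite big_cons coefs0_mul0 -IH /= ?bc0 ?mulr1 //; last by move=> k ks; apply: H; rewrite inE ks orbT.
  by rewrite /bser /coefs /= dvdn0 div0n bc0.
- exact/tw_ode/rpow_ode.
- have : all (fun m => 0 < m)%N (ms L) by apply/allP => m; exact: ms_gt0.
  elim: (ms L) => [|m s IH] /=; first by rewrite !big_nil /powode Dq1 mulr0 mul0r scaler0.
  by move=> /andP[m0 /IH]; rewrite !big_cons => ?; apply: powodeM => //; exact: bser_ode.
have -> : \prod_(m <- ms L) (1 + fpsX ^+ m) = tw (\prod_(m <- ms L) (1 - fpsX ^+ m)).
  rewrite tw_prod; apply: eq_big_seq => m mL; rewrite tw_Xn1 //; exact: ms_odd mL.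
move=> i le_in; rewrite /tw /coefs /=; congr (_ * _); rewrite -/(coefs _).
rewrite ms_prod /Q6 /qpoch2; apply: (@eqmodqM n) => //.
  by move=> j lej; have := @qpoch_trunc 1 L j isT; rewrite expr1 => -> //; lia.
move=> j lej; rewrite (@qpoch_trunc 5 L j) //; last by lia.
by congr (coefs _ _); apply: eq_bigr => k _; congr (1 - fpsX ^+ _); lia.
Qed.

End PowerOde.

(** * Negative parts of the binomial series with exponent 2 + e *)

Section Bser.
Variable R : realType.
Implicit Types (f g h : fps R) (d e : R).

Definition nnfps f := forall n, 0 <= f n.

Lemma nnD f g : nnfps f -> nnfps g -> nnfps (f + g).
Proof. by move=> f0 g0 n; rewrite coefsD addr_ge0. Qed.

Lemma nnM f g : nnfps f -> nnfps g -> nnfps (f * g).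
Proof. by move=> f0 g0 n; rewrite coefsM sumr_ge0 // => i _; rewrite mulr_ge0. Qed.

Lemma nn1 : nnfps 1.
Proof. by move=> n; rewrite coefs1 ler0n. Qed.

Lemma nnX f k : nnfps f -> nnfps (f ^+ k).
Proof. by move=> f0; elim: k => [|k IH]; [exact: nn1|rewrite exprS; exact: nnM]. Qed.

Lemma nn_prod (I : Type) (r : seq I) (F : I -> fps R) :
  (forall i, nnfps (F i)) -> nnfps (\prod_(i <- r) F i).
Proof. by move=> F0; elim/big_rec: _ => [|i f _]; [exact: nn1|exact: nnM]. Qed.

Lemma coefsFPS (F : nat -> R) n : FPS F n = F n. Proof. by []. Qed.

Lemma nn_inv h : nnfps h -> h 0%N = 0 -> exists2 u, nnfps u & (1 - h) * u = 1.
Proof.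
move=> h0 h00.
exists (FPS (fun n => (\sum_(k < n.+1) h ^+ k) n)).
  by move=> n; rewrite coefsFPS coefs_sum sumr_ge0 // => k _; exact: nnX.
apply/fpsP => n.
transitivity (((1 - h) * \sum_(k < n.+1) h ^+ k) n).
  apply: (@eqmodqM _ n) => // i le_in; rewrite coefsFPS !coefs_sum.
  rewrite (big_ord_widen n.+1 (fun k => (h ^+ k) i)) // big_mkcond /=.
  by apply: eq_bigr => k _; case: ifP => // lt; rewrite coefs_expr_small //; lia.
rewrite -[1 - h]opprB mulNr -subrX1 opprB coefsB coefs_expr_small // ?subr0 //.
Qed.

Lemma bserD1 d m : (0 < m)%N -> bser (d + 1) m = (1 + fpsX ^+ m) * bser d m.
Proof.
move=> m0; apply/fpsP => n.
apply: (@powode_uniq _ (1 + fpsX ^+ m) (1 + fpsX ^+ m) (d + 1) _ _ n) => //.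
- by rewrite coefsD coefs1 coefs_fpsXn; case: m m0 => // m _; rewrite addr0.
- rewrite coefs0_mul0 coefsD coefs1 coefs_fpsXn /bser /coefs /= dvdn0 div0n !bc0.
  by case: m m0 => // m _; rewrite addr0 mul1r.
- exact: bser_ode.
- have := @bser_ode _ d m m0; rewrite /powode DqM => H.
  set P := 1 + _ in H *; set b := bser d m in H *.
  have -> : P * (Dq P * b + P * Dq b) = P * (P * Dq b) + Dq P * (P * b) by ring.
  by rewrite H scalerDl scale1r -scalerAr [P * (_ * _)]mulrCA.
Qed.

Definition gg (d : nat) : fps R := FPS (fun n => (d %| n)%N%:R).

Lemma ggE (d : nat) : (0 < d)%N -> (1 - fpsX ^+ d) * gg d = 1.
Proof.
move=> d0; apply/fpsP => n; rewrite mulrBl mul1r coefsB mul_Xn coefs1 /gg !coefsFPS.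
case: leqP => [le|lt]; first by rewrite dvdn_subl // subrr; case: n le => // d'; lia.
rewrite subr0; case: n lt => [|n] lt; first by rewrite dvdn0.
by rewrite gtnNdvd.
Qed.

(* A bound for the negative part of [(1 + X^m)^(2 + e)], which lives in the degrees
   [4 m], [6 m], [8 m], ...: at most [3/64] in degree [4 m] and [1/64] from there on. *)
Definition hh (m : nat) : fps R :=
  64^-1 *: (fpsX ^+ (4 * m) * (2 *: 1 + gg (2 * m))).

Lemma hhE m n :
  hh m n = if (4 * m <= n)%N then (2 * (n == 4 * m)%:R + (2 * m %| n)%:R) / 64 else 0.
Proof.
rewrite /hh coefsZ mul_Xn; case: leqP => le; last by rewrite mulr0.
rewrite coefsD coefsZ coefs1 /gg coefsFPS mulrC.
have -> : (n - 4 * m == 0)%N = (n == 4 * m)%N by rewrite subn_eq0 eqn_leq le andbT.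
have d4 : (2 * m %| 4 * m)%N by apply: dvdn_mul.
by rewrite (dvdn_subl le d4).
Qed.

Lemma nn_hh m : nnfps (hh m).
Proof. by move=> n; rewrite hhE; case: ifP => // _; rewrite divr_ge0 ?addr_ge0 ?mulr_ge0 ?ler0n. Qed.

Lemma hh0 m : (0 < m)%N -> hh m 0%N = 0.
Proof. by move=> m0; rewrite hhE leqn0 muln_eq0 (gtn_eqF m0). Qed.

(** From k = 3 on, the ratio (2 + e - k) / (k + 1) of consecutive coefficients is nonpositive. *)
Lemma bc_signs e i : 0 <= e <= 1 -> 0 <= bc (2 + e) (2 * i + 3) /\ bc (2 + e) (2 * i + 4) <= 0.
Proof.
move=> /andP[e0 e1].
have neg k : 0 <= bc (2 + e) (2 * k + 3) -> bc (2 + e) (2 * k + 4) <= 0.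
  move=> a0; have := bcS (2 + e) (2 * k + 3); rewrite -addnS => E.
  have k0 : 0 <= (2 * k)%:R :> R by rewrite ler0n.
  have p : 0 < (2 * k + 4)%:R :> R by rewrite ltr0n; lia.
  by rewrite -(pmulr_lle0 _ p) E mulr_ge0_le0 // natrD; lra.
suff H : 0 <= bc (2 + e) (2 * i + 3) by split=> //; exact: neg.
elim: i => [|i IH].
  have -> : bc (2 + e) (2 * 0 + 3) = (2 + e) * (1 + e) * e / 6.
    by rewrite /bc !big_ord_recr big_ord0 /=; field.
  by rewrite !mulr_ge0 ?addr_ge0 ?invr_ge0.
have b0 := neg _ IH; have := bcS (2 + e) (2 * i + 4).
rewrite (_ : (2 * i + 4).+1 = 2 * i.+1 + 3)%N => [E|]; last by lia.
have i0 : 0 <= (2 * i)%:R :> R by rewrite ler0n.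
have p : 0 < (2 * i.+1 + 3)%:R :> R by rewrite ltr0n; lia.
by rewrite -(pmulr_lge0 _ p) E mulr_le0 // natrD; lra.
Qed.

(** The exact minimum is - 1/24, at e = (sqrt 5 - 1) / 2; 3/64 is the next multiple of 1/64. *)
Lemma bc4_ge e : 0 <= e <= 1 -> - (3 / 64) <= bc (2 + e) 4.
Proof.
move=> /andP[e0 e1].
have -> : bc (2 + e) 4 = (2 + e) * (1 + e) * e * (e - 1) / 24.
  by rewrite /bc !big_ord_recr big_ord0 /=; field.
have : e * (1 - e) * ((1 + e) * (2 + e)) <= 9 / 8.
  have h : 0 <= (e - 1 / 2) ^+ 2 by exact: sqr_ge0.
  have h2 : 0 <= (e - 3 / 5) ^+ 2 by exact: sqr_ge0.
  nra.
lra.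
Qed.

Lemma bc_abs e k : 0 <= e <= 1 -> (6 <= k)%N -> `|bc (2 + e) k| <= 1 / 64.
Proof.
move=> /andP[e0 e1]; elim: k => // k IH; rewrite leq_eqVlt => /predU1P[<-|].
  (* The six factors are symmetric under e -> 1 - e and pair up: (1 + e)(2 - e) = 2 + u and (2 +
     e)(3 - e) = 6 + u. *)
  pose u := e * (1 - e).
  have -> : bc (2 + e) 6 = - (u * (2 + u) * (6 + u) / 720).
    by rewrite /bc /u !big_ord_recr big_ord0 /=; field.
  have u0 : 0 <= u by rewrite mulr_ge0 // subr_ge0.
  have u1 : u <= 1 / 4 by have := sqr_ge0 (e - 1 / 2); rewrite /u; nra.
  clearbody u; have P0 : 0 <= u * (2 + u) * (6 + u) by rewrite !mulr_ge0 ?addr_ge0.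
  rewrite normrN ger0_norm; last by lra.
  have : u * (2 + u) * (6 + u) <= 1 / 4 * 3 * 7.
    by apply: ler_pM; rewrite ?mulr_ge0 ?addr_ge0 //; [apply: ler_pM; lra | lra].
  lra.
rewrite ltnS => k6; apply: le_trans (IH k6).
have p : 0 < k.+1%:R :> R by rewrite ltr0n.
have k6R : 6 <= k%:R :> R by rewrite ler_nat.
rewrite -(ler_pM2r p) -[k.+1%:R in leLHS]ger0_norm ?ler0n // -normrM bcS normrM.
rewrite ler_wpM2l // ler_norml -natr1; apply/andP; split; lra.
Qed.

Lemma nn_ee e m : 0 <= e <= 1 -> (0 < m)%N ->
  nnfps (bser (2 + e) m - ((1 + fpsX ^+ m) ^+ 2 - hh m)).
Proof.
move=> e01 m0 n; have /andP[e0 e1] := e01.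
have -> : (1 + fpsX ^+ m) ^+ 2 = 1 + 2 *: fpsX ^+ m + fpsX ^+ (2 * m) :> fps R.
  by rewrite sqrrD expr1n mul1r mulnC exprM scaler_nat.
rewrite !coefsB !coefsD coefsZ coefs1 !coefs_fpsXn hhE /bser coefsFPS.
case: ifP => [/dvdnP[q ->]|nd]; last first.
  have ne k : (n == k * m)%N = false by apply: contraFF nd => /eqP ->; exact: dvdn_mull.
  have := ne 0%N; have := ne 1%N; rewrite mul0n mul1n => -> ->; rewrite (ne 2) (ne 4).
  have -> : (2 * m %| n)%N = false.
    by apply: contraFF nd; apply: dvdn_trans; exact: dvdn_mull.
  by case: ifP => _ /=; lra.
have eqm k : (q * m == k * m)%N = (q == k) by rewrite eqn_pmul2r.
have := eqm 0%N; have := eqm 1%N; rewrite mul0n mul1n => -> ->.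
rewrite (eqm 2) (eqm 4) leq_pmul2r // dvdn_pmul2r // dvdn2 mulnK //.
case: q {eqm} => [|[|[|[|[|[|q]]]]]] /=.
- by rewrite bc0; lra.
- by have := bcS (2 + e) 0; rewrite bc0 mulr1 => ->; lra.
- have -> : bc (2 + e) 2 = (2 + e) * (1 + e) / 2.
    by rewrite /bc !big_ord_recr big_ord0 /=; field.
  nra.
- by have [] := bc_signs 0 e01; rewrite muln0 => a _; lra.
- by have := bc4_ge e01; lra.
- by have [] := bc_signs 1 e01; rewrite muln1 => a _; lra.
rewrite negbK; case: (boolP (odd q)) => oq /=.
  have [+ _] := bc_signs q./2.+2 e01.
  rewrite (_ : 2 * q./2.+2 + 3 = q.+4.+2)%N; last first.
    by rewrite -{2}(odd_double_half q) oq -mul2n; lia.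
  by move=> a; lra.
have := bc_abs e01 (isT : 6 <= q.+4.+2)%N; rewrite ler_norml => /andP[a _]; lra.
Qed.

(* [(1 - s) (1 - h) = (1 - s - h) (1 + s h / (1 - s - h))]: the product of the [1 - h]
   may be replaced by one minus their sum, at the cost of a nonnegative factor. *)
Lemma group_factor e (s : seq nat) : 0 <= e <= 1 -> all (ltn 0) s ->
  exists2 J, nnfps J & \prod_(m <- s) bser (2 + e) m = (1 - \sum_(m <- s) hh m) * J.
Proof.
move=> e01; elim: s => [|m s IH] /=.
  by exists 1; [exact: nn1|rewrite !big_nil subr0 mulr1].
move=> /andP[m0 s0]; have [J J0 JE] := IH s0; rewrite !big_cons {}JE.
set S := \sum_(j <- s) hh j.
have S0 : nnfps S by move=> n; rewrite coefs_sum sumr_ge0 // => j _; exact: nn_hh.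
have S00 : S 0%N = 0.
  by rewrite coefs_sum big_seq big1 // => j js; apply: hh0; exact: (allP s0).
have [u u0 uE] := nn_inv (@nn_hh m) (hh0 m0).
have Sh0 : nnfps (hh m + S) by apply: nnD => //; exact: nn_hh.
have [v v0 vE] : exists2 v, nnfps v & (1 - (hh m + S)) * v = 1.
  by apply: nn_inv => //; rewrite coefsD S00 hh0 // addr0.
(* Here the square (1 + X^m)^2 is weakened to 1; what this discards goes into the nonnegative factor
   [J]. *)
pose E := bser (2 + e) m - (1 - hh m).
have E0 : nnfps E.
  have -> : E = (bser (2 + e) m - ((1 + fpsX ^+ m) ^+ 2 - hh m)) +
      (fpsX ^+ m + fpsX ^+ m + fpsX ^+ m * fpsX ^+ m) by rewrite /E; ring.
  have X0 : nnfps (fpsX ^+ m : fps R) by move=> n; rewrite coefs_fpsXn ler0n.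
  by apply: nnD; [exact: nn_ee | apply: nnD; [exact: nnD | exact: nnM]].
exists (J * (1 + E * u) * (1 + S * hh m * v)).
  apply: nnM; [apply: nnM => //|]; (apply: nnD; first exact: nn1).
    exact: nnM.
  by apply: nnM => //; apply: nnM => //; exact: nn_hh.
have -> : bser (2 + e) m = (1 - hh m) * (1 + E * u).
  by rewrite mulrDr mulr1 mulrCA uE mulr1 /E; ring.
have -> : (1 - (hh m + S)) * (J * (1 + E * u) * (1 + S * hh m * v)) =
  J * (1 + E * u) * ((1 - (hh m + S)) + S * hh m * ((1 - (hh m + S)) * v)) by ring.
by rewrite vE; ring.
Qed.

End Bser.

(* The integer computation for small indices *)
Local Close Scope ring_scope.

(* Coefficients of index below [bnd] are covered by a computation, the others by the
   saddle point estimate. *)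
Definition bnd := 1610.

Fixpoint nadd (w : N) (a b : seq N) : seq N :=
  match a, b with
  | x :: a', y :: b' => N.add x (N.mul w y) :: nadd w a' b'
  | _, _ => a
  end.

(* a + w X^d b *)
Fixpoint naddX (w : N) (d : nat) (a b : seq N) : seq N :=
  match d, a with
  | d'.+1, x :: a' => x :: naddX w d' a' b
  | _, _ => nadd w a b
  end.

(* p / (1 - X^d), d coefficients at a time: they are those of p plus the previous d ones
   [prev] of the quotient.  The fuel k is at least the length of p. *)
Fixpoint ngeo (k d : nat) (prev p : seq N) : seq N :=
  match k, p with
  | k'.+1, _ :: _ => let c := nadd 1 (take d p) prev in c ++ ngeo k' d c (drop d p)
  | _, _ => [::]
  end.

(** Adds 64 [hh m] p to the accumulator. [hh m] starts in degree 4 m, hence the guard. *)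
Definition taps (p acc : seq N) (m : nat) : seq N :=
  if 4 * m < bnd then
    naddX 1 (4 * m) (naddX 2 (4 * m) acc p) (ngeo bnd (2 * m) (nseq (2 * m) 0%num) p)
  else acc.

Definition mul1DX (p : seq N) (m : nat) : seq N := naddX 1 m p p.

Definition hsum (s : seq nat) (p : seq N) : seq N := foldl (taps p) (nseq bnd 0%num) s.

(** [N.sub] stops at 0; [nle64] is checked beforehand, so nothing is cut off. *)
Fixpoint nsub64 (p a : seq N) : seq N :=
  match p, a with
  | x :: p', y :: a' => N.sub (N.mul 64 x) y :: nsub64 p' a'
  | _, _ => [::]
  end.

Definition nle64 (p a : seq N) : bool := all2 (fun x y => N.leb y (N.mul 64 x)) p a.

(* Large [m] first keeps the numbers small in most of the steps. *)
Definition prods (L : nat) := foldl mul1DX (1%num :: nseq bnd.-1 0%num) (rev (ms L.+1)).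

(* The negative parts of the factors with [m >= 5] may all be subtracted at once, and then
   that of the factor [m = 1], except in degree 4. *)
Definition check (L : nat) : bool :=
  let f := prods L in
  let a := hsum (behead (ms L.+1)) f in
  nle64 f a &&
  let v := nsub64 f a in
  let b := mul1DX (mul1DX v 1) 1 in
  let c := hsum [:: 1] v in
  [&& nle64 (take 4 b) (take 4 c), nle64 (drop 5 b) (drop 5 c)
    & all2 N.eqb (take 5 v) [:: 64; 64; 0; 0; 0]%num].

(** The exponents in [ms 269] exhaust those below 1614, more than the degrees below [bnd]
    require. *)
Lemma checkP : check 268 = true.
Proof. vm_cast_no_check (eq_refl true). Qed.

Local Open Scope ring_scope.

(** * Correctness of the computation *)

Section Table.
Variable R : realType.
Implicit Types (f g h : fps R) (e : R).

Definition nR (x : N) : R := (nat_of_bin x)%:R.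

Lemma nRD x y : nR (N.add x y) = nR x + nR y.
Proof. rewrite /nR -natrD; congr (_%:R); lia. Qed.

Lemma nRM x y : nR (N.mul x y) = nR x * nR y.
Proof. rewrite /nR -natrM; congr (_%:R); lia. Qed.

Lemma nR1 : nR 1 = 1. Proof. by []. Qed.

Lemma nR_ge0 x : 0 <= nR x.
Proof. exact: ler0n. Qed.

Definition rep (l : seq N) f :=
  size l = bnd /\ forall n, (n < bnd)%N -> nR (nth 0%num l n) = f n.

Lemma eq_rep l f g : rep l f -> (forall n, (n < bnd)%N -> f n = g n) -> rep l g.
Proof. by move=> [sl lf] fg; split=> // n lt; rewrite lf ?fg. Qed.

Lemma size_naddX w d a b : size (naddX w d a b) = size a.
Proof.
have sz c : size (nadd w a c) = size a.
  by elim: a c => [|x a IH] [|y c] //=; rewrite IH.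
elim: d a {sz} (sz b) => [|d IH] [|x a] //= H; rewrite IH //.
by elim: a b {H IH} => [|z a IH] [|y c] //=; rewrite IH.
Qed.

Lemma nth_nadd w a b i : (i < size a)%N ->
  nth 0%num (nadd w a b) i = N.add (nth 0%num a i) (N.mul w (nth 0%num b i)).
Proof.
elim: a b i => [|x a IH] [|y b] [|i] //=; rewrite ?N.mul_0_r ?N.add_0_r //.
by move=> lt; rewrite IH.
Qed.

Lemma nth_naddX w d a b i : (i < size a)%N ->
  nth 0%num (naddX w d a b) i =
  if (d <= i)%N then N.add (nth 0%num a i) (N.mul w (nth 0%num b (i - d))) else nth 0%num a i.
Proof.
elim: d a i => [|d IH] [|x a] i //=; first by move=> lt; rewrite subn0 -nth_nadd.
by case: i => [|i] //= lt; rewrite IH // ltnS subSS.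
Qed.

Lemma rep_naddX w d a b f g : rep a f -> rep b g ->
  rep (naddX w d a b) (f + nR w *: (fpsX ^+ d * g)).
Proof.
move=> [sa af] [sb bg]; split; first by rewrite size_naddX.
move=> n lt; rewrite nth_naddX ?sa // coefsD coefsZ mul_Xn.
case: leqP => le; last by rewrite mulr0 addr0 af.
by rewrite nRD nRM af // bg //; lia.
Qed.

(** The recurrence c_i = p_i + c_(i - d) of the quotient; prepending the d entries of [prev]
    realizes the shift by d. *)
Lemma nth_ngeo k d prev p i : (0 < d)%N -> size prev = d -> (size p <= k)%N ->
  (i < size p)%N -> nth 0%num (ngeo k d prev p) i =
    N.add (nth 0%num p i) (nth 0%num (prev ++ ngeo k d prev p) i).
Proof.
move=> d0; elim: k prev p i => [|k IH] prev [|x p] i sp le lt //.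
have sc : size (nadd 1 (take d (x :: p)) prev) = size (take d (x :: p)).
  exact: (size_naddX 1 0).
have -> : ngeo k.+1 d prev (x :: p) = nadd 1 (take d (x :: p)) prev ++
    ngeo k d (nadd 1 (take d (x :: p)) prev) (drop d (x :: p)) by [].
move: (x :: p) le lt sc => l le lt.
rewrite size_take_min; set c := nadd _ _ _ => sc.
have ci j : (j < minn d (size l))%N -> nth 0%num c j = N.add (nth 0%num l j) (nth 0%num prev j).
  rewrite leq_min => /andP[jd jl].
  by rewrite nth_nadd ?size_take_min ?leq_min ?jd // nth_take // N.mul_1_l.
have [id|di] := ltnP i d.
  by rewrite !nth_cat sc sp id leq_min id lt ci // leq_min id.
have cd : size c = d by rewrite sc; apply/minn_idPl; exact: leq_trans di (ltnW lt).
rewrite [in RHS]nth_cat sp ltnNge di /= nth_cat cd ltnNge di /= IH ?size_drop ?nth_drop ?subnKC //.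
  by move: le d0; clear; lia.
by rewrite ltn_sub2r // (leq_ltn_trans di lt).
Qed.

Lemma size_ngeo k d prev p : (0 < d)%N -> (size p <= k)%N -> size (ngeo k d prev p) = size p.
Proof.
move=> d0; elim: k prev p => [|k IH] prev [|x p] // le.
rewrite [ngeo _ _ _ _]/(nadd 1 (take d (x :: p)) prev ++ _) size_cat (size_naddX 1 0) IH.
  by rewrite -size_cat cat_take_drop.
by rewrite size_drop; move: le d0; rewrite /=; lia.
Qed.

Lemma rep_ngeo d p f : (0 < d)%N -> rep p f ->
  rep (ngeo bnd d (nseq d 0%num) p) (gg R d * f).
Proof.
move=> d0 [sp pf]; have lep : (size p <= bnd)%N by rewrite sp.
split; first by rewrite size_ngeo.
have E : gg R d * f = f + fpsX ^+ d * (gg R d * f).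
  by rewrite -{2}[f]mul1r -(ggE R d0); ring.
elim/ltn_ind => n IH lt; rewrite nth_ngeo ?size_nseq ?sp // E coefsD nRD pf // mul_Xn.
congr (_ + _); rewrite nth_cat size_nseq; case: leqP => dn; first by apply: IH; lia.
by rewrite nth_nseq dn.
Qed.

Lemma rep_taps m p acc f g : (0 < m)%N -> rep p f -> rep acc g ->
  rep (taps p acc m) (g + 64 *: (hh R m * f)).
Proof.
move=> m0 pf ag; rewrite /taps.
have -> : 64 *: (hh R m * f) = 2 *: (fpsX ^+ (4 * m) * f) + fpsX ^+ (4 * m) * (gg R (2 * m) * f).
  rewrite /hh scalerAl scalerA divff ?scale1r ?pnatr_eq0 // -mulrA mulrDl mulrDr.
  by rewrite -scalerAl mul1r -scalerAr.
case: ltnP => le; last first.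
  apply: (eq_rep ag) => n lt; rewrite !coefsD coefsZ !mul_Xn leqNgt (leq_trans lt le) /=.
  by rewrite mulr0 !addr0.
have m2 : (0 < 2 * m)%N by lia.
apply: (eq_rep (rep_naddX 1 (4 * m) (rep_naddX 2 (4 * m) ag pf) (rep_ngeo m2 pf))) => n _.
by rewrite nR1 scale1r addrA.
Qed.

Lemma rep_hsum s p f : all (ltn 0) s -> rep p f ->
  rep (hsum s p) (64 *: ((\sum_(m <- s) hh R m) * f)).
Proof.
move=> s0 pf; rewrite /hsum.
suff H acc g : rep acc g ->
    rep (foldl (taps p) acc s) (g + 64 *: ((\sum_(m <- s) hh R m) * f)).
  rewrite -[64 *: _]add0r; apply: H.
  by split=> [|n lt]; rewrite ?size_nseq // nth_nseq lt coefs0.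
elim: s s0 acc g => [|m s IH] /= s0 acc g ag.
  by rewrite big_nil mul0r scaler0 addr0.
move: s0 => /andP[m0 s0]; rewrite big_cons mulrDl scalerDr addrA.
by apply: IH => //; exact: rep_taps.
Qed.

Lemma rep_mul1DX p f m : rep p f -> rep (mul1DX p m) ((1 + fpsX ^+ m) * f).
Proof.
move=> pf; apply: (eq_rep (rep_naddX 1 m pf pf)) => n _.
by rewrite nR1 scale1r mulrDl mul1r.
Qed.

Lemma rep_prods s p f : rep p f ->
  rep (foldl mul1DX p s) ((\prod_(m <- s) (1 + fpsX ^+ m)) * f).
Proof.
elim: s p f => [|m s IH] p f pf /=; first by rewrite big_nil mul1r.
apply: (eq_rep (IH _ _ (rep_mul1DX m pf))) => n _.
by rewrite big_cons; congr (coefs _ _); ring.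
Qed.

Lemma nle64_nth p a n : nle64 p a -> (n < size p)%N ->
  nR (nth 0%num a n) <= 64 * nR (nth 0%num p n).
Proof.
have -> : 64 * nR (nth 0%num p n) = nR (N.mul 64 (nth 0%num p n)) by rewrite nRM.
rewrite /nR ler_nat /nle64; elim: p a n => [|x p IH] [|y a] [|n] //=.
  by move=> /andP[+ _] _ => /N.leb_le; lia.
by move=> /andP[_ le] lt; apply: IH.
Qed.

Lemma nle64P p a f g : nle64 p a -> rep p f -> rep a g ->
  forall n, (n < bnd)%N -> g n <= 64 * f n.
Proof.
by move=> le [sp pf] [sa ag] n lt; rewrite -pf // -ag // nle64_nth // sp.
Qed.

Lemma rep_nsub64 p a f g : nle64 p a -> rep p f -> rep a g ->
  rep (nsub64 p a) (64 *: f - g).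
Proof.
move=> le pf ag; have H := nle64P le pf ag; case: pf ag => [sp pf] [sa ag].
have spa : size p = size a by rewrite sp.
split; first by rewrite -sp; elim: p a spa {le H pf sp sa ag} => [|x p IH] [|y a] //= [] /IH ->.
move=> n lt; have := H n lt; rewrite coefsB coefsZ -pf // -ag //.
have -> : nth 0%num (nsub64 p a) n = N.sub (N.mul 64 (nth 0%num p n)) (nth 0%num a n).
  have : (n < size p)%N by rewrite sp.
  clear - spa; elim: p a n spa => [|x p IH] [|y a] [|n] //= [] sz lt.
  exact: IH.
set x := nth _ p n; set y := nth _ a n.
have E : 64 * nR x = nR (N.mul 64 x) by rewrite nRM.
rewrite E /nR ler_nat => le'; rewrite -natrB //; congr (_%:R); lia.
Qed.

Lemma nn_lowM N f g : (forall n, (n < N)%N -> 0 <= f n) -> nnfps g ->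
  forall n, (n < N)%N -> 0 <= (f * g) n.
Proof.
move=> f0 g0 n lt; rewrite coefsM sumr_ge0 // => i _; rewrite mulr_ge0 // f0 //.
by have := ltn_ord i; lia.
Qed.

Lemma low_of_check L e n : check L -> 0 <= e <= 1 -> (n < bnd)%N ->
  0 <= (\prod_(m <- ms L.+1) bser (3 + e) m) n.
Proof.
move=> chk e01; pose F := \prod_(m <- ms L.+1) (1 + fpsX ^+ m) : fps R.
have s0 : all (ltn 0) (behead (ms L.+1)).
  by apply/allP => m /mem_behead; exact: ms_gt0.
have [J J0 JE] := group_factor e01 s0.
set S := \sum_(m <- _) _ in JE.
(* The factor m = 1 is kept apart: for it the square (1 + X)^2 is not given away. *)
have -> : \prod_(m <- ms L.+1) bser (3 + e) m = F * (1 - S) * bser (2 + e) 1 * J.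
  transitivity (F * \prod_(m <- ms L.+1) bser (2 + e) m).
    rewrite -big_split; apply: eq_big_seq => m /ms_gt0 m0 /=; rewrite -bserD1 //.
    by congr (bser _ _); ring.
  have E : ms L.+1 = 1%N :: behead (ms L.+1) by [].
  by rewrite [in X in _ * X]E big_cons JE; ring.
set V := F * _.
move: n; apply: nn_lowM => //.
have p64 : 0 < 64 :> R by rewrite ltr0n.
move: chk; rewrite /check.
have r0 : rep (1%num :: nseq bnd.-1 0%num) 1.
  split=> [|[|n] lt].
  - by rewrite -[size _]/(size (nseq bnd.-1 0%num)).+1 size_nseq.
  - by rewrite coefs1.
  - rewrite -[nth _ _ _]/(nth 0%num (nseq bnd.-1 0%num) n) nth_nseq coefs1.
    by case: ifP.
have rF : rep (prods L) F.
  have := rep_prods (rev (ms L.+1)) r0; rewrite mulr1 /F.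
  by rewrite (perm_big (ms L.+1)) //= perm_rev.
move: (prods L) rF => f rF; have ra := rep_hsum s0 rF.
move: (hsum _ f) ra => a ra /andP[le1]; have rv := rep_nsub64 le1 rF ra.
move: (nsub64 f a) rv => v rv.
have EV : 64 *: F - 64 *: (S * F) = 64 *: V.
  by rewrite -scalerBr; congr (_ *: _); rewrite /V; ring.
rewrite {}EV in rv; have rb := rep_mul1DX 1 (rep_mul1DX 1 rv).
have rc := rep_hsum (s := [:: 1%N]) isT rv; rewrite big_seq1 in rc.
move: (mul1DX _ 1) (hsum _ v) rb rc => b c rb rc /and3P[lt4 gt5 eq5].
have V0 n : (n < bnd)%N -> 0 <= V n.
  move=> lt; have := rv.2 n lt; rewrite coefsZ => E.
  have : 0 <= 64 * V n by rewrite -E nR_ge0.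
  by rewrite (pmulr_rge0 _ p64).
have Vlow i : (i < 5)%N -> V i = (nth 0%N [:: 1; 1; 0; 0; 0]%N i)%:R.
  move=> lt; apply: (mulfI (lt0r_neq0 p64)).
  have lt' : (i < bnd)%N by rewrite (leq_trans lt).
  rewrite -coefsZ -rv.2 //; move: eq5; case: (v) => [|w0 [|w1 [|w2 [|w3 [|w4 w']]]]]; rewrite [all2 _ _ _]/= ?andbF //.
  move=> /andP[/N.eqb_eq -> /andP[/N.eqb_eq -> /andP[/N.eqb_eq -> /andP[/N.eqb_eq -> /andP[/N.eqb_eq -> _]]]]].
  have -> : 64 = nR 64 by [].
  case: i lt {lt'} => [|[|[|[|[|i]]]]] // _.
  - exact: (nRM 64 1).
  - exact: (nRM 64 1).
  - exact: (nRM 64 0).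
  - exact: (nRM 64 0).
  - exact: (nRM 64 0).
have cle n : (n < bnd)%N -> n != 4 ->
    (hh R 1 * V) n <= ((1 + fpsX ^+ 1) ^+ 2 * V : fps R) n.
  move=> lt n4; suff : nR (nth 0%num c n) <= 64 * nR (nth 0%num b n).
    have -> : (1 + fpsX ^+ 1) ^+ 2 * V = (1 + fpsX ^+ 1) * ((1 + fpsX ^+ 1) * V).
      by rewrite expr2 mulrA.
    rewrite rc.2 // rb.2 // -!scalerAr !coefsZ (ler_pM2l p64) (ler_pM2l p64).
    exact.
  case: (ltnP n 4) => n4'.
    have := nle64_nth (n := n) lt4; rewrite size_take rb.1 !nth_take //; exact.
  have := nle64_nth (n := n - 5) gt5; rewrite size_drop rb.1 !nth_drop.
  have -> : (5 + (n - 5) = n)%N by clear - n4 n4'; lia.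
  by apply; clear - lt n4 n4'; rewrite ltn_sub2r //; lia.
(* V = 1 + X + O(X^5), so (1 + X)^2 V has no term in degree 4, while [hh 1] costs 3/64 there. The
   exact coefficient is binomial(3 + e, 4) >= 0. *)
move=> n lt; case: (eqVneq n 4%N) => [{lt}->|n4].
  rewrite coefsM !big_ord_recl big_ord0 /= !Vlow // /bser !coefsFPS !dvd1n !divn1 /=.
  rewrite /bc !big_ord_recr !big_ord0 /=.
  have /andP[e0 e1] := e01.
  set x := (X in 0 <= X).
  have -> : x = (e * (e + 1) * (e + 2) * (e + 3)) / 24 by rewrite /x; field.
  by rewrite divr_ge0 // !mulr_ge0 // addr_ge0.
have -> : V * bser (2 + e) 1 = ((1 + fpsX ^+ 1) ^+ 2 * V - hh R 1 * V)
   + (bser (2 + e) 1 - ((1 + fpsX ^+ 1) ^+ 2 - hh R 1)) * V by ring.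
rewrite coefsD addr_ge0 //; first by rewrite coefsB subr_ge0; exact: cle.
by rewrite mulrC; apply: (nn_lowM V0) => //; exact: nn_ee.
Qed.

Lemma low_nonneg e n : 0 <= e <= 1 -> (n < bnd)%N ->
  0 <= (\prod_(m <- ms 269) bser (3 + e) m) n.
Proof. exact: low_of_check checkP. Qed.

End Table.

(** * Derivatives and the mean value theorem *)

Section Calculus.
Variable R : realType.
Implicit Types (f g : R -> R) (x y a b d : R).

Lemma dv_eq f x a b : is_derive x 1 f a -> a = b -> is_derive x 1 f b.
Proof. by move=> H <-. Qed.

Lemma dvD f g x a b : is_derive x 1 f a -> is_derive x 1 g b ->
  is_derive x 1 (fun y => f y + g y) (a + b).
Proof. by move=> ? ?; exact: is_deriveD. Qed.

Lemma dvN f x a : is_derive x 1 f a -> is_derive x 1 (fun y => - f y) (- a).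
Proof. by move=> ?; exact: is_deriveN. Qed.

Lemma dvB f g x a b : is_derive x 1 f a -> is_derive x 1 g b ->
  is_derive x 1 (fun y => f y - g y) (a - b).
Proof. by move=> ? ?; exact: is_deriveB. Qed.

Lemma dvM f g x a b : is_derive x 1 f a -> is_derive x 1 g b ->
  is_derive x 1 (fun y => f y * g y) (a * g x + f x * b).
Proof.
move=> fa gb; apply: (dv_eq (is_deriveM fa gb)).
by rewrite addrC ![_ *: _]mulrC [b * _]mulrC.
Qed.

Lemma dvc (c x : R) : is_derive x 1 (fun _ => c) 0.
Proof. exact: is_derive_cst. Qed.

Lemma dvid x : is_derive x 1 (fun y => y) 1.
Proof. exact: is_derive_id. Qed.

Lemma dvo f g x a b : is_derive (g x) 1 f a -> is_derive x 1 g b ->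
  is_derive x 1 (fun y => f (g y)) (a * b).
Proof. by move=> ? ?; apply: (dv_eq (is_derive1_comp _ _)). Qed.

Lemma dvX n f x a : is_derive x 1 f a ->
  is_derive x 1 (fun y => f y ^+ n.+1) (n.+1%:R * f x ^+ n * a).
Proof.
move=> fa; have -> : (fun y => f y ^+ n.+1) = f ^+ n.+1.
  by apply/funext => y; rewrite fctE.
by apply: (dv_eq (is_deriveX n.+1 fa)).
Qed.

Lemma dv_ext f g x a : (forall y, f y = g y) -> is_derive x 1 g a -> is_derive x 1 f a.
Proof. by move=> /funext ->. Qed.

Lemma dvV f x a : f x != 0 -> is_derive x 1 f a ->
  is_derive x 1 (fun y => (f y)^-1) (- a / f x ^+ 2).
Proof.
move=> f0 fa; apply: (dv_eq (is_deriveV f0 fa)); rewrite -[_ *: _]/(_ * _).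
by rewrite !mulNr mulrC.
Qed.

Lemma mvt f df a b : a <= b ->
  (forall x, a <= x <= b -> is_derive x 1 f (df x)) ->
  exists2 c, a <= c <= b & f b - f a = df c * (b - a).
Proof.
move=> ab H.
have [] := @MVT_segment R f df a b ab.
- by move=> x; rewrite in_itv /= => /andP[? ?]; apply: H; rewrite !ltW.
- apply: derivable_within_continuous => x; rewrite in_itv /= => xab.
  by have [] := H _ xab.
by move=> c; rewrite in_itv /=; exists c.
Qed.

Lemma mvt_le f df a b (M : R) : a <= b ->
  (forall x, a <= x <= b -> is_derive x 1 f (df x)) ->
  (forall x, a <= x <= b -> `|df x| <= M) -> `|f b - f a| <= M * (b - a).
Proof.
move=> ab H HM; have [c cab ->] := mvt ab H.
by rewrite normrM (ger0_norm (_ : 0 <= b - a)) ?subr_ge0 // ler_wpM2r ?subr_ge0 // HM.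
Qed.

Lemma mvt_mono f df a b : a <= b ->
  (forall x, a <= x <= b -> is_derive x 1 f (df x)) ->
  (forall x, a <= x <= b -> 0 <= df x) -> f a <= f b.
Proof.
move=> ab H H0; have [c cab E] := mvt ab H.
by rewrite -subr_ge0 E mulr_ge0 ?subr_ge0 // H0.
Qed.

End Calculus.

(** * Truncated binomial series at a complex point z = x e^(i al) *)

Section Binomial.
Variable R : realType.
Implicit Types (x al de : R).

(** The squared modulus of 1 + x e^(i al). *)
Definition qq x al : R := 1 + 2 * x * cos al + x ^+ 2.

(* the argument of 1 + x e^(i al) *)
Definition be x al : R := atan (x * sin al / (1 + x * cos al)).

Lemma qqE x al : qq x al = (1 + x * cos al) ^+ 2 + (x * sin al) ^+ 2.
Proof. by rewrite /qq exprMn sin2cos2; ring. Qed.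

Lemma re_gt0 x al : 0 <= x < 1 -> 1 - x <= 1 + x * cos al.
Proof.
move=> /andP[x0 x1]; have := cos_geN1 al; rewrite -(ler_pM2l (_ : 0 < 1)) // => H.
rewrite lerD2l -[- x]mulrN1 ler_wpM2l //; lra.
Qed.

Lemma qq_ge x al : 0 <= x < 1 -> (1 - x) ^+ 2 <= qq x al.
Proof.
move=> x01; rewrite qqE; apply: (@le_trans _ _ ((1 + x * cos al) ^+ 2)); last by rewrite lerDl sqr_ge0.
by rewrite ler_sqr ?nnegrE; have := re_gt0 al x01; move: x01 => /andP[]; lra.
Qed.

Lemma qq_gt0 x al : 0 <= x < 1 -> 0 < qq x al.
Proof.
move=> x01; apply: lt_le_trans (qq_ge al x01); rewrite exprn_gt0 // subr_gt0.
by case/andP: x01.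
Qed.

Lemma re_pos x al : 0 <= x < 1 -> 0 < 1 + x * cos al.
Proof.
by move=> x01; apply: lt_le_trans (re_gt0 al x01); case/andP: x01; rewrite subr_gt0.
Qed.

Lemma dv_be x al : 0 <= x < 1 -> is_derive x 1 (be^~ al) (sin al / qq x al).
Proof.
move=> x01; have c0 := lt0r_neq0 (re_pos al x01).
have q0 := lt0r_neq0 (qq_gt0 al x01).
have H1 : is_derive x 1 (fun y : R => 1 + y * cos al) (cos al).
  apply: (dv_eq (dvD (dvc 1 x) (dvM (dvid x) (dvc (cos al) x)))); ring.
have H2 : is_derive x 1 (fun y : R => y * sin al) (sin al).
  apply: (dv_eq (dvM (dvid x) (dvc (sin al) x))); ring.
have H3 := dvM H2 (dvV (f := fun y => 1 + y * cos al) c0 H1).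
have H4 := dvo (f := @atan R) (g := fun y => y * sin al / (1 + y * cos al)) (is_derive1_atan _) H3.
apply: (dv_eq H4).
have -> : 1 + (x * sin al / (1 + x * cos al)) ^+ 2 = qq x al / (1 + x * cos al) ^+ 2.
  by rewrite qqE; field.
by field; rewrite c0 q0.
Qed.

Lemma dv_lnq x al : 0 <= x < 1 ->
  is_derive x 1 (fun y => ln (qq y al)) (2 * (cos al + x) / qq x al).
Proof.
move=> x01; have q0 := qq_gt0 al x01.
have H1 : is_derive x 1 (qq^~ al) (2 * (cos al + x)).
  rewrite /qq; apply: (dv_eq (dvD (dvD (dvc 1 x) (dvM (dvM (dvc 2 x) (dvid x)) (dvc (cos al) x))) (dvX 1 (dvid x)))).
  ring.
have H4 := dvo (f := @ln R) (g := qq^~ al) (is_derive1_ln q0) H1.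
by apply: (dv_eq H4); ring.
Qed.

Section Approx.
Variables (d al : R).
Hypothesis d04 : 0 <= d <= 4.

(** [Ac] + i [As] is the partial sum A of the series of (1 + z)^d; [DAc] and [DAs] are the
    derivatives in x. *)
Definition Ac J x : R := \sum_(k < J.+1) bc d k * x ^+ k * cos (k%:R * al).
Definition As J x : R := \sum_(k < J.+1) bc d k * x ^+ k * sin (k%:R * al).
Definition DAc J x : R := \sum_(k < J) bc d k * (d - k%:R) * x ^+ k * cos (k.+1%:R * al).
Definition DAs J x : R := \sum_(k < J) bc d k * (d - k%:R) * x ^+ k * sin (k.+1%:R * al).

Lemma dv_mono k c x : is_derive x 1 (fun y : R => bc d k.+1 * y ^+ k.+1 * c)
  (bc d k * (d - k%:R) * x ^+ k * c).
Proof.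
apply: (dv_eq (dvM (dvM (dvc _ x) (dvX k (dvid x))) (dvc c x))).
by rewrite -bcS; ring.
Qed.

Lemma dv_Ac J x : is_derive x 1 (Ac J) (DAc J x).
Proof.
elim: J => [|J IH].
  rewrite /DAc big_ord0; apply: dv_ext (dvc (bc d 0 * cos 0) x) => y.
  by rewrite /Ac big_ord1 expr0 mulr1 mul0r.
rewrite /DAc big_ord_recr /=; apply: dv_ext (dvD IH (dv_mono J _ x)) => y.
by rewrite /Ac big_ord_recr.
Qed.

Lemma dv_As J x : is_derive x 1 (As J) (DAs J x).
Proof.
elim: J => [|J IH].
  rewrite /DAs big_ord0; apply: dv_ext (dvc (bc d 0 * sin 0) x) => y.
  by rewrite /As big_ord1 expr0 mulr1 mul0r.
rewrite /DAs big_ord_recr /=; apply: dv_ext (dvD IH (dv_mono J _ x)) => y.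
by rewrite /As big_ord_recr.
Qed.

Lemma cosS k : cos (k.+2%:R * al) = cos al * cos (k.+1%:R * al) - sin al * sin (k.+1%:R * al).
Proof. by rewrite -cosD; congr cos; rewrite -[k.+2%:R]natr1; ring. Qed.
Lemma sinS k : sin (k.+2%:R * al) = sin al * cos (k.+1%:R * al) + cos al * sin (k.+1%:R * al).
Proof. by rewrite -sinD; congr sin; rewrite -[k.+2%:R]natr1; ring. Qed.

Lemma Ac0 x : Ac 0 x = 1.
Proof. by rewrite /Ac big_ord1 bc0 expr0 !mul1r mul0r cos0. Qed.

Lemma As0 x : As 0 x = 0.
Proof. by rewrite /As big_ord1 mul0r sin0 mulr0. Qed.

(** Real part of (1 + z) A' - d e^(i al) A = (J - d) binomial(d, J) x^J e^(i (J + 1) al): the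
    partial sum solves the equation of (1 + z)^d up to its last term. [ode_s] is the imaginary
    part. *)
Lemma ode_c J x : (1 + x * cos al) * DAc J x - x * sin al * DAs J x
    - d * (cos al * Ac J x - sin al * As J x) =
  (J%:R - d) * bc d J * x ^+ J * cos (J.+1%:R * al).
Proof.
elim: J => [|J IH].
  rewrite /DAc /DAs !big_ord0 Ac0 As0 bc0 expr0 !mulr1 mul1r; ring.
have -> : DAc J.+1 x = DAc J x + bc d J * (d - J%:R) * x ^+ J * cos (J.+1%:R * al).
  by rewrite /DAc big_ord_recr.
have -> : DAs J.+1 x = DAs J x + bc d J * (d - J%:R) * x ^+ J * sin (J.+1%:R * al).
  by rewrite /DAs big_ord_recr.
have -> : Ac J.+1 x = Ac J x + bc d J.+1 * x ^+ J.+1 * cos (J.+1%:R * al).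
  by rewrite /Ac big_ord_recr.
have -> : As J.+1 x = As J x + bc d J.+1 * x ^+ J.+1 * sin (J.+1%:R * al).
  by rewrite /As big_ord_recr.
rewrite cosS; move: IH (bcS d J) => IH B.
transitivity ((1 + x * cos al) * DAc J x - x * sin al * DAs J x
    - d * (cos al * Ac J x - sin al * As J x)
  + (bc d J * (d - J%:R)) * x ^+ J * (cos (J.+1%:R * al)
     + x * (cos al * cos (J.+1%:R * al) - sin al * sin (J.+1%:R * al)))
  - d * bc d J.+1 * x ^+ J.+1 * (cos al * cos (J.+1%:R * al) - sin al * sin (J.+1%:R * al))).
  by rewrite exprS; ring.
rewrite IH.
transitivity ((bc d J * (d - J%:R)) * x ^+ J
     * (x * (cos al * cos (J.+1%:R * al) - sin al * sin (J.+1%:R * al)))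
  - d * bc d J.+1 * x ^+ J.+1 * (cos al * cos (J.+1%:R * al) - sin al * sin (J.+1%:R * al))).
  by ring.
by rewrite -B exprS; ring.
Qed.

Lemma ode_s J x : (1 + x * cos al) * DAs J x + x * sin al * DAc J x
    - d * (cos al * As J x + sin al * Ac J x) =
  (J%:R - d) * bc d J * x ^+ J * sin (J.+1%:R * al).
Proof.
elim: J => [|J IH].
  rewrite /DAc /DAs !big_ord0 Ac0 As0 bc0 expr0 !mulr1 mul1r; ring.
have -> : DAc J.+1 x = DAc J x + bc d J * (d - J%:R) * x ^+ J * cos (J.+1%:R * al).
  by rewrite /DAc big_ord_recr.
have -> : DAs J.+1 x = DAs J x + bc d J * (d - J%:R) * x ^+ J * sin (J.+1%:R * al).
  by rewrite /DAs big_ord_recr.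
have -> : Ac J.+1 x = Ac J x + bc d J.+1 * x ^+ J.+1 * cos (J.+1%:R * al).
  by rewrite /Ac big_ord_recr.
have -> : As J.+1 x = As J x + bc d J.+1 * x ^+ J.+1 * sin (J.+1%:R * al).
  by rewrite /As big_ord_recr.
rewrite sinS; move: IH (bcS d J) => IH B.
transitivity ((1 + x * cos al) * DAs J x + x * sin al * DAc J x
    - d * (cos al * As J x + sin al * Ac J x)
  + (bc d J * (d - J%:R)) * x ^+ J * (sin (J.+1%:R * al)
     + x * (sin al * cos (J.+1%:R * al) + cos al * sin (J.+1%:R * al)))
  - d * bc d J.+1 * x ^+ J.+1 * (sin al * cos (J.+1%:R * al) + cos al * sin (J.+1%:R * al))).
  by rewrite exprS; ring.
rewrite IH.
transitivity ((bc d J * (d - J%:R)) * x ^+ J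
     * (x * (sin al * cos (J.+1%:R * al) + cos al * sin (J.+1%:R * al)))
  - d * bc d J.+1 * x ^+ J.+1 * (sin al * cos (J.+1%:R * al) + cos al * sin (J.+1%:R * al))).
  by ring.
by rewrite -B exprS; ring.
Qed.

(** From J = 1 on, the step to J + 1 multiplies by (d - (J + 1)) / (J + 1), of modulus at most 1 as
    0 <= d <= 4; the worst case is d (d - 1) <= 12 at J = 1. *)
Lemma bc_bound J : `|(J%:R - d) * bc d J| <= 12.
Proof.
elim: J => [|[|J] IH].
- by rewrite bc0 mulr1 ler_norml; move: d04 => /andP[]; lra.
- have := bcS d 0; rewrite bc0 mulr1 mul1r subr0 => ->.
  by rewrite ler_norml; move: d04 => /andP[]; nra.
- have -> : (J.+2%:R - d) * bc d J.+2 = (d - J.+2%:R) / J.+2%:R * ((J.+1%:R - d) * bc d J.+1).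
    have := bcS d J.+1; have N0 : (J.+2%:R : R) != 0 by [].
    move=> /(canRL (mulfK N0)) ->; field.
    by move: N0; rewrite -natr1 -natr1; congr (_ != _); ring.
  rewrite normrM -[12]mul1r ler_pM // normrM normfV [`|J.+2%:R|]ger0_norm //.
  rewrite ler_pdivrMr // mul1r ler_norml.
  have : (2:R) <= J.+2%:R by rewrite ler_nat.
  by move: d04 => /andP[]; lra.
Qed.

(* [rho] times the unit of phase [- d * be] is the inverse of the principal
   branch of [(1 + x e^(i al))^d]. *)
Definition rho x : R := expR (- (d / 2) * ln (qq x al)).

Lemma dv_rho x : 0 <= x < 1 ->
  is_derive x 1 rho (- d * (cos al + x) / qq x al * rho x).
Proof.
move=> x01; apply: dv_eq (dvo (f := @expR R) (is_derive_expR _)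
  (dvM (dvc (- (d / 2)) x) (dv_lnq al x01))) _.
by rewrite -/(rho x); have := lt0r_neq0 (qq_gt0 al x01) => ?; field.
Qed.

Lemma dv_dbe x : 0 <= x < 1 ->
  is_derive x 1 (fun y => d * be y al) (d * sin al / qq x al).
Proof. by move=> x01; apply: dv_eq (dvM (dvc d x) (dv_be al x01)) _; ring. Qed.

(** [Uc] + i [Us] is A (1 + z)^(- d), which should be close to 1. *)
Definition Uc J x := rho x * (Ac J x * cos (d * be x al) + As J x * sin (d * be x al)).
Definition Us J x := rho x * (As J x * cos (d * be x al) - Ac J x * sin (d * be x al)).

(** By the equations for A, only the defect term survives, multiplied by (1 + z)^(- d - 1). *)
Lemma dv_U J x : 0 <= x < 1 ->
  let E := (J%:R - d) * bc d J * x ^+ J in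
  let th := J.+1%:R * al - d * be x al in
  is_derive x 1 (Uc J) (rho x / qq x al * E *
     ((1 + x * cos al) * cos th + x * sin al * sin th)) /\
  is_derive x 1 (Us J) (rho x / qq x al * E *
     ((1 + x * cos al) * sin th - x * sin al * cos th)).
Proof.
move=> x01 E th; have q0 := lt0r_neq0 (qq_gt0 al x01).
have dT := dv_dbe x01.
have dc := dvo (f := @cos R) (is_derive_cos _) dT.
have ds := dvo (f := @sin R) (is_derive_sin _) dT.
have Ec := ode_c J x; have Es := ode_s J x.
have qE := qqE x al.
have {}Ec : E * cos (J.+1%:R * al) = (1 + x * cos al) * DAc J x - x * sin al * DAs J x
    - d * (cos al * Ac J x - sin al * As J x) by rewrite Ec.
have {}Es : E * sin (J.+1%:R * al) = (1 + x * cos al) * DAs J x + x * sin al * DAc J x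
    - d * (cos al * As J x + sin al * Ac J x) by rewrite Es.
have cs := cos2Dsin2 al.
have e1 : DAc J x = (d * ((cos al + x) * Ac J x - sin al * As J x)
   + (1 + x * cos al) * (E * cos (J.+1%:R * al)) + x * sin al * (E * sin (J.+1%:R * al))) / qq x al.
  apply: (mulIf q0); rewrite mulfVK // Ec Es qE.
  transitivity (DAc J x * ((1 + x * cos al) ^+ 2 + (x * sin al) ^+ 2)
    + d * x * Ac J x * (1 - (cos al ^+ 2 + sin al ^+ 2))); last by ring.
  by rewrite cs subrr mulr0 addr0.
have e2 : DAs J x = (d * ((cos al + x) * As J x + sin al * Ac J x)
   + (1 + x * cos al) * (E * sin (J.+1%:R * al)) - x * sin al * (E * cos (J.+1%:R * al))) / qq x al.
  apply: (mulIf q0); rewrite mulfVK // Ec Es qE.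
  transitivity (DAs J x * ((1 + x * cos al) ^+ 2 + (x * sin al) ^+ 2)
    + d * x * As J x * (1 - (cos al ^+ 2 + sin al ^+ 2))); last by ring.
  by rewrite cs subrr mulr0 addr0.
rewrite /th cosB sinB.
split.
  apply: dv_eq (dvM (dv_rho x01) (dvD (dvM (dv_Ac J x) dc) (dvM (dv_As J x) ds))) _.
  by rewrite e1 e2; field.
apply: dv_eq (dvM (dv_rho x01) (dvB (dvM (dv_As J x) dc) (dvM (dv_Ac J x) ds))) _.
by rewrite e1 e2; field.
Qed.

Lemma U0 J : Uc J 0 = 1 /\ Us J 0 = 0.
Proof.
have a0 : Ac J 0 = 1.
  rewrite /Ac big_ord_recl big1 => [|k _]; last by rewrite lift0 exprS mul0r mulr0 mul0r.
  by rewrite /= bc0 expr0 mul0r cos0 !mulr1 addr0.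
have s0 : As J 0 = 0.
  rewrite /As big_ord_recl big1 => [|k _]; last by rewrite lift0 exprS mul0r mulr0 mul0r.
  by rewrite /= mul0r sin0 mulr0 addr0.
have b0 : be 0 al = 0 by rewrite /be mul0r mul0r atan0.
have r0 : rho 0 = 1 by rewrite /rho /qq mulr0 mul0r expr0n /= !addr0 ln1 mulr0 expR0.
by rewrite /Uc /Us a0 s0 b0 r0 mulr0 cos0 sin0; split; ring.
Qed.

(** Mean value theorem from x = 0. 36 is 12, from [bc_bound], times 3, from the trigonometric
    bracket; (1 - r)^(- 4) bounds [rho] and (1 - r)^(- 2) bounds 1 / [qq]. The bound is uniform in
    al. *)
Lemma U_bound r J x : 0 <= r < 1 -> 0 <= x <= r ->
  let C := 36 * (expR (- 4 * ln (1 - r)) / (1 - r) ^+ 2) * r ^+ J in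
  `|Uc J x - 1| <= C /\ `|Us J x| <= C.
Proof.
move=> /andP[r0 r1] /andP[x0 xr] C.
have key y : 0 <= y <= x -> 0 <= y < 1 /\
    forall a b : R, `|a| <= 1 -> `|b| <= 1 ->
    `|rho y / qq y al * ((J%:R - d) * bc d J * y ^+ J) *
       ((1 + y * cos al) * a + y * sin al * b)| <= C.
  move=> /andP[y0 yx]; have y01 : 0 <= y < 1 by rewrite y0 (le_lt_trans _ r1) // (le_trans yx).
  split=> // a b a1 b1; have q0 := qq_gt0 al y01.
  have r1' : 0 < 1 - r by lra.
  have yr : y <= r by apply: le_trans xr.
  have q1 : (1 - r) ^+ 2 <= qq y al.
    apply: le_trans (qq_ge al y01); rewrite ler_sqr ?nnegrE; lra.
  have rh : `|rho y| <= expR (- 4 * ln (1 - r)).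
    rewrite ger0_norm ?expR_ge0 // ler_expR.
    have : ln ((1 - r) ^+ 2) <= ln (qq y al) by rewrite ler_ln ?posrE ?exprn_gt0.
    rewrite lnXn // -mulr_natl => lq.
    have l0 : ln (1 - r) <= 0 by rewrite ln_le0 //; lra.
    move: d04 => /andP[d0 d4]; nra.
  have qi : `|(qq y al)^-1| <= ((1 - r) ^+ 2)^-1.
    rewrite ger0_norm; last by rewrite invr_ge0 ltW.
    by rewrite lef_pV2 // posrE exprn_gt0.
  have yJ : `|y ^+ J| <= r ^+ J by rewrite ger0_norm ?exprn_ge0 // lerXn2r ?nnegrE.
  have n1 : `|(1 + y * cos al) * a + y * sin al * b| <= 3.
    apply: le_trans (ler_normD _ _) _; rewrite !normrM.
    have s1 : `|sin al| <= 1 by rewrite ler_norml sin_geN1 sin_le1.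
    have c1 : `|1 + y * cos al| <= 2.
      rewrite ger0_norm ?ltW ?re_pos //; have := cos_le1 al; nra.
    have ya : `|y| <= 1 by rewrite ger0_norm //; lra.
    rewrite (_ : 3 = 2 * 1 + 1 * 1 * 1); last by ring.
    by apply: lerD; rewrite !ler_pM ?mulr_ge0.
  rewrite /C (_ : 36 * _ * _ = expR (- 4 * ln (1 - r)) / (1 - r) ^+ 2 * (12 * r ^+ J) * 3); last by ring.
  rewrite normrM ler_pM // normrM ler_pM // normrM ler_pM //.
  exact: bc_bound.
have C0 : 0 <= C by rewrite !mulr_ge0 ?expR_ge0 ?invr_ge0 ?exprn_ge0 //; lra.
have x1 : x <= 1 by lra.
have [uc us] := U0 J.
have tr (v : R) : `|cos v| <= 1 /\ `|sin v| <= 1 by rewrite !ler_norml cos_geN1 cos_le1 sin_geN1 sin_le1.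
have der y : 0 <= y <= x -> 0 <= y < 1 by move=> /key[].
split.
  have := mvt_le (M := C) x0 (fun y xy => (dv_U J (der y xy)).1).
  rewrite uc subr0 => H; apply: le_trans (H _) _; last by rewrite ler_piMr.
  move=> y xy; have [_ b] := key y xy.
  by have [ct st] := tr (J.+1%:R * al - d * be y al); exact: b.
have := mvt_le (M := C) x0 (fun y xy => (dv_U J (der y xy)).2).
rewrite us !subr0 => H; apply: le_trans (H _) _; last by rewrite ler_piMr.
move=> y xy; have [_ b] := key y xy.
set th := J.+1%:R * al - d * be y al; have [ct st] := tr th.
by have := b (sin th) (- cos th); rewrite mulrN normrN => /(_ st ct).
Qed.

Lemma AsAc_U J x : 0 <= x < 1 ->
  let T := d * be x al in
  Ac J x = expR (d / 2 * ln (qq x al)) * (Uc J x * cos T - Us J x * sin T) /\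
  As J x = expR (d / 2 * ln (qq x al)) * (Uc J x * sin T + Us J x * cos T).
Proof.
move=> x01 T; have E : expR (d / 2 * ln (qq x al)) * rho x = 1.
  by rewrite /rho -expRD -mulrDl subrr mul0r expR0.
have cs := cos2Dsin2 T; rewrite /Uc /Us -/T.
split.
  transitivity (expR (d / 2 * ln (qq x al)) * rho x * Ac J x * (cos T ^+ 2 + sin T ^+ 2)).
    by rewrite E cs mul1r mulr1.
  by ring.
transitivity (expR (d / 2 * ln (qq x al)) * rho x * As J x * (cos T ^+ 2 + sin T ^+ 2)).
  by rewrite E cs mul1r mulr1.
by ring.
Qed.

End Approx.
End Binomial.

(** * Coefficients of polynomials as averages over a circle *)

Section Polar.
Variable R : realType.
Implicit Types (a b t : R) (z w : R[i]).

Definition cis t : R[i] := Complex (cos t) (sin t).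

Lemma cisD a b : cis (a + b) = cis a * cis b.
Proof.
apply/eqP; rewrite eq_complex; apply/andP; split; apply/eqP; first exact: cosD.
by rewrite [LHS]sinD addrC.
Qed.

Lemma cis0 : cis 0 = 1.
Proof. by rewrite /cis cos0 sin0. Qed.

Lemma cisX n a : cis a ^+ n = cis (n%:R * a).
Proof.
elim: n => [|n IH]; first by rewrite expr0 mul0r cis0.
by rewrite exprS IH -cisD -natr1; congr cis; ring.
Qed.

Lemma Re_add z w : complex.Re (z + w) = complex.Re z + complex.Re w.
Proof. by case: z => a b; case: w. Qed.

Lemma Re_sum (I : Type) (r : seq I) (F : I -> R[i]) :
  complex.Re (\sum_(i <- r) F i) = \sum_(i <- r) complex.Re (F i).
Proof. by elim/big_rec2: _ => // i y x _ <-; rewrite Re_add. Qed.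

Lemma sum_complex (I : Type) (r : seq I) (F G : I -> R) :
  \sum_(i <- r) Complex (F i) (G i) = Complex (\sum_(i <- r) F i) (\sum_(i <- r) G i) :> R[i].
Proof. by elim: r => [|i r IH]; rewrite ?big_nil // !big_cons IH. Qed.

Lemma Re_scal a z : complex.Re ((real_complex R a) * z) = a * complex.Re z.
Proof. by case: z => x y /=; rewrite mul0r subr0. Qed.

Definition ev (p : {poly R}) z := (map_poly (real_complex R) p).[z].

Lemma ev_prod (I : Type) (s : seq I) (F : I -> {poly R}) z :
  ev (\prod_(i <- s) F i) z = \prod_(i <- s) ev (F i) z.
Proof. by rewrite /ev rmorph_prod horner_prod. Qed.

Lemma ev_polar (p : {poly R}) r t n :
  complex.Re (ev p (real_complex R r * cis t) * cis (- (n%:R * t))) =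
  \sum_(k < size p) p`_k * r ^+ k * cos ((k%:R - n%:R) * t).
Proof.
rewrite /ev horner_coef size_map_poly mulr_suml Re_sum; apply: eq_bigr => k _.
rewrite coef_map exprMn cisX -rmorphXn -!mulrA mulrA -rmorphM -cisD Re_scal -!mulrA; congr (_ * (_ * _)).
by rewrite /cis /=; congr cos; ring.
Qed.

Lemma dirichlet K (t : R) :
  sin (t / 2) * (1 + 2 * \sum_(j < K) cos (j.+1%:R * t)) = sin ((K%:R + 1 / 2) * t).
Proof.
elim: K => [|K IH].
  by rewrite big_ord0 mulr0 addr0 mulr1; congr sin; ring.
rewrite big_ord_recr /= [2 * _]mulrDr addrA mulrDr IH.
have -> : (K%:R + 1 / 2) * t = K.+1%:R * t - t / 2 by rewrite -natr1; field.
have -> : (K.+1%:R + 1 / 2) * t = K.+1%:R * t + t / 2 by field.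
by rewrite sinB sinD; ring.
Qed.

Lemma sin_npi (k : int) : sin (k%:~R * pi : R) = 0.
Proof.
have H n : sin (n%:R * pi : R) = 0.
  by elim: n => [|n IH]; rewrite ?mul0r ?sin0 // -natr1 mulrDl mul1r sinDpi IH oppr0.
case: k => n; first exact: H.
by rewrite NegzE mulrNz mulNr sinN H oppr0.
Qed.

(** Of the 2K + 1 nodes only 0 <= j <= K are used, the others being conjugate; with an odd number of
    nodes pi is not one of them. *)
Definition ang (K j : nat) : R := 2 * pi * j%:R / (2 * K%:R + 1).

Lemma ang_gt0 K j : (0 < j)%N -> 0 < ang K j.
Proof.
move=> j0; rewrite /ang divr_gt0 ?mulr_gt0 ?pi_gt0 ?ltr0n //.
Qed.

Lemma ang_ltpi K j : (j <= K)%N -> ang K j < pi.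
Proof.
move=> jK; have K0 : 0 < 2 * K%:R + 1 :> R by have := ler0n R K; lra.
rewrite /ang ltr_pdivrMr // [2 * pi]mulrC -mulrA ltr_pM2l ?pi_gt0 //.
have : j%:R <= K%:R :> R by rewrite ler_nat.
lra.
Qed.

Lemma dirichlet_ang K (k n : nat) : (k < 2 * K + 1)%N -> (n < 2 * K + 1)%N ->
  1 + 2 * \sum_(j < K) cos ((k%:R - n%:R) * ang K j.+1) =
  if k == n then 2 * K%:R + 1 else 0.
Proof.
move=> kN nN; have K0 : 0 < 2 * K%:R + 1 :> R by have := ler0n R K; lra.
case: eqP => [->|/eqP kn].
  under eq_bigr do rewrite subrr mul0r cos0.
  by rewrite sumr_const card_ord; ring.
set t : R := (k%:R - n%:R) * (2 * pi / (2 * K%:R + 1)).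
have -> : \sum_(j < K) cos ((k%:R - n%:R) * ang K j.+1) = \sum_(j < K) cos (j.+1%:R * t).
  by apply: eq_bigr => j _; congr cos; rewrite /ang /t; ring.
have s0 : sin (t / 2) != 0.
  have H (u v : nat) : (u < v)%N -> (v < 2 * K + 1)%N ->
      sin ((v%:R - u%:R) * (2 * pi / (2 * K%:R + 1)) / 2 : R) != 0.
    move=> uv vN; have uv' : u%:R < v%:R :> R by rewrite ltr_nat.
    have vN' : v%:R < 2 * K%:R + 1 :> R by rewrite -natrM natr1 ltr_nat; lia.
    set x := (X in sin X); have -> : x = (v%:R - u%:R) / (2 * K%:R + 1) * pi :> R.
      by rewrite /x; field; exact: lt0r_neq0.
    apply/lt0r_neq0/sin_gt0_pi.
    rewrite mulr_gt0 ?pi_gt0 ?divr_gt0 ?subr_gt0 //=.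
    rewrite gtr_pMl ?pi_gt0 // ltr_pdivrMr // mul1r.
    by have := ler0n R u; lra.
  have [lt|lt|E] := ltngtP k n; last by rewrite E eqxx in kn.
    have -> : t / 2 = - ((n%:R - k%:R) * (2 * pi / (2 * K%:R + 1)) / 2) by rewrite /t; ring.
    by rewrite sinN oppr_eq0 H.
  exact: H.
apply: (mulfI s0); rewrite dirichlet mulr0.
have -> : (K%:R + 1 / 2) * t = (k%:Z - n%:Z)%:~R * pi.
  rewrite /t rmorphB /= !pmulrn; field; exact: lt0r_neq0.
exact: sin_npi.
Qed.

(** Exact, since 2K + 1 nodes separate all exponents up to 2K. *)
Lemma fourier (p : {poly R}) r n K : (size p <= 2 * K + 1)%N -> (n < 2 * K + 1)%N ->
  let A t := complex.Re (ev p (real_complex R r * cis t) * cis (- (n%:R * t))) in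
  A 0 + 2 * \sum_(j < K) A (ang K j.+1) = (2 * K%:R + 1) * (p`_n * r ^+ n).
Proof.
move=> sp nK A.
have AE t : A t = \sum_(k < size p) p`_k * r ^+ k * cos ((k%:R - n%:R) * t) by exact: ev_polar.
clearbody A; under eq_bigr do rewrite AE.
rewrite AE.
rewrite exchange_big /= mulr_sumr -big_split /=.
transitivity (\sum_(k < size p) p`_k * r ^+ k * (if k == n :> nat then 2 * K%:R + 1 else 0)).
  apply: eq_bigr => k _; rewrite -(@dirichlet_ang K k n) //; last exact: leq_trans (ltn_ord k) sp.
  by rewrite -mulr_sumr mulr0 cos0; ring.
have [lt|le] := ltnP n (size p).
  rewrite (bigD1 (Ordinal lt)) //= eqxx big1 ?addr0 1?mulrC // => k kn.
  by rewrite -val_eqE /= in kn; rewrite (negPf kn) mulr0.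
rewrite nth_default // mul0r mulr0 big1 // => k _.
by have -> : (k == n :> nat) = false; [have := ltn_ord k; lia | rewrite mulr0].
Qed.

(** For the larger of |Re z - 1| and |Im z|, one plus twice the distance is submultiplicative. The
    factor 6^size is crude, but the number of factors is fixed while e may be taken arbitrarily
    small. *)
Lemma cprod_close (I : eqType) (s : seq I) (F : I -> R[i]) (e : R) : 0 <= e <= 1 ->
  (forall i, i \in s -> `|complex.Re (F i) - 1| <= e /\ `|complex.Im (F i)| <= e) ->
  let z := \prod_(i <- s) F i in
  `|complex.Re z - 1| <= 6 ^+ size s * e /\ `|complex.Im z| <= 6 ^+ size s * e.
Proof.
move=> /andP[e0 e1] H /=.
suff : exists2 d, 0 <= d <= ((1 + 2 * e) ^+ size s - 1) / 2 &
    `|complex.Re (\prod_(i <- s) F i) - 1| <= d /\ `|complex.Im (\prod_(i <- s) F i)| <= d.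
  move=> [d /andP[d0 d1] [d2 d3]].
  have B k : (1 + 2 * e) ^+ k <= 1 + 2 * (6 ^+ k * e).
    elim: k => [|k IH]; first by rewrite !expr0; lra.
    have k1 : 1 <= (6 : R) ^+ k by rewrite exprn_ege1 //; lra.
    rewrite !exprS; apply: (le_trans (ler_wpM2l _ IH)); first by lra.
    have : 6 ^+ k * e * e <= 6 ^+ k * e by rewrite ler_piMr // mulr_ge0 // exprn_ge0.
    have : e <= 6 ^+ k * e by rewrite ler_peMl.
    by nra.
  have := B (size s); split; [apply: le_trans d2 _ | apply: le_trans d3 _]; lra.
elim: s H => [|i s IH] H.
  exists 0; first by rewrite expr0 subrr mul0r lexx.
  by rewrite big_nil /= subrr normr0.
have [|d /andP[d0 d1] [d2 d3]] := IH.
  by move=> j js; apply: H; rewrite inE js orbT.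
have [h1 h2] : `|complex.Re (F i) - 1| <= e /\ `|complex.Im (F i)| <= e by apply: H; rewrite inE eqxx.
rewrite big_cons; move: d2 d3; set z := \prod_(j <- s) F j => d2 d3.
exists (e + d + 2 * e * d).
  rewrite [size (_ :: _)]/= exprS; apply/andP; split; first by rewrite !addr_ge0 ?mulr_ge0.
  by move: d1; set q := _ ^+ _ => d1; nra.
case: (F i) z h1 h2 d2 d3 => a b [a' b'] /= h1 h2 d2 d3; split.
  rewrite (_ : _ - 1 = (a - 1) + (a' - 1) + (a - 1) * (a' - 1) - b * b'); last by ring.
  have n1 : `|(a - 1) * (a' - 1)| <= e * d by rewrite normrM ler_pM.
  have n2 : `|b * b'| <= e * d by rewrite normrM ler_pM.
  move: h1 d2 n1 n2; rewrite !ler_norml => /andP[? ?] /andP[? ?] /andP[? ?] /andP[? ?].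
  apply/andP; split; lra.
rewrite (_ : a * b' + b * a' = b + b' + (a - 1) * b' + b * (a' - 1)); last by ring.
have n1 : `|(a - 1) * b'| <= e * d by rewrite normrM ler_pM.
have n2 : `|b * (a' - 1)| <= e * d by rewrite normrM ler_pM.
move: h2 d3 n1 n2; rewrite !ler_norml => /andP[? ?] /andP[? ?] /andP[? ?] /andP[? ?].
apply/andP; split; lra.
Qed.

Definition bpoly (d : R) J m : {poly R} := \sum_(k < J.+1) bc d k *: 'X^(m * k).

Lemma coef_bpoly d J m i : (0 < m)%N -> (i <= J)%N -> (bpoly d J m)`_i = bser d m i.
Proof.
move=> m0 iJ; rewrite /bpoly coef_sum /bser /coefs.
under eq_bigr do rewrite coefZ coefXn.
case: ifP => [/dvdnP[q E]|nd]; last first.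
  rewrite big1 // => k _; case: eqP => [E|]; last by rewrite mulr0.
  by rewrite E dvdn_mulr in nd.
have qJ : (q < J.+1)%N by rewrite ltnS; apply: leq_trans iJ; rewrite E leq_pmulr.
rewrite E mulnK // (bigD1 (Ordinal qJ)) //= mulnC eqxx mulr1 big1 ?addr0 // => k kq.
rewrite -val_eqE /= in kq; rewrite eqn_pmul2l // eq_sym (negPf kq) mulr0.
by [].
Qed.

Lemma coef_bpoly_prod d J (s : seq nat) i : all (fun m => 0 < m)%N s -> (i <= J)%N ->
  (\prod_(m <- s) bpoly d J m)`_i = (\prod_(m <- s) bser d m : fps R) i.
Proof.
elim: s i => [|m s IH] i /=; first by rewrite !big_nil coef1 coefs1.
move=> /andP[m0 s0] iJ; rewrite !big_cons coefM coefsM; apply: eq_bigr => k _.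
have ki : (k <= i)%N by rewrite -ltnS.
by rewrite coef_bpoly ?IH //; lia.
Qed.

Lemma ev_bpoly d J m r t :
  ev (bpoly d J m) (real_complex R r * cis t) =
  Complex (Ac d (m%:R * t) J (r ^+ m)) (As d (m%:R * t) J (r ^+ m)).
Proof.
have E : ev (bpoly d J m) (real_complex R r * cis t) =
  \sum_(k < J.+1) real_complex R (bc d k * (r ^+ m) ^+ k) * cis (k%:R * (m%:R * t)).
  rewrite /ev /bpoly raddf_sum horner_sum; apply: eq_bigr => k _.
  rewrite /= map_polyZ map_polyXn hornerZ hornerXn exprM exprMn cisX exprMn cisX.
  rewrite rmorphM !rmorphXn mulrA.
  by rewrite -[RHS]mulrA.
rewrite E /Ac /As -sum_complex; apply: eq_bigr => k _.
by apply/eqP; rewrite eq_complex /= !mul0r subr0 addr0 !eqxx.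
Qed.

End Polar.

(** * Riemann sums of step functions *)

Section Counting.
Variable R : realType.

Lemma count_bounds K (t : R) : 0 <= t -> t <= K%:R + 1 ->
  t - 1 <= \sum_(j < K) (if j.+1%:R <= t then 1 else 0) <= t.
Proof.
move=> t0 tK; apply/andP; split; last first.
  elim: K {tK} => [|K IH]; first by rewrite big_ord0.
  rewrite big_ord_recr /=; case: ifP => [le|_]; last by rewrite addr0.
  apply: le_trans le; rewrite -[K.+1%:R]natr1 lerD2r.
  rewrite -[K in K%:R](card_ord K) -sumr_const ler_sum // => j _.
  by case: ifP.
elim: K tK => [|K IH] tK; first by rewrite big_ord0; lra.
have [le|lt] := leP K.+1%:R t.
  have -> : \sum_(j < K.+1) (if j.+1%:R <= t then 1 else 0) = K.+1%:R :> R.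
    rewrite -[K.+1 in RHS](card_ord K.+1) -sumr_const; apply: eq_bigr => j _.
    by rewrite (le_trans _ le) // ler_nat.
  lra.
have nle : (K.+1%:R <= t) = false by apply/negbTE; rewrite -ltNge.
rewrite big_ord_recr /= nle addr0; apply: IH.
by rewrite natr1 ltW.
Qed.

(* [area s] is the integral of [step s] over the positive axis. *)
Definition step (s : seq (R * R)) (t : R) : R :=
  \sum_(cb <- s) cb.1 * (if t <= cb.2 then 1 else 0).

Definition area (s : seq (R * R)) : R := \sum_(cb <- s) cb.1 * cb.2.

(** Each jump miscounts the nodes by at most one, so the error does not grow with K. *)
Lemma riemann_step K (s : seq (R * R)) : all (fun cb => 0 <= cb.2 <= pi) s ->
  (2 * K%:R + 1) * area s / (2 * pi) - \sum_(cb <- s) `|cb.1| <=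
  \sum_(j < K) step s (ang R K j.+1).
Proof.
move=> /allP sb; rewrite /step exchange_big /= /area.
rewrite mulr_sumr mulr_suml -sumrB; rewrite big_seq [leRHS]big_seq; apply: ler_sum => -[c b] /sb /= /andP[b0 bpi].
have K0 : 0 < 2 * K%:R + 1 :> R by have := ler0n R K; lra.
have p0 := pi_gt0 R.
rewrite -mulr_sumr; set t := (2 * K%:R + 1) * b / (2 * pi).
have -> : \sum_(j < K) (if ang R K j.+1 <= b then 1 else 0) =
          \sum_(j < K) (if j.+1%:R <= t then 1 else 0) :> R.
  apply: eq_bigr => j _; congr (if _ then _ else _); rewrite /ang /t.
  rewrite ler_pdivrMr // ler_pdivlMr ?mulr_gt0 //.
  by congr (_ <= _); ring.
have /andP[lo hi] : t - 1 <= \sum_(j < K) (if j.+1%:R <= t then 1 else 0) <= t.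
  apply: count_bounds; first by rewrite /t divr_ge0 ?mulr_ge0 // ltW.
  rewrite /t ler_pdivrMr ?mulr_gt0 //.
  apply: (@le_trans _ _ ((2 * K%:R + 1) * pi)); first by rewrite ler_pM2l.
  by nra.
rewrite (_ : (2 * K%:R + 1) * (c * b) / (2 * pi) = c * t); last by rewrite /t; ring.
have [c0|c0] := leP 0 c; [rewrite ger0_norm // | rewrite ltr0_norm //]; nra.
Qed.

Lemma expr_small (r e : R) : 0 <= r < 1 -> 0 < e -> exists J, r ^+ J < e.
Proof.
move=> /andP[r0 r1] e0.
have : ((fun n => r ^+ n) @ \oo --> (0 : R))%classic by apply: cvg_expr; rewrite ger0_norm.
move=> /cvgrPdist_lt /(_ e e0) [N _ /(_ N (leqnn N))] /=.
by rewrite sub0r normrN ger0_norm ?exprn_ge0 //; exists N.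
Qed.

End Counting.

(** * A positivity criterion for the coefficients *)

Section Criterion.
Variable R : realType.
Variables (d r : R) (L n : nat).
Hypotheses (d04 : 0 <= d <= 4) (r01 : 0 < r < 1).

(** The modulus of the product of the (1 + z)^d on the circle of radius r, normalized by its value
    [mod0] at t = 0. *)
Definition modulus (t : R) : R :=
  expR (\sum_(m <- ms L) d / 2 * (ln (qq (r ^+ m) (m%:R * t)) - ln (qq (r ^+ m) 0))).

Definition phase (t : R) : R := d * \sum_(m <- ms L) be (r ^+ m) (m%:R * t).

Definition mod0 : R := expR (\sum_(m <- ms L) d / 2 * ln (qq (r ^+ m) 0)).

Lemma rX01 m : (0 < m)%N -> 0 <= r ^+ m < 1.
Proof.
case/andP: r01 => r0 r1 m0.
by rewrite exprn_ge0 ?ltW //= exprn_ilt1 // ?ltW // -lt0n.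
Qed.

Lemma rX_le m : (0 < m)%N -> r ^+ m <= r.
Proof.
case/andP: r01 => r0 r1; case: m => // m _.
rewrite exprS; apply: ler_piMr; first exact: ltW.
by apply: exprn_ile1; exact: ltW.
Qed.

Lemma modulus_le1 t : modulus t <= 1.
Proof.
rewrite /modulus -[leRHS]expR0 ler_expR big_seq; apply: sumr_le0 => m /ms_gt0 m0.
have x01 := rX01 m0; rewrite mulr_ge0_le0 ?divr_ge0 //; first by case/andP: d04.
rewrite subr_le0 ler_ln ?posrE ?qq_gt0 // /qq cos0.
have := cos_le1 (m%:R * t); case/andP: x01 => x0 _ c1.
move: (r ^+ m) (cos _) x0 c1 => x c x0 c1; have := ler_piMr x0 c1; lra.
Qed.

Lemma value_close (e : R) : 0 < e -> exists2 J, (n <= J)%N & forall t,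
  mod0 * modulus t * (cos (phase t - n%:R * t) - e) <=
  complex.Re (ev (\prod_(m <- ms L) bpoly d J m) (real_complex R r * cis t) *
      cis (- (n%:R * t))).
Proof.
move=> e0; case/andP: (r01) => r0 r1.
set C := 36 * (expR (- 4 * ln (1 - r)) / (1 - r) ^+ 2).
have C0 : 0 < C by rewrite !mulr_gt0 ?expR_gt0 ?invr_gt0 ?exprn_gt0 // subr_gt0.
set M := size (ms L).
have M0 : 0 < (6 : R) ^+ M by rewrite exprn_gt0.
have [J0 HJ0] : exists J, r ^+ J < Num.min 1 (e / 2 / 6 ^+ M) / C.
  apply: expr_small; first by rewrite ltW.
  by rewrite divr_gt0 // lt_min ltr01 !divr_gt0.
exists (n + J0)%N; first by lia.
move=> t; set J := (n + J0)%N.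
have rJ : C * r ^+ J <= Num.min 1 (e / 2 / 6 ^+ M).
  have : r ^+ J <= r ^+ J0 by rewrite ler_wiXn2l ?ltW // /J; lia.
  move=> h; have := le_lt_trans h HJ0; rewrite ltr_pdivlMr // mulrC; exact: ltW.
pose F m := Complex (Uc d (m%:R * t) J (r ^+ m)) (Us d (m%:R * t) J (r ^+ m)).
have := @cprod_close R _ (ms L) F (C * r ^+ J).
case.
- rewrite mulr_ge0 ?exprn_ge0 ?(ltW C0) ?(ltW r0) //=; apply: le_trans rJ _.
  by rewrite ge_min lexx.
- move=> m /ms_gt0 m0 /=; apply: U_bound => //; first by rewrite ltW.
  by rewrite exprn_ge0 ?(ltW r0) //= rX_le.
set z := \prod_(m <- ms L) F m => z1 z2.
have eM : 6 ^+ M * (C * r ^+ J) <= e / 2.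
  rewrite mulrC -ler_pdivlMr //; apply: le_trans rJ _.
  by rewrite ge_min lexx orbT.
have {}z1 := le_trans z1 eM; have {}z2 := le_trans z2 eM.
have E : ev (\prod_(m <- ms L) bpoly d J m) (real_complex R r * cis t) =
    real_complex R (mod0 * modulus t) * cis (phase t) * z.
  rewrite ev_prod /mod0 /modulus /phase /z -expRD -big_split /=.
  elim: (ms L) (@ms_gt0 L) => [|m s IH] H.
    by rewrite !big_nil mulr0 expR0 cis0 !mulr1.
  rewrite !big_cons IH; last by move=> k ks; apply: H; rewrite inE ks orbT.
  have m0 : (0 < m)%N by apply: H; rewrite inE eqxx.
  have [Ea Es] := AsAc_U d (m%:R * t) J (rX01 m0).
  have -> : ev (bpoly d J m) (real_complex R r * cis t) =
     real_complex R (expR (d / 2 * ln (qq (r ^+ m) (m%:R * t)))) *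
       cis (d * be (r ^+ m) (m%:R * t)) * F m.
    rewrite ev_bpoly Ea Es /F /cis; apply/eqP; rewrite eq_complex /=.
    by rewrite !mul0r subr0 addr0; apply/andP; split; apply/eqP; ring.
  rewrite [d * (_ + _)]mulrDr cisD expRD.
  have -> : d / 2 * ln (qq (r ^+ m) 0) +
      d / 2 * (ln (qq (r ^+ m) (m%:R * t)) - ln (qq (r ^+ m) 0)) =
      d / 2 * ln (qq (r ^+ m) (m%:R * t)) by ring.
  by rewrite [in RHS]rmorphM; ring.
rewrite E (_ : _ * cis (phase t) * z * cis (- (n%:R * t)) =
  real_complex R (mod0 * modulus t) * (cis (phase t - n%:R * t) * z)); last by rewrite cisD; ring.
rewrite Re_scal ler_pM2l; last by rewrite mulr_gt0 ?expR_gt0.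
have := cos_geN1 (phase t - n%:R * t); have := cos_le1 (phase t - n%:R * t).
have := sin_geN1 (phase t - n%:R * t); have := sin_le1 (phase t - n%:R * t).
case: z z1 z2 {E} => a b /= a1 b1 s1 s2 c1 c2.
set ct := cos _ in c1 c2 *; set st := sin _ in s1 s2 *.
have n1 : `|ct * (a - 1)| <= 1 * (e / 2) by rewrite normrM ler_pM // ler_norml c1 c2.
have n2 : `|st * b| <= 1 * (e / 2) by rewrite normrM ler_pM // ler_norml s1 s2.
move: n1 n2; rewrite !ler_norml => /andP[? ?] /andP[? ?]; lra.
Qed.

Lemma coef_nonneg_crit (s : seq (R * R)) :
  all (fun cb => 0 <= cb.2 <= pi) s -> 0 < area s ->
  (forall t, 0 < t < pi -> step s t <= modulus t * cos (phase t - n%:R * t)) ->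
  0 <= (\prod_(m <- ms L) bser d m : fps R) n.
Proof.
move=> sb a0 H; have p0 := pi_gt0 R; case/andP: (r01) => r0 r1.
(* Over the K nodes the step function contributes about 4 K e and truncation costs at most K e, so a
   large K absorbs the constant C. K is chosen after J, as it must also exceed the degree of P. *)
set e := area s / (4 * pi).
have e0 : 0 < e by rewrite divr_gt0 // mulr_gt0.
have [J nJ HJ] := value_close e0.
set P := \prod_(m <- ms L) bpoly d J m in HJ.
set C := \sum_(cb <- s) `|cb.1|.
have C0 : 0 <= C by apply: sumr_ge0.
have [K0 hK0] : exists K : nat, C + 1 + e <= e * K%:R.
  exists (Num.truncn ((C + 1 + e) / e)).+1; rewrite mulrC -ler_pdivrMr //; apply: ltW.
  by rewrite truncnS_gt.
pose K := (K0 + size P + n)%N.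
have KK0 : (K0 <= K)%N by rewrite /K -addnA leq_addr.
have KP : (size P <= K)%N by rewrite /K (addnC K0) -addnA leq_addr.
have Kn : (n <= K)%N by rewrite /K leq_addl.
have K2 : (K < 2 * K + 1)%N by clear; lia.
clearbody K.
have F := @fourier R P r n K (leq_trans KP (ltnW K2)) (leq_ltn_trans Kn K2).
have R0 : 0 < mod0 by rewrite expR_gt0.
rewrite -(@coef_bpoly_prod R d J) //; last by apply/allP => m; exact: ms_gt0.
rewrite -/P; have rn : 0 < r ^+ n by rewrite exprn_gt0.
have K1 : 0 < 2 * K%:R + 1 :> R by have := ler0n R K; lra.
suff : 0 <= (2 * K%:R + 1) * (P`_n * r ^+ n) by rewrite pmulr_rge0 // pmulr_lge0.
rewrite -F; have A0 := HJ 0.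
have A1 : mod0 * (1 - e) <= complex.Re (ev P (real_complex R r * cis 0) * cis (- (n%:R * 0))).
  apply: le_trans A0; rewrite /modulus /phase !mulr0 subr0.
  rewrite big1 ?expR0 ?mulr1; last by move=> m _; rewrite mulr0 subrr mulr0.
  by rewrite big1 ?mulr0 ?cos0 // => m _; rewrite mulr0 /be sin0 mulr0 mul0r atan0.
have A2 : mod0 * (\sum_(j < K) step s (ang R K j.+1) - K%:R * e) <=
   \sum_(j < K) complex.Re (ev P (real_complex R r * cis (ang R K j.+1)) * cis (- (n%:R * ang R K j.+1))).
  have -> : K%:R * e = \sum_(j < K) e by rewrite sumr_const card_ord mulr_natl.
  rewrite -sumrB mulr_sumr; apply: ler_sum => j _; apply: le_trans (HJ _).
  rewrite -mulrA ler_pM2l //.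
  have := H (ang R K j.+1); rewrite ang_gt0 // ang_ltpi //= => /(_ isT) h.
  have := ler_piMr (ltW e0) (modulus_le1 (ang R K j.+1)); lra.
have A3 := riemann_step K sb.
have KK : K0%:R <= K%:R :> R by rewrite ler_nat.
have A4 : (2 * K%:R + 1) * area s / (2 * pi) = 2 * (2 * K%:R + 1) * e.
  by rewrite /e; move: (lt0r_neq0 p0); move: (@pi R) (area s) => p a p1; field.
rewrite A4 -/C in A3.
apply: (@le_trans _ _ (mod0 * ((1 - e) + 2 * (2 * (2 * K%:R + 1) * e - C - K%:R * e)))).
  rewrite mulr_ge0 ?ltW //; have : e * K0%:R <= e * K%:R by rewrite ler_pM2l.
  lra.
rewrite mulrDr; apply: lerD; first exact: A1.
rewrite mulrCA ler_pM2l //; apply: le_trans A2; rewrite ler_pM2l //.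
by rewrite lerD2r.
Qed.

End Criterion.

(** * Taylor bounds for sin, cos and exp *)

Section Taylor.
Variable R : realType.
Implicit Types x a t : R.

Lemma mono0 (f df : R -> R) x : 0 <= x -> f 0 = 0 ->
  (forall y, 0 <= y <= x -> is_derive y 1 f (df y)) ->
  (forall y, 0 <= y <= x -> 0 <= df y) -> 0 <= f x.
Proof. by move=> x0 f0 H1 H2; have := mvt_mono x0 H1 H2; rewrite f0. Qed.

Lemma dvXid n x : is_derive x 1 (fun y : R => y ^+ n.+1) (n.+1%:R * x ^+ n).
Proof. by apply: (dv_eq (dvX n (dvid x))); rewrite mulr1. Qed.

Lemma dvcX n c x : is_derive x 1 (fun y : R => c * y ^+ n.+1) (c * (n.+1%:R * x ^+ n)).
Proof. by apply: (dv_eq (dvM (dvc c x) (dvXid n x))); rewrite mul0r add0r. Qed.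

(** Each bound in the chain up to [cos_ge6] follows from the preceding one by integration from 0. *)
Lemma sin_le t : 0 <= t -> sin t <= t.
Proof.
move=> t0; rewrite -subr_ge0; apply: (@mono0 (fun y : R => y - sin y) (fun y : R => 1 - cos y) _ t0).
- by rewrite sin0 subr0.
by move=> y _; rewrite subr_ge0 cos_le1.
Qed.

Lemma cos_ge2 t : 0 <= t -> 1 - t ^+ 2 / 2 <= cos t.
Proof.
move=> t0; rewrite -subr_ge0; apply: (@mono0 (fun y => cos y - (1 - y ^+ 2 / 2)) (fun y => y - sin y) _ t0).
- by rewrite cos0 expr0n /= mul0r subr0 subrr.
- move=> y _; apply: (dv_eq (dvB (is_derive_cos y) (dvB (dvc 1 y) (dvM (dvXid 1 y) (dvc 2^-1 y))))).
  by field.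
by move=> y /andP[y0 _]; rewrite subr_ge0 sin_le.
Qed.

Lemma sin_ge3 t : 0 <= t -> t - t ^+ 3 / 6 <= sin t.
Proof.
move=> t0; rewrite -subr_ge0; apply: (@mono0 (fun y => sin y - (y - y ^+ 3 / 6)) (fun y => cos y - (1 - y ^+ 2 / 2)) _ t0).
- by rewrite sin0 expr0n /= mul0r !subr0.
- move=> y _; apply: (dv_eq (dvB (is_derive_sin y) (dvB (dvid y) (dvM (dvXid 2 y) (dvc 6^-1 y))))).
  by field.
by move=> y /andP[y0 _]; rewrite subr_ge0 cos_ge2.
Qed.

Lemma cos_le4 t : 0 <= t -> cos t <= 1 - t ^+ 2 / 2 + t ^+ 4 / 24.
Proof.
move=> t0; rewrite -subr_ge0; apply: (@mono0 (fun y => 1 - y ^+ 2 / 2 + y ^+ 4 / 24 - cos y) (fun y => sin y - (y - y ^+ 3 / 6)) _ t0).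
- by rewrite cos0 !expr0n /= !mul0r; ring.
- move=> y _; apply: (dv_eq (dvB (dvD (dvB (dvc 1 y) (dvM (dvXid 1 y) (dvc 2^-1 y))) (dvM (dvXid 3 y) (dvc 24^-1 y))) (is_derive_cos y))).
  by field.
by move=> y /andP[y0 _]; rewrite subr_ge0 sin_ge3.
Qed.

Lemma sin_le5 t : 0 <= t -> sin t <= t - t ^+ 3 / 6 + t ^+ 5 / 120.
Proof.
move=> t0; rewrite -subr_ge0; apply: (@mono0 (fun y => y - y ^+ 3 / 6 + y ^+ 5 / 120 - sin y) (fun y => 1 - y ^+ 2 / 2 + y ^+ 4 / 24 - cos y) _ t0).
- by rewrite sin0 !expr0n /= !mul0r; ring.
- move=> y _; apply: (dv_eq (dvB (dvD (dvB (dvid y) (dvM (dvXid 2 y) (dvc 6^-1 y))) (dvM (dvXid 4 y) (dvc 120^-1 y))) (is_derive_sin y))).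
  by field.
by move=> y /andP[y0 _]; rewrite subr_ge0 cos_le4.
Qed.

Lemma cos_ge6 t : 0 <= t -> 1 - t ^+ 2 / 2 + t ^+ 4 / 24 - t ^+ 6 / 720 <= cos t.
Proof.
move=> t0; rewrite -subr_ge0; apply: (@mono0 (fun y => cos y - (1 - y ^+ 2 / 2 + y ^+ 4 / 24 - y ^+ 6 / 720)) (fun y => y - y ^+ 3 / 6 + y ^+ 5 / 120 - sin y) _ t0).
- by rewrite cos0 !expr0n /= !mul0r; ring.
- move=> y _; apply: (dv_eq (dvB (is_derive_cos y) (dvB (dvD (dvB (dvc 1 y) (dvM (dvXid 1 y) (dvc 2^-1 y))) (dvM (dvXid 3 y) (dvc 24^-1 y))) (dvM (dvXid 5 y) (dvc 720^-1 y))))).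
  by field.
by move=> y /andP[y0 _]; rewrite subr_ge0 sin_le5.
Qed.

Lemma cos_abs t : cos `|t| = cos t.
Proof. by have [?|?] := leP 0 t; [rewrite ger0_norm | rewrite ltr0_norm // cosN]. Qed.

Lemma cos_geabs t : 1 - t ^+ 2 / 2 <= cos t.
Proof. by rewrite -cos_abs -[t ^+ 2]real_normK ?num_real //; exact: cos_ge2. Qed.

Lemma cos_lip a t : `|cos a - cos t| <= `|a - t|.
Proof.
wlog le : a t / t <= a.
  by move=> H; have [/H//|/ltW/H] := leP t a; rewrite distrC [`|_ - a|]distrC.
rewrite [`|a - t|]ger0_norm ?subr_ge0 // -[a - t]mul1r.
apply: (mvt_le (f := @cos R) (df := fun y : R => - sin y)) => //.
by move=> y _; rewrite normrN ler_norml sin_geN1 sin_le1.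
Qed.

Lemma expR_ge2 x : 0 <= x -> 1 + x + x ^+ 2 / 2 <= expR x.
Proof.
move=> t0; rewrite -subr_ge0; apply: (@mono0 (fun y => expR y - (1 + y + y ^+ 2 / 2)) (fun y => expR y - (1 + y)) _ t0).
- by rewrite expR0 expr0n /= mul0r; ring.
- move=> y _; apply: (dv_eq (dvB (is_derive_expR y) (dvD (dvD (dvc 1 y) (dvid y)) (dvM (dvXid 1 y) (dvc 2^-1 y))))).
  by field.
by move=> y _; rewrite subr_ge0 expR_ge1Dx.
Qed.

Lemma expR_ge3 x : 0 <= x -> 1 + x + x ^+ 2 / 2 + x ^+ 3 / 6 <= expR x.
Proof.
move=> t0; rewrite -subr_ge0; apply: (@mono0 (fun y => expR y - (1 + y + y ^+ 2 / 2 + y ^+ 3 / 6)) (fun y => expR y - (1 + y + y ^+ 2 / 2)) _ t0).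
- by rewrite expR0 !expr0n /= !mul0r; ring.
- move=> y _; apply: (dv_eq (dvB (is_derive_expR y) (dvD (dvD (dvD (dvc 1 y) (dvid y)) (dvM (dvXid 1 y) (dvc 2^-1 y))) (dvM (dvXid 2 y) (dvc 6^-1 y))))).
  by field.
by move=> y /andP[y0 _]; rewrite subr_ge0 expR_ge2.
Qed.

Lemma expRN_ge1 x : 0 <= x -> 1 - x <= expR (- x).
Proof. by move=> _; exact: expR_ge1Dx. Qed.

Lemma expRN_le2 x : 0 <= x -> expR (- x) <= 1 - x + x ^+ 2 / 2.
Proof.
move=> t0; rewrite -subr_ge0; apply: (@mono0 (fun y => 1 - y + y ^+ 2 / 2 - expR (- y)) (fun y => expR (- y) - (1 - y)) _ t0).
- by rewrite oppr0 expR0 expr0n /= mul0r; ring.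
- move=> y _; apply: (dv_eq (dvB (dvD (dvB (dvc 1 y) (dvid y)) (dvM (dvXid 1 y) (dvc 2^-1 y))) (dvo (f := @expR R) (is_derive_expR _) (dvN (dvid y))))).
  by field.
by move=> y /andP[y0 _]; rewrite subr_ge0 expRN_ge1.
Qed.

Lemma expRN_ge3 x : 0 <= x -> 1 - x + x ^+ 2 / 2 - x ^+ 3 / 6 <= expR (- x).
Proof.
move=> t0; rewrite -subr_ge0; apply: (@mono0 (fun y => expR (- y) - (1 - y + y ^+ 2 / 2 - y ^+ 3 / 6)) (fun y => 1 - y + y ^+ 2 / 2 - expR (- y)) _ t0).
- by rewrite oppr0 expR0 !expr0n /= !mul0r; ring.
- move=> y _; apply: (dv_eq (dvB (dvo (f := @expR R) (is_derive_expR _) (dvN (dvid y))) (dvB (dvD (dvB (dvc 1 y) (dvid y)) (dvM (dvXid 1 y) (dvc 2^-1 y))) (dvM (dvXid 2 y) (dvc 6^-1 y))))).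
  by field.
by move=> y /andP[y0 _]; rewrite subr_ge0 expRN_le2.
Qed.

(** The k-th power of the cubic Taylor polynomial at x, about y / k, turns a numerical bound on exp
    into a rational inequality. *)
Lemma expRN_le (k : nat) x y M : 0 <= x -> k%:R * x <= y ->
  1 <= M * (1 + x + x ^+ 2 / 2 + x ^+ 3 / 6) ^+ k -> expR (- y) <= M.
Proof.
move=> x0 kxy H; apply: (@le_trans _ _ (expR (- (k%:R * x)))); first by rewrite ler_expR lerN2.
rewrite expRN -[leLHS]mul1r ler_pdivrMr ?expR_gt0 //.
set p := 1 + x + x ^+ 2 / 2 + x ^+ 3 / 6 in H.
have p1 : 1 <= p by rewrite /p -!addrA lerDl !addr_ge0 // ?mulr_ge0 ?exprn_ge0 ?invr_ge0.
have pk : p ^+ k <= expR (k%:R * x).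
  by rewrite expRM_natl lerXn2r ?nnegrE ?expR_ge0 ?(le_trans _ p1) //; exact: expR_ge3.
have pk0 : 0 < p ^+ k by rewrite exprn_gt0 // (lt_le_trans _ p1).
have M0 : 0 <= M by rewrite -(pmulr_lge0 _ pk0); apply: le_trans H.
by apply: (le_trans H); rewrite ler_wpM2l.
Qed.

End Taylor.

(** * Phase and modulus of a single factor 1 + x e^(i al) *)

Section Factor.
Variable R : realType.
Implicit Types x al d : R.

Lemma dv_be_al x al : 0 <= x < 1 ->
  is_derive al 1 (be x) (x * (cos al + x) / qq x al).
Proof.
move=> x01; have c0 := lt0r_neq0 (re_pos al x01).
have q0 := lt0r_neq0 (qq_gt0 al x01).
have H1 : is_derive al 1 (fun y : R => 1 + x * cos y) (- (x * sin al)).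
  by apply: (dv_eq (dvD (dvc 1 al) (dvM (dvc x al) (is_derive_cos al)))); ring.
have H2 : is_derive al 1 (fun y : R => x * sin y) (x * cos al).
  by apply: (dv_eq (dvM (dvc x al) (is_derive_sin al))); ring.
have H3 := dvM H2 (dvV (f := fun y => 1 + x * cos y) c0 H1).
have H4 := dvo (f := @atan R) (g := fun y => x * sin y / (1 + x * cos y)) (is_derive1_atan _) H3.
apply: (dv_eq H4).
have E : 1 + (x * sin al / (1 + x * cos al)) ^+ 2 = qq x al / (1 + x * cos al) ^+ 2.
  by rewrite qqE; field.
rewrite E; transitivity ((x * cos al + x ^+ 2 * (cos al ^+ 2 + sin al ^+ 2)) / qq x al).
  by field; rewrite c0 q0.
by rewrite cos2Dsin2; ring.
Qed.

(* [x / (1 + x)] is the slope of [be x] at the origin. *)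
Lemma be_linear x al : 0 <= x < 1 -> 0 <= al -> x * al ^+ 2 <= 1 / 2 ->
  `|be x al - x / (1 + x) * al| <= x * al ^+ 3 / 6.
Proof.
move=> x01 a0 xa; case/andP: (x01) => x0 x1.
have x1p : 0 < 1 + x by lra.
have b0 : be x 0 = 0 by rewrite /be sin0 mulr0 mul0r atan0.
have dF y : x / (1 + x) - x * (cos y + x) / qq x y = x * ((1 - x) * (1 - cos y)) / ((1 + x) * qq x y).
  have q0 := lt0r_neq0 (qq_gt0 y x01); have q1 := lt0r_neq0 x1p.
  transitivity (x * (qq x y - (cos y + x) * (1 + x)) / ((1 + x) * qq x y)); first by field; rewrite q1 q0.
  by congr (_ * _ / _); rewrite /qq; ring.
have dFa (y : R) : is_derive y 1 (fun z => x / (1 + x) * z - be x z) (x * ((1 - x) * (1 - cos y)) / ((1 + x) * qq x y)).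
  rewrite -dF; apply: (dv_eq (dvB (dvM (dvc _ y) (dvid y)) (dv_be_al y x01))); ring.
have lo : 0 <= x / (1 + x) * al - be x al.
  apply: (@mono0 R (fun z => x / (1 + x) * z - be x z) (fun y => x * ((1 - x) * (1 - cos y)) / ((1 + x) * qq x y)) _ a0).
  - by rewrite b0 mulr0 subr0.
  move=> y _; rewrite divr_ge0 ?mulr_ge0 ?subr_ge0 ?cos_le1 ?(ltW x1) ?(ltW x1p) //.
  by rewrite ltW // qq_gt0.
have hi : 0 <= x * al ^+ 3 / 6 - (x / (1 + x) * al - be x al).
  apply: (@mono0 R (fun z => x * z ^+ 3 / 6 - (x / (1 + x) * z - be x z))
     (fun y => x * y ^+ 2 / 2 - x * ((1 - x) * (1 - cos y)) / ((1 + x) * qq x y)) _ a0).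
  - by rewrite b0 expr0n /= !mulr0 mul0r !subr0.
  - move=> y _; apply: (dv_eq (dvB (dvM (dvcX 2 x y) (dvc 6^-1 y)) (dFa y))); field.
    by rewrite (lt0r_neq0 x1p) (lt0r_neq0 (qq_gt0 y x01)).
  move=> y /andP[y0 ya]; have q0 := qq_gt0 y x01.
  rewrite subr_ge0 -!mulrA ler_wpM2l //.
  have D0 : 0 < (1 + x) * qq x y by rewrite mulr_gt0.
  rewrite mulrA ler_pdivrMr //.
  have c1 := cos_geabs y; have c2 := cos_le1 y; have c3 := cos_geN1 y.
  (* For y^2 <= 6, cos y >= - 4/5 gives (1 - x) / ((1 + x) |1 + x e^(iy)|^2) <= 1, and 1 - cos y <=
     y^2 / 2 suffices. Beyond, x y^2 <= 1/2 forces x <= 1/12, and 1 - cos y <= 2 suffices against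
     y^2 / 2 > 3. *)
  have [y6|y6] := leP (y ^+ 2) 6.
    have c4 : - (4 / 5) <= cos y.
      apply: le_trans (cos_ge6 y0).
      rewrite (_ : y ^+ 4 = (y ^+ 2) ^+ 2); last by rewrite -exprM.
      rewrite (_ : y ^+ 6 = (y ^+ 2) ^+ 3); last by rewrite -exprM.
      move: (y ^+ 2) (sqr_ge0 y) y6 => u u0 u6.
      have : 0 <= (6 - u) * (u ^+ 2 - 24 * u + 216) by rewrite mulr_ge0 //; nra.
      by nra.
    have A : 1 - x <= (1 + x) * qq x y.
      have : 1 - 8 / 5 * x + x ^+ 2 <= qq x y by rewrite /qq; nra.
      move=> /(ler_wpM2l (ltW x1p)); apply: le_trans.
      have : 0 <= x * (2 / 5 - 3 / 5 * x + x ^+ 2) by rewrite mulr_ge0 //; nra.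
      by nra.
    apply: (@le_trans _ _ ((1 + x) * qq x y * (1 - cos y))).
      by rewrite ler_wpM2r // subr_ge0.
    rewrite mulrC ler_wpM2r ?(ltW D0) //; lra.
  have x12 : x <= 1 / 12.
    have : x * y ^+ 2 <= 1 / 2.
      by apply: le_trans xa; rewrite ler_wpM2l // lerXn2r ?nnegrE.
    nra.
  have q1 := qq_ge y x01.
  have A : (11 / 12) * (1 - x) <= (1 + x) * qq x y.
    apply: le_trans (ler_wpM2l (ltW x1p) q1); nra.
  apply: (@le_trans _ _ (2 * (1 - x))); first by rewrite mulrC ler_wpM2r //; lra.
  nra.
rewrite distrC ger0_norm //; lra.
Qed.

Lemma lnqq_sub x al : 0 <= x < 1 ->
  ln (qq x al) - ln (qq x 0) = ln (1 - 2 * x / (1 + x) ^+ 2 * (1 - cos al)).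
Proof.
move=> x01; have q0 := qq_gt0 al x01; have q1 := qq_gt0 0 x01.
rewrite -ln_div ?posrE //; congr ln.
have E : qq x 0 = (1 + x) ^+ 2 by rewrite /qq cos0; ring.
have x1 : 1 + x != 0 by apply/lt0r_neq0; case/andP: x01 => ? ?; lra.
by rewrite E /qq; field.
Qed.

(** From ln(1 - w) <= - w. Replacing the weight 2x / (1 + x)^2 by a polynomial leaves, for x = r^m,
    sums in r and in r^2 that have closed forms. *)
Lemma lnqq_le x al : 0 <= x < 1 ->
  ln (qq x al) - ln (qq x 0) <= - ((x - x ^+ 2 / 2) * (1 - cos al)).
Proof.
move=> x01; case/andP: (x01) => x0 x1; rewrite lnqq_sub //.
have c2 := cos_le1 al.
have w : x - x ^+ 2 / 2 <= 2 * x / (1 + x) ^+ 2.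
  have p : 0 < (1 + x) ^+ 2 by rewrite exprn_gt0 //; lra.
  rewrite ler_pdivlMr //.
  have : 0 <= x * ((1 - x) ^+ 2 * (x + 2)) by rewrite !mulr_ge0 ?sqr_ge0 //; lra.
  nra.
have q0 : 0 < 1 - 2 * x / (1 + x) ^+ 2 * (1 - cos al).
  have q0 := qq_gt0 al x01; have q1 := qq_gt0 0 x01.
  have E : qq x 0 = (1 + x) ^+ 2 by rewrite /qq cos0; ring.
  have x1' : 1 + x != 0 by apply/lt0r_neq0; lra.
  have -> : 1 - 2 * x / (1 + x) ^+ 2 * (1 - cos al) = qq x al / qq x 0.
    by rewrite E /qq; field.
  by rewrite divr_gt0.
apply: (@le_trans _ _ (- (2 * x / (1 + x) ^+ 2 * (1 - cos al)))).
  by apply: le_trans (le_ln1Dx _) _ => //; rewrite ltrNl opprK; lra.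
by rewrite lerN2 ler_wpM2r // subr_ge0.
Qed.

(** From - ln(1 - u) <= u / (1 - u), where u <= x al^2 <= b. *)
Lemma lnqq_ge x al b : 0 <= x < 1 -> x * al ^+ 2 <= b -> b < 1 ->
  - (x * al ^+ 2 / (1 - b)) <= ln (qq x al) - ln (qq x 0).
Proof.
move=> x01 xb b1; case/andP: (x01) => x0 x1; rewrite lnqq_sub //.
have c2 := cos_le1 al; have c1 := cos_geabs al.
set u := 2 * x / (1 + x) ^+ 2 * (1 - cos al).
have w : 2 * x / (1 + x) ^+ 2 <= 2 * x.
  rewrite ler_piMr //; first lra.
  by rewrite invf_le1 ?exprn_gt0 //; nra.
have w0 : 0 <= 2 * x / (1 + x) ^+ 2 by rewrite divr_ge0 ?sqr_ge0 //; lra.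
have u0 : 0 <= u by rewrite mulr_ge0 // subr_ge0.
have ub : u <= x * al ^+ 2.
  apply: (@le_trans _ _ (2 * x * (1 - cos al))); first by rewrite ler_wpM2r // subr_ge0.
  nra.
have u1 : 0 < 1 - u by lra.
have b1' : 0 < 1 - b by lra.
have : - ln (1 - u) <= u / (1 - u).
  rewrite -lnV ?posrE // [X in ln X](_ : _ = 1 + u / (1 - u)); last by field; exact: lt0r_neq0.
  apply: le_ln1Dx; apply: (@lt_le_trans _ _ 0) => //; rewrite divr_ge0 // ltW //.
move=> H; rewrite lerNl; apply: le_trans H _.
rewrite ler_pdivrMr // mulrAC ler_pdivlMr //.
have : u * (1 - b) <= x * al ^+ 2 * (1 - u) by apply: ler_pM => //; lra.
by [].
Qed.

End Factor.

(** * Closed forms and bounds for sums over the exponents *)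

Ltac nonneg := repeat lazymatch goal with
  | |- is_true (0 <= _ * _) => apply: mulr_ge0
  | |- is_true (0 <= _ - _) => assumption
  | |- is_true (0 <= _ + _) => apply: addr_ge0
  | |- is_true (0 <= _^-1) => rewrite invr_ge0
  | |- is_true (0 <= _ ^+ _) => apply: exprn_ge0
  | |- is_true (0 <= _%:R) => exact: ler0n
  | |- is_true (0 <= 1) => exact: ler01
  | |- _ => assumption
  end.

Section PowerSums.
Variable R : realType.
Implicit Types (r q : R).

Lemma ms_sumE L (F : nat -> R) :
  \sum_(m <- ms L) F m = \sum_(k < L) (F (6 * k).+1 + F (6 * k + 5)%N).
Proof.
rewrite /ms big_flatten big_map -{1}(subn0 L) -/(index_iota 0 L) big_mkord.
by apply: eq_bigr => k _; rewrite big_cons big_seq1 addSnnS.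
Qed.

(** Telescoping; in the moments below g k is the tail from index k on of the infinite series. *)
Lemma sum_poly_le L q (f g : nat -> R) (c : R) : 0 <= q ->
  g 0%N = c -> (forall k, f k * q ^+ k = g k - g k.+1) -> (forall k, 0 <= g k) ->
  \sum_(k < L) f k * q ^+ k <= c.
Proof.
move=> q0 g0 H gp; suff -> : \sum_(k < L) f k * q ^+ k = c - g L by rewrite gerBl.
elim: L => [|L IH]; first by rewrite big_ord0 -g0 subrr.
by rewrite big_ord_recr /= IH H; ring.
Qed.

Variable r : R.
Hypothesis r01 : 0 < r < 1.
Local Notation q := (r ^+ 6).

Lemma q01 : 0 < q < 1.
Proof. by case/andP: r01 => r0 r1; rewrite exprn_gt0 // exprn_ilt1 // ltW. Qed.

Lemma q1_neq0 : 1 - q != 0.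
Proof. by apply/lt0r_neq0; case/andP: q01; lra. Qed.

Lemma r_split k : r ^+ (6 * k).+1 = r * q ^+ k /\ r ^+ (6 * k + 5) = r ^+ 5 * q ^+ k.
Proof. by rewrite exprS exprM exprD exprM mulrC [_ * r ^+ 5]mulrC [q ^+ k * r]mulrC. Qed.

Let q0 : 0 <= q. Proof. by case/andP: q01 => /ltW. Qed.
Let p0 : 0 <= 1 - q. Proof. by case/andP: q01 => ? ?; lra. Qed.
Let r0 : 0 <= r. Proof. by case/andP: r01 => /ltW. Qed.

Lemma sum0_eq L : \sum_(k < L) q ^+ k = (1 - q ^+ L) / (1 - q).
Proof.
elim: L => [|L IH]; first by rewrite big_ord0 expr0 subrr mul0r.
by rewrite big_ord_recr /= IH [q ^+ L.+1]exprS; have := q1_neq0; move: q (q ^+ L) => x y x1; field.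
Qed.

Lemma moment1_le L : \sum_(m <- ms L) m%:R * r ^+ m <=
  (r + 5 * r ^+ 5 + 5 * r ^+ 7 + r ^+ 11) / (1 - q) ^+ 2.
Proof.
pose f (k : nat) : R := (6 * k%:R + 1) * r + (6 * k%:R + 5) * r ^+ 5.
rewrite ms_sumE (eq_bigr (fun k : 'I_L => f k * q ^+ k)); last first.
  move=> k _; have [-> ->] := r_split k.
  by rewrite /f -natr1 natrD !natrM; ring.
pose g k : R := q ^+ k * ((6 * (r + r ^+ 5) * k%:R + r + 5 * r ^+ 5) / (1 - q) + 6 * (r + r ^+ 5) * q / (1 - q) ^+ 2).
apply: (@sum_poly_le L q f g) => //.
- rewrite /g expr0; have q1 := q1_neq0.
  rewrite (_ : r ^+ 7 = r * q); last by ring.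
  rewrite (_ : r ^+ 11 = r ^+ 5 * q); last by ring.
  by move: q q1 => x x1; field.
- move=> k; rewrite /f /g [q ^+ k.+1]exprS -[k.+1%:R]natr1; have q1 := q1_neq0.
  by move: q (q ^+ k) q1 => x y x1; field.
- by move=> k; rewrite /g; nonneg.
Qed.

Lemma moment2_le L : \sum_(m <- ms L) m%:R ^+ 2 * r ^+ m <=
  (r + 25 * r ^+ 5 + 46 * r ^+ 7 + 46 * r ^+ 11 + 25 * r ^+ 13 + r ^+ 17) / (1 - q) ^+ 3.
Proof.
pose f (k : nat) : R := (6 * k%:R + 1) ^+ 2 * r + (6 * k%:R + 5) ^+ 2 * r ^+ 5.
rewrite ms_sumE (eq_bigr (fun k : 'I_L => f k * q ^+ k)); last first.
  move=> k _; have [-> ->] := r_split k.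
  by rewrite /f -natr1 natrD !natrM; ring.
pose S (a : R) (k : R) : R := (6 * k + a) ^+ 2 / (1 - q) + (72 * k + 12 * a + 36) * q / (1 - q) ^+ 2
   + 72 * q ^+ 2 / (1 - q) ^+ 3.
pose g k : R := q ^+ k * (r * S 1 k%:R + r ^+ 5 * S 5 k%:R).
apply: (@sum_poly_le L q f g) => //.
- rewrite /g /S expr0; have q1 := q1_neq0.
  rewrite (_ : r ^+ 7 = r * q); last by ring.
  rewrite (_ : r ^+ 11 = r ^+ 5 * q); last by ring.
  rewrite (_ : r ^+ 13 = r * q ^+ 2); last by ring.
  rewrite (_ : r ^+ 17 = r ^+ 5 * q ^+ 2); last by ring.
  by move: q q1 => x x1; field.
- move=> k; rewrite /f /g /S [q ^+ k.+1]exprS -[k.+1%:R]natr1; have q1 := q1_neq0.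
  by move: q (q ^+ k) q1 => x y x1; field.
- by move=> k; rewrite /g /S; nonneg.
Qed.

Lemma moment3_le L : \sum_(m <- ms L) m%:R ^+ 3 * r ^+ m <=
  (r + 125 * r ^+ 5 + 339 * r ^+ 7 + 831 * r ^+ 11 + 831 * r ^+ 13 + 339 * r ^+ 17
   + 125 * r ^+ 19 + r ^+ 23) / (1 - q) ^+ 4.
Proof.
pose f (k : nat) : R := (6 * k%:R + 1) ^+ 3 * r + (6 * k%:R + 5) ^+ 3 * r ^+ 5.
rewrite ms_sumE (eq_bigr (fun k : 'I_L => f k * q ^+ k)); last first.
  move=> k _; have [-> ->] := r_split k.
  by rewrite /f -natr1 natrD !natrM; ring.
pose S (a : R) (k : R) : R := (6 * k + a) ^+ 3 / (1 - q)
   + (18 * (6 * k + a) ^+ 2 + 108 * (6 * k + a) + 216) * q / (1 - q) ^+ 2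
   + (216 * (6 * k + a) + 1296) * q ^+ 2 / (1 - q) ^+ 3 + 1296 * q ^+ 3 / (1 - q) ^+ 4.
pose g k : R := q ^+ k * (r * S 1 k%:R + r ^+ 5 * S 5 k%:R).
apply: (@sum_poly_le L q f g) => //.
- rewrite /g /S expr0; have q1 := q1_neq0.
  rewrite (_ : r ^+ 7 = r * q); last by ring.
  rewrite (_ : r ^+ 11 = r ^+ 5 * q); last by ring.
  rewrite (_ : r ^+ 13 = r * q ^+ 2); last by ring.
  rewrite (_ : r ^+ 17 = r ^+ 5 * q ^+ 2); last by ring.
  rewrite (_ : r ^+ 19 = r * q ^+ 3); last by ring.
  rewrite (_ : r ^+ 23 = r ^+ 5 * q ^+ 3); last by ring.
  by move: q q1 => x x1; field.
- move=> k; rewrite /f /g /S [q ^+ k.+1]exprS -[k.+1%:R]natr1; have q1 := q1_neq0.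
  by move: q (q ^+ k) q1 => x y x1; field.
- by move=> k; rewrite /g /S; nonneg.
Qed.

(* With [r = exp (- s)], [kappa] is [sinh (3 s)]. *)
Definition kappa : R := (r ^- 3 - r ^+ 3) / 2.

Lemma kap_q : 1 - q = 2 * kappa * r ^+ 3.
Proof. by rewrite /kappa; have : r != 0 by [case/andP: r01 => /lt0r_neq0]; move=> ?; field. Qed.

Lemma kap_gt0 : 0 < kappa.
Proof.
have := kap_q; case/andP: q01 => _ q1; case/andP: r01 => rr _ E.
have : 0 < 2 * kappa * r ^+ 3 by rewrite -E; lra.
by rewrite pmulr_lgt0 ?exprn_gt0 // pmulr_rgt0.
Qed.

Lemma kap_sq : 1 + q ^+ 2 = (2 + 4 * kappa ^+ 2) * q.
Proof.
have E := kap_q; transitivity ((1 - q) ^+ 2 + 2 * q); first by ring.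
by rewrite E; ring.
Qed.

Lemma kap_q3 : 1 + q <= (2 + kappa ^+ 2) * r ^+ 3.
Proof.
have k2 := kap_sq; have kk := sqr_ge0 kappa; case/andP: r01 => rr _.
have r3 : 0 < r ^+ 3 by rewrite exprn_gt0.
rewrite -(ler_pXn2r (n := 2)) // ?nnegrE; last 2 first.
- by rewrite addr_ge0.
- by rewrite mulr_ge0 ?addr_ge0 // ltW.
rewrite (_ : (1 + q) ^+ 2 = (4 + 4 * kappa ^+ 2) * q); last first.
  transitivity (1 + q ^+ 2 + 2 * q); first by ring.
  by rewrite k2; ring.
rewrite (_ : ((2 + kappa ^+ 2) * r ^+ 3) ^+ 2 = (4 + 4 * kappa ^+ 2 + kappa ^+ 2 * kappa ^+ 2) * q); last by ring.
by rewrite ler_wpM2r // lerDl mulr_ge0.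
Qed.

(** Monotonicity of cosh, multiplied by 2 r^c. The numerators of the moments are palindromic; their
    pairs of powers are pushed outwards to exponents that [kappa] controls. *)
Lemma fold_le c i j : (i <= j <= c)%N ->
  r ^+ (c - i) + r ^+ (c + i) <= r ^+ (c - j) + r ^+ (c + j).
Proof.
move=> /andP[ij jc]; rewrite -subr_ge0.
have e1 : r ^+ (c - i) = r ^+ (c - j) * r ^+ (j - i) by rewrite -exprD; congr (_ ^+ _); lia.
have e2 : r ^+ (c + i) = r ^+ (c - j) * r ^+ (j + i) by rewrite -exprD; congr (_ ^+ _); lia.
have e3 : r ^+ (c + j) = r ^+ (c - j) * (r ^+ (j - i) * r ^+ (j + i)) by rewrite -!exprD; congr (_ ^+ _); lia.
rewrite e1 e2 e3 (_ : _ - _ = r ^+ (c - j) * ((1 - r ^+ (j - i)) * (1 - r ^+ (j + i)))); last by ring.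
have le1 k : 0 <= 1 - r ^+ k by rewrite subr_ge0 exprn_ile1 // ltW //; case/andP: r01.
by rewrite !mulr_ge0 ?exprn_ge0.
Qed.

(** The leading term is the integral of x r^x / 3, as the exponents have density 1/3 and kappa is
    about - 3 ln r; likewise 18 / kappa^3 and 162 / kappa^4 below. *)
Lemma moment1_kap L : \sum_(m <- ms L) m%:R * r ^+ m <= 3 / kappa ^+ 2 + 9 / 4.
Proof.
apply: le_trans (moment1_le L) _; rewrite kap_q.
have k0 := kap_gt0; case/andP: r01 => rr _; have r6 : 0 < q by rewrite exprn_gt0.
rewrite (_ : (2 * kappa * r ^+ 3) ^+ 2 = 4 * kappa ^+ 2 * q); last by ring.
have kp : 0 < kappa ^+ 2 by rewrite exprn_gt0.
have D : 0 < 4 * kappa ^+ 2 * q by rewrite pmulr_lgt0 // pmulr_rgt0.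
rewrite (ler_pdivrMr _ _ D).
rewrite (_ : _ * (4 * kappa ^+ 2 * q) = (12 + 9 * kappa ^+ 2) * q); last by field; exact: lt0r_neq0.
have f1 : r ^+ 5 + r ^+ 7 <= r ^+ 3 + r ^+ 9 := @fold_le 6 1 3 isT.
have f2 : r + r ^+ 11 <= r ^+ 0 + r ^+ 12 := @fold_le 6 5 6 isT.
have f3 : r ^+ 3 + r ^+ 9 <= (2 + kappa ^+ 2) * q.
  rewrite (_ : r ^+ 3 + r ^+ 9 = r ^+ 3 * (1 + q)); last by ring.
  rewrite (_ : (2 + kappa ^+ 2) * q = r ^+ 3 * ((2 + kappa ^+ 2) * r ^+ 3)); last by ring.
  by rewrite ler_wpM2l ?kap_q3 // exprn_ge0.
have f4 : r ^+ 0 + r ^+ 12 = (2 + 4 * kappa ^+ 2) * q.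
  by transitivity (1 + q ^+ 2); [ring | exact: kap_sq].
lra.
Qed.

Lemma moment2_kap L : kappa <= 1 / 4 ->
  \sum_(m <- ms L) m%:R ^+ 2 * r ^+ m <= (18 + 40 * kappa ^+ 2) / kappa ^+ 3.
Proof.
move=> k4; apply: le_trans (moment2_le L) _; rewrite kap_q.
have k0 := kap_gt0; case/andP: r01 => rr _; have r9 : 0 < r ^+ 9 by rewrite exprn_gt0.
rewrite (_ : (2 * kappa * r ^+ 3) ^+ 3 = 8 * kappa ^+ 3 * r ^+ 9); last by ring.
have kp : 0 < kappa ^+ 3 by rewrite exprn_gt0.
have D : 0 < 8 * kappa ^+ 3 * r ^+ 9 by rewrite pmulr_lgt0 // pmulr_rgt0.
rewrite (ler_pdivrMr _ _ D).
rewrite (_ : _ * (8 * kappa ^+ 3 * r ^+ 9) = (144 + 320 * kappa ^+ 2) * r ^+ 9); last by field; exact: lt0r_neq0.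
have f1 : r ^+ 7 + r ^+ 11 <= r ^+ 3 + r ^+ 15 := @fold_le 9 2 6 isT.
have f2 : r ^+ 5 + r ^+ 13 <= r ^+ 3 + r ^+ 15 := @fold_le 9 4 6 isT.
have e1 : r ^+ 3 + r ^+ 15 = (2 + 4 * kappa ^+ 2) * r ^+ 9.
  transitivity (r ^+ 3 * (1 + q ^+ 2)); first by ring.
  by rewrite kap_sq; ring.
have f3 : r + r ^+ 17 <= (2 + 18 * kappa ^+ 2) * r ^+ 9.
  have f : r ^+ 4 + r ^+ 20 <= r ^+ 0 + r ^+ 24 := @fold_le 12 8 12 isT.
  have e : r ^+ 0 + r ^+ 24 = ((2 + 4 * kappa ^+ 2) ^+ 2 - 2) * r ^+ 12.
    transitivity ((1 + q ^+ 2) ^+ 2 - 2 * q ^+ 2); first by ring.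
    by rewrite kap_sq; ring.
  have r3 : 0 < r ^+ 3 by rewrite exprn_gt0.
  rewrite -(ler_pM2r r3) (_ : (r + r ^+ 17) * r ^+ 3 = r ^+ 4 + r ^+ 20); last by ring.
  rewrite (_ : (2 + 18 * kappa ^+ 2) * r ^+ 9 * r ^+ 3 = (2 + 18 * kappa ^+ 2) * r ^+ 12); last by ring.
  apply: (le_trans f); rewrite e ler_pM2r ?exprn_gt0 //.
  have u0 := sqr_ge0 kappa; have u1 : kappa ^+ 2 <= 1 / 16 by nra.
  by move: (kappa ^+ 2) u0 u1 => u u0 u1; nra.
have r9' : 0 <= kappa ^+ 2 * r ^+ 9 by rewrite mulr_ge0 ?sqr_ge0 // ltW.
lra.
Qed.

Lemma moment3_kap L : kappa <= 1 / 4 ->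
  \sum_(m <- ms L) m%:R ^+ 3 * r ^+ m <= (162 + 450 * kappa ^+ 2) / kappa ^+ 4.
Proof.
move=> k4; apply: le_trans (moment3_le L) _; rewrite kap_q.
have k0 := kap_gt0; case/andP: r01 => rr _; have r12 : 0 < r ^+ 12 by rewrite exprn_gt0.
rewrite (_ : (2 * kappa * r ^+ 3) ^+ 4 = 16 * kappa ^+ 4 * r ^+ 12); last by ring.
have kp : 0 < kappa ^+ 4 by rewrite exprn_gt0.
have D : 0 < 16 * kappa ^+ 4 * r ^+ 12 by rewrite pmulr_lgt0 // pmulr_rgt0.
rewrite (ler_pdivrMr _ _ D).
rewrite (_ : _ * (16 * kappa ^+ 4 * r ^+ 12) = (2592 + 7200 * kappa ^+ 2) * r ^+ 12); last by field; exact: lt0r_neq0.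
have f1 : r ^+ 11 + r ^+ 13 <= r ^+ 6 + r ^+ 18 := @fold_le 12 1 6 isT.
have f2 : r ^+ 7 + r ^+ 17 <= r ^+ 6 + r ^+ 18 := @fold_le 12 5 6 isT.
have f3 : r ^+ 5 + r ^+ 19 <= r ^+ 0 + r ^+ 24 := @fold_le 12 7 12 isT.
have f4 : r + r ^+ 23 <= r ^+ 0 + r ^+ 24 := @fold_le 12 11 12 isT.
have e1 : r ^+ 6 + r ^+ 18 = (2 + 4 * kappa ^+ 2) * r ^+ 12.
  transitivity (q * (1 + q ^+ 2)); first by ring.
  by rewrite kap_sq; ring.
have e : r ^+ 0 + r ^+ 24 = ((2 + 4 * kappa ^+ 2) ^+ 2 - 2) * r ^+ 12.
  transitivity ((1 + q ^+ 2) ^+ 2 - 2 * q ^+ 2); first by ring.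
  by rewrite kap_sq; ring.
have f5 : ((2 + 4 * kappa ^+ 2) ^+ 2 - 2) * r ^+ 12 <= (2 + 17 * kappa ^+ 2) * r ^+ 12.
  rewrite ler_pM2r //; have u0 := sqr_ge0 kappa; have u1 : kappa ^+ 2 <= 1 / 16 by nra.
  by move: (kappa ^+ 2) u0 u1 => u u0 u1; nra.
have r9' : 0 <= kappa ^+ 2 * r ^+ 12 by rewrite mulr_ge0 ?sqr_ge0 // ltW.
lra.
Qed.

(** Real part of a geometric sum of ratio q e^(6it), multiplied by |1 - q e^(6it)|^2. *)
Lemma cos_telescope L j t :
  (1 - 2 * q * cos (6 * t) + q ^+ 2) * \sum_(k < L) q ^+ k * cos ((6 * k%:R + j) * t) =
  cos (j * t) - q * cos ((j - 6) * t)
  - q ^+ L * (cos ((6 * L%:R + j) * t) - q * cos ((6 * L%:R + j - 6) * t)).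
Proof.
elim: L => [|L IH].
  rewrite big_ord0 expr0 mulr0 mul1r (_ : (6 * 0%:R + j) * t = j * t); last by ring.
  by rewrite (_ : (6 * 0%:R + j - 6) * t = (j - 6) * t) ?subrr //; ring.
rewrite big_ord_recr /= mulrDr IH -[L.+1%:R]natr1.
set A := (6 * L%:R + j) * t.
have -> : (6 * (L%:R + 1) + j) * t = A + 6 * t by rewrite /A; ring.
have -> : (6 * (L%:R + 1) + j - 6) * t = A by rewrite /A; ring.
have -> : (6 * L%:R + j - 6) * t = A - 6 * t by rewrite /A; ring.
by rewrite !cosD cosN sinN [q ^+ L.+1]exprS; ring.
Qed.

Definition csum L t : R := \sum_(m <- ms L) r ^+ m * (1 - cos (m%:R * t)).

Definition S0 : R := (r + r ^+ 5) / (1 - q).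
Definition sin3q t : R := sin (3 * t) / kappa.
Definition pp : R := r ^+ 4 * (1 - r ^+ 2) / ((1 + r ^+ 4) * (1 - q)).
(** As L grows, the sums of r^m and of r^m cos(m t) tend to [S0] and [S0 * kk t]. The denominator is
    |1 - q e^(6it)|^2 / (1 - q)^2, so [kk] peaks where sin 3t = 0. *)
Definition kk t : R := ((1 - pp) * cos t + pp * cos (5 * t)) / (1 + sin3q t ^+ 2).

(** 1/6 is the limit as r -> 1. *)
Lemma pp01 : 0 <= pp <= 1 / 6.
Proof.
have r2 : 0 <= 1 - r ^+ 2 by rewrite subr_ge0 exprn_ile1 // ltW //; case/andP: r01.
have p1 : 0 < 1 - q by case/andP: q01; lra.
have D : 0 < (1 + r ^+ 4) * (1 - q) by rewrite mulr_gt0 // ltr_wpDr ?exprn_ge0.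
rewrite /pp; apply/andP; split.
  by apply: divr_ge0; [rewrite mulr_ge0 ?exprn_ge0 | exact: ltW].
rewrite ler_pdivrMr //.
rewrite (_ : r ^+ 4 * (1 - r ^+ 2) = (r ^+ 2) ^+ 2 * (1 - r ^+ 2)); last by ring.
rewrite (_ : (1 + r ^+ 4) * (1 - q) = (1 + (r ^+ 2) ^+ 2) * (1 - (r ^+ 2) ^+ 3)); last by ring.
have u0 := sqr_ge0 r; move: (r ^+ 2) r2 u0 => u u1 u0.
have : 0 <= (1 - u) * ((1 - u) ^+ 2 * (1 + 3 * u + u ^+ 2)) by rewrite !mulr_ge0 ?sqr_ge0 //; nra.
nra.
Qed.

Lemma S0_ge : 1 / kappa <= S0.
Proof.
have k0 := kap_gt0; have r3 : 0 < r ^+ 3 by rewrite exprn_gt0; case/andP: r01.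
have D : 0 < 2 * kappa * r ^+ 3 by rewrite pmulr_lgt0 // pmulr_rgt0.
rewrite /S0 kap_q (ler_pdivlMr _ _ D) (_ : 1 / kappa * (2 * kappa * r ^+ 3) = 2 * r ^+ 3).
  have f : r ^+ 3 + r ^+ 3 <= r + r ^+ 5 := @fold_le 3 0 2 isT.
  lra.
by field; exact: lt0r_neq0.
Qed.

Lemma csum_ge L t : S0 * (1 - kk t - q ^+ L * (1 + 2 / (1 - q))) <= csum L t.
Proof.
set C := \sum_(m <- ms L) r ^+ m * cos (m%:R * t).
have p1 : 0 < 1 - q by case/andP: q01; lra.
have E : csum L t = S0 * (1 - q ^+ L) - C.
  rewrite /csum (eq_bigr (fun m : nat => r ^+ m - r ^+ m * cos (m%:R * t))); last by move=> m _; ring.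
  rewrite sumrB; congr (_ - _); rewrite ms_sumE.
  transitivity (\sum_(k < L) (r + r ^+ 5) * q ^+ k).
    by apply: eq_bigr => k _; have [-> ->] := r_split k; ring.
  by rewrite -mulr_sumr sum0_eq /S0; ring.
set C1 := \sum_(k < L) q ^+ k * cos ((6 * k%:R + 1) * t).
set C5 := \sum_(k < L) q ^+ k * cos ((6 * k%:R + 5) * t).
have EC : C = r * C1 + r ^+ 5 * C5.
  rewrite /C ms_sumE /C1 /C5 !mulr_sumr -big_split /=; apply: eq_bigr => k _.
  have [-> ->] := r_split k.
  by rewrite -[(6 * k).+1%:R]natr1 natrD natrM; ring.
set Q := 1 - 2 * q * cos (6 * t) + q ^+ 2.
have QE : Q = (1 - q) ^+ 2 * (1 + sin3q t ^+ 2).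
  have -> : Q = (1 - q) ^+ 2 + 4 * q * sin (3 * t) ^+ 2.
    rewrite /Q (_ : 6 * t = (3 * t) *+ 2); last by rewrite -mulr_natr; ring.
    by rewrite cos_mulr2n cos2sin2 -mulr_natr; ring.
  rewrite /sin3q kap_q expr_div_n; field; exact: lt0r_neq0 kap_gt0.
have Q0 : 0 < Q by rewrite QE mulr_gt0 ?exprn_gt0 // ltr_wpDr ?sqr_ge0.
have main : Q * C <= (r + r ^+ 5) * (1 - q) * ((1 - pp) * cos t + pp * cos (5 * t))
     + (r + r ^+ 5) * (q ^+ L * 2).
  have T1 : Q * C1 = _ := cos_telescope L 1 t; have T5 : Q * C5 = _ := cos_telescope L 5 t.
  have n6 : (1 - 6) * t = - (5 * t) by ring.
  have n1 : (5 - 6) * t = - t by ring.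
  rewrite n6 cosN mul1r in T1; rewrite n1 cosN in T5.
  have err a b : - (cos a - q * cos b) <= 2.
    have := cos_geN1 a; have := cos_le1 b; have := cos_geN1 b; case/andP: q01; nra.
  have qL : 0 <= q ^+ L by rewrite exprn_ge0.
  set e1 := cos ((6 * L%:R + 1) * t) - q * cos ((6 * L%:R + 1 - 6) * t) in T1.
  set e5 := cos ((6 * L%:R + 5) * t) - q * cos ((6 * L%:R + 5 - 6) * t) in T5.
  have h1 : r * (q ^+ L * - e1) <= r * (q ^+ L * 2) by do 2!rewrite ler_wpM2l //; exact: err.
  have h5 : r ^+ 5 * (q ^+ L * - e5) <= r ^+ 5 * (q ^+ L * 2).
    by rewrite ler_wpM2l ?exprn_ge0 // ler_wpM2l //; exact: err.
  have M : (r + r ^+ 5) * (1 - q) * ((1 - pp) * cos t + pp * cos (5 * t)) =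
     r * (cos t - q * cos (5 * t)) + r ^+ 5 * (cos (5 * t) - q * cos t).
    have ne : 1 + r ^+ 4 != 0 by apply: lt0r_neq0; rewrite ltr_wpDr ?exprn_ge0.
    have P : (r + r ^+ 5) * (1 - q) * pp = r ^+ 5 * (1 - r ^+ 2).
      by rewrite /pp (_ : r + r ^+ 5 = r * (1 + r ^+ 4)); [field; rewrite q1_neq0 ne | ring].
    rewrite (_ : _ * _ = (r + r ^+ 5) * (1 - q) * cos t + (r + r ^+ 5) * (1 - q) * pp * (cos (5 * t) - cos t)); last by ring.
    by rewrite P; ring.
  rewrite M EC mulrDr (mulrCA Q r) (mulrCA Q) T1 T5; lra.
have a0 : 0 <= r + r ^+ 5 by rewrite addr_ge0 ?exprn_ge0.
rewrite E.
have key : C <= S0 * kk t + S0 * (q ^+ L * (2 / (1 - q))).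
  have g0 : 0 < 1 + sin3q t ^+ 2 by rewrite ltr_wpDr ?sqr_ge0.
  rewrite -(ler_pM2l Q0); apply: (le_trans main).
  rewrite [leRHS]mulrDr; apply: lerD.
    rewrite QE /S0 /kk le_eqVlt; apply/orP; left; apply/eqP.
    by move: q1_neq0 (lt0r_neq0 g0) => ? ?; field; apply/andP.
  rewrite QE /S0 (_ : _ * (_ / _ * _) = (r + r ^+ 5) * (q ^+ L * 2) * (1 + sin3q t ^+ 2)); last first.
    by move: q1_neq0 => ?; field.
  by rewrite ler_peMr ?mulr_ge0 ?exprn_ge0 // lerDl sqr_ge0.
rewrite (_ : S0 * _ = S0 * (1 - q ^+ L) - (S0 * kk t + S0 * (q ^+ L * (2 / (1 - q))))); last by ring.
lra.
Qed.

End PowerSums.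

(** * Estimates at the saddle point *)

Section SaddleBounds.
Variable R : realType.

Lemma sum_ms_mono (F : nat -> R) L L' : (L <= L')%N -> (forall m, 0 <= F m) ->
  \sum_(m <- ms L) F m <= \sum_(m <- ms L') F m.
Proof.
move=> LL F0; rewrite !ms_sumE; elim: L' LL => [|L' IH]; first by rewrite leqn0 => /eqP ->.
rewrite leq_eqVlt => /predU1P[->//|]; rewrite ltnS => /IH le.
by apply: (le_trans le); rewrite big_ord_recr /= lerDl addr_ge0.
Qed.

Lemma sum_ms_id L : \sum_(m <- ms L) m%:R = 6 * L%:R ^+ 2 :> R.
Proof.
rewrite ms_sumE; elim: L => [|L IH]; first by rewrite big_ord0 expr0n mulr0.
by rewrite big_ord_recr /= IH -[(6 * L).+1%:R]natr1 natrD natrM -[L.+1%:R]natr1; ring.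
Qed.

Lemma ms_lt L m : m \in ms L -> (m < 6 * L)%N.
Proof.
rewrite /ms => /flatten_mapP [k]; rewrite mem_iota !inE => /andP[_ kL] /orP[]/eqP->; lia.
Qed.

Lemma bernoulli (q : R) n : 0 <= q -> 1 - n%:R * (1 - q) <= q ^+ n.
Proof.
move=> q0; elim: n => [|n IH]; first by rewrite expr0 mul0r subr0.
rewrite exprS -natr1; have := ler_wpM2l q0 IH.
have := mulr_ge0 (ler0n R n) (sqr_ge0 (1 - q)); nra.
Qed.

Variables (d r : R) (n : nat).
Hypotheses (d34 : 3 <= d <= 4) (r01 : 0 < r < 1) (n_ge : (1610 <= n)%N).
(** With this length q^L is the cube of q^n = O(1/n), which outweighs X and 1 / (1 - q), both
    O(n). *)
Let L := (3 * n)%N.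
Hypothesis mean : d * \sum_(m <- ms L) m%:R * (r ^+ m / (1 + r ^+ m)) = n%:R.
Local Notation q := (r ^+ 6).
Local Notation kap := (kappa r).

Lemma n_geR : 1610 <= n%:R :> R.
Proof. by rewrite ler_nat. Qed.

Lemma x01 m : 0 < r ^+ m <= 1.
Proof. by case/andP: r01 => r0 r1; rewrite exprn_gt0 //= exprn_ile1 // ltW. Qed.

Lemma mean_term m : r ^+ m / 2 <= r ^+ m / (1 + r ^+ m) <= r ^+ m.
Proof.
case/andP: (x01 m) => x0 x1; have p : 0 < 1 + r ^+ m by lra.
apply/andP; split; first by rewrite ler_pM2l // lef_pV2 ?posrE //; lra.
by rewrite ler_pdivrMr // ler_peMr ?(ltW x0) //; lra.
Qed.

(** The exponents m < 6 n alone contribute at least 9 n^2 q^n to the mean n. *)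
Lemma qn_small : 9 * n%:R * q ^+ n <= 1.
Proof.
have n0 := n_geR; case/andP: (d34) => d3 _.
have H : 6 * n%:R ^+ 2 * (q ^+ n / 2) <= \sum_(m <- ms L) m%:R * (r ^+ m / (1 + r ^+ m)).
  apply: (@le_trans _ _ (\sum_(m <- ms n) m%:R * (r ^+ m / (1 + r ^+ m)))); last first.
    apply: sum_ms_mono; first by rewrite /L; lia.
    by move=> m; case/andP: (x01 m) => x0 _; rewrite mulr_ge0 // divr_ge0 ?addr_ge0 // ltW.
  rewrite -sum_ms_id mulr_suml big_seq [leRHS]big_seq; apply: ler_sum => m /ms_lt mn.
  rewrite ler_wpM2l //; apply: le_trans (proj1 (andP (mean_term m))).
  rewrite ler_pM2r // -exprM; case/andP: r01 => r0 r1.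
  by rewrite ler_wiXn2l ?ltW // ltnW.
have S0 : 0 <= 6 * n%:R ^+ 2 * (q ^+ n / 2) by rewrite !mulr_ge0 ?exprn_ge0 // ltW //; case/andP: r01.
have : 3 * (6 * n%:R ^+ 2 * (q ^+ n / 2)) <= n%:R.
  apply: (@le_trans _ _ (d * \sum_(m <- ms L) m%:R * (r ^+ m / (1 + r ^+ m)))); last by rewrite mean.
  apply: (le_trans (ler_wpM2l (_ : 0 <= 3) H)) => //.
  by rewrite ler_wpM2r // (le_trans S0 H).
rewrite (_ : 3 * _ = n%:R * (9 * n%:R * q ^+ n)); last by field.
move=> H'; have n1 : 0 < n%:R :> R by lra.
by rewrite -(ler_pM2l n1) mulr1.
Qed.

Lemma eps_ge : 1 <= 2 * n%:R * (1 - q).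
Proof.
have n0 := n_geR; have := qn_small; have q0 : 0 <= q by case/andP: (x01 6) => /ltW.
have := bernoulli n q0; have := exprn_ge0 n q0; nra.
Qed.

Lemma kap_n : 1 <= 4 * n%:R * kap.
Proof.
have E := eps_ge; rewrite kap_q // in E; have k0 := kap_gt0 r01; case/andP: (x01 3) => _ r3.
have n0 := n_geR.
apply: (le_trans E); rewrite (_ : 2 * n%:R * _ = 4 * n%:R * kap * r ^+ 3); last by ring.
by rewrite ler_piMr // mulr_ge0 ?ltW //; lra.
Qed.

(** The large parameter: at t = kappa v / 3 the exponents below are X times a function of v. *)
Definition XX : R := 3 * d / kap.

(** Equivalent to X >= 120. Otherwise 3 d <= d^2 < 1600 kappa^2, and the first moment gives n <=
    1600 + 9. *)
Lemma kap_le : 40 * kap <= d.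
Proof.
have k0 := kap_gt0 r01; case/andP: d34 => d3 d4.
have H : n%:R <= d * (3 / kap ^+ 2 + 9 / 4).
  rewrite -mean ler_wpM2l //; first lra.
  apply: le_trans (moment1_kap r01 L); apply: ler_sum => m _.
  by rewrite ler_wpM2l // (proj2 (andP (mean_term m))).
rewrite leNgt; apply/negP => kd; have n0 := n_geR.
have k20 : 0 < kap ^+ 2 by rewrite exprn_gt0.
have dd : d * d <= (40 * kap) * (40 * kap) by apply: ler_pM; lra.
have d3d : 3 * d <= d * d by rewrite ler_pM2r //; lra.
have H1 : d * (3 / kap ^+ 2) <= 40 * 40.
  rewrite mulrA ler_pdivrMr //; lra.
lra.
Qed.

Lemma kap_10 : kap <= 1 / 10.
Proof. have := kap_le; case/andP: d34; lra. Qed.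

Lemma XX_kap : XX * kap = 3 * d.
Proof. by rewrite /XX; have := lt0r_neq0 (kap_gt0 r01) => ?; field. Qed.

Lemma XX_ge : 120 <= XX.
Proof. by rewrite /XX ler_pdivlMr ?kap_gt0 //; have := kap_le; lra. Qed.

(** Error, relative to [S0], of the passage to infinite sums. *)
Definition eta : R := q ^+ L * (1 + 2 / (1 - q)).

Lemma eta_bound : 0 <= eta /\ XX * eta <= 1 / 1000.
Proof.
have n0 := n_geR; have E := eps_ge; have K := kap_n; have k0 := kap_gt0 r01.
have p1 : 0 < 1 - q by case/andP: (q01 r01); lra.
have qL0 : 0 <= q ^+ n by rewrite exprn_ge0 //; case/andP: (x01 6) => /ltW.
have i0 : 0 <= 2 / (1 - q) by rewrite divr_ge0 // ltW.
have e0 : 0 <= eta by rewrite mulr_ge0 ?addr_ge0 // exprn_ge0 //; case/andP: (x01 6) => /ltW.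
split=> //.
have i1 : 2 / (1 - q) <= 4 * n%:R by rewrite ler_pdivrMr //; lra.
have X1 : XX <= 48 * n%:R.
  rewrite /XX ler_pdivrMr //; case/andP: d34 => _ d4; lra.
have qL : n%:R ^+ 3 * q ^+ L <= 1 / 729.
  have -> : q ^+ L = (q ^+ n) ^+ 3 by rewrite /L mulnC exprM.
  have : (9 * n%:R * q ^+ n) ^+ 3 <= 1 by rewrite exprn_ile1 ?qn_small // !mulr_ge0.
  rewrite !exprMn; lra.
have : XX * eta <= 48 * n%:R * eta by rewrite ler_wpM2r.
have : eta <= q ^+ L * (5 * n%:R).
  apply: ler_wpM2l; first by rewrite exprn_ge0 //; case/andP: (x01 6) => /ltW.
  lra.
move=> e1 e2; apply: (le_trans e2).
apply: (@le_trans _ _ (48 * n%:R * (q ^+ L * (5 * n%:R)))); first by rewrite ler_wpM2l //; lra.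
have n1 : 0 < n%:R :> R by lra.
rewrite -(ler_pM2l n1) (_ : n%:R * _ = 240 * (n%:R ^+ 3 * q ^+ L)); last by ring.
lra.
Qed.

Lemma r3_ge : 9 / 10 <= r ^+ 3.
Proof.
have E := kap_q r01; have k1 := kap_10; case/andP: (x01 3) => r3 r31.
rewrite leNgt; apply/negP => lt.
have : 1 - q <= 2 / 10 * r ^+ 3 by rewrite E ler_pM2r //; lra.
rewrite (_ : q = r ^+ 3 * r ^+ 3); last by ring.
nra.
Qed.

(** y^2 e^(- y) <= 2 at y = m s, s = - ln r, while kappa <= (105/33) s and (105/33)^2 <= 81/8. *)
Lemma decay m : r ^+ m * (m%:R * kap) ^+ 2 <= 81 / 4.
Proof.
have r3 := r3_ge; case/andP: (r01) => r0 r1; have k0 := kap_gt0 r01; case/andP: (x01 m) => xm _.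
set s := - ln r.
have s3 : 1 - r ^+ 3 <= 3 * s.
  have p3 : 0 < r ^+ 3 by rewrite exprn_gt0.
  have := @le_ln1Dx R (r ^+ 3 - 1) ltac:(lra).
  rewrite (_ : 1 + (r ^+ 3 - 1) = r ^+ 3); last by ring.
  by rewrite lnXn // -mulr_natl /s; lra.
have ks : 33 * kap <= 105 * s.
  have E := kap_q r01; have E2 : q = r ^+ 3 * r ^+ 3 by ring.
  case/andP: (x01 3); move: (r ^+ 3) r3 s3 E E2 => p p9 s3 E E2 p0 p1.
  have : 33 * (2 * kap * p) <= 35 * (1 - p) * (2 * p) by rewrite -E E2; nra.
  rewrite (_ : 33 * _ = 33 * kap * (2 * p)); last by ring.
  rewrite ler_pM2r; last by lra.
  lra.
have s0 : 0 < s by lra.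
have xE : r ^+ m = (expR (m%:R * s))^-1.
  by rewrite /s mulrN expRN invrK expRM_natl lnK // posrE.
have ms0 : 0 <= m%:R * s by rewrite mulr_ge0 // ltW.
have H : r ^+ m * (m%:R * s) ^+ 2 <= 2.
  rewrite xE ler_pdivrMl ?expR_gt0 //; have := expR_ge2 ms0.
  lra.
have k2 : kap ^+ 2 <= 81 / 8 * s ^+ 2.
  have : 0 <= (105 * s - 33 * kap) * (105 * s + 33 * kap) by apply: mulr_ge0; lra.
  have := sqr_ge0 s; move: (kappa r) s {s3 ks s0 xE ms0 H k0} => k s; lra.
apply: (@le_trans _ _ (81 / 8 * (r ^+ m * (m%:R * s) ^+ 2))); last by lra.
rewrite (_ : 81 / 8 * _ = r ^+ m * m%:R ^+ 2 * (81 / 8 * s ^+ 2)); last by ring.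
rewrite exprMn mulrA; apply: ler_wpM2l k2.
by apply: mulr_ge0; [exact: ltW | exact: sqr_ge0].
Qed.

Lemma decay_v m v : r ^+ m * (m%:R * (kap * v / 3)) ^+ 2 <= 9 / 4 * v ^+ 2.
Proof.
have := ler_wpM2r (sqr_ge0 v) (decay m).
rewrite (_ : _ * v ^+ 2 = 9 * (r ^+ m * (m%:R * (kap * v / 3)) ^+ 2)); last by field.
lra.
Qed.

Lemma rm01 m : (0 < m)%N -> 0 <= r ^+ m < 1.
Proof. exact: rX01. Qed.

(** The saddle point equation cancels the linear term; the rest is cubic. v^2 <= 2/9 yields the
    hypothesis of [be_linear], and 343/1000 rounds (162 + 450/100) / 486. *)
Lemma phase_near v : 0 <= v -> v ^+ 2 <= 2 / 9 ->
  `|phase d r L (kap * v / 3) - n%:R * (kap * v / 3)| <= 343 / 1000 * XX * v ^+ 3.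
Proof.
move=> v0 v2; set t := kap * v / 3; have k0 := kap_gt0 r01; have k1 := kap_10; case/andP: (d34) => d3 _.
have t0 : 0 <= t by rewrite /t divr_ge0 // mulr_ge0 // ltW.
have -> : phase d r L t - n%:R * t =
    d * \sum_(m <- ms L) (be (r ^+ m) (m%:R * t) - r ^+ m / (1 + r ^+ m) * (m%:R * t)).
  rewrite -mean /phase -mulrA -mulrBr mulr_suml -sumrB; congr (_ * _).
  by apply: eq_bigr => m _; ring.
rewrite normrM ger0_norm; last lra.
apply: (@le_trans _ _ (d * (t ^+ 3 / 6 * \sum_(m <- ms L) m%:R ^+ 3 * r ^+ m))).
  rewrite ler_wpM2l //; first lra.
  apply: (le_trans (ler_norm_sum _ _ _)); rewrite mulr_sumr big_seq [leRHS]big_seq.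
  apply: ler_sum => m /ms_gt0 m0; apply: (le_trans (be_linear _ _ _)).
  - exact: rm01.
  - by rewrite mulr_ge0.
  - by apply: le_trans (decay_v m v) _; lra.
  by rewrite le_eqVlt; apply/orP; left; apply/eqP; ring.
have k4 : kap <= 1 / 4 by lra.
have M := moment3_kap r01 L k4.
apply: (@le_trans _ _ (d * (t ^+ 3 / 6 * ((162 + 450 * kap ^+ 2) / kap ^+ 4)))).
  by rewrite ler_wpM2l ?ler_wpM2l ?divr_ge0 ?exprn_ge0 //; lra.
have kn := lt0r_neq0 k0.
rewrite (_ : d * _ = XX * v ^+ 3 * ((162 + 450 * kap ^+ 2) / 486)); last first.
  by rewrite /XX /t; field.
rewrite mulrC -[leRHS]mulrA; apply: ler_wpM2r.
  by rewrite mulr_ge0 ?exprn_ge0 //; have := XX_ge; lra.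
have : kap ^+ 2 <= 1 / 100 by nra.
lra.
Qed.

(** v^2 <= 1/43 allows b = 9/172 in [lnqq_ge]; 36/100 rounds (172/163) (18 + 40/100) / 54. *)
Lemma modulus_lower v : 0 <= v -> v ^+ 2 <= 1 / 43 ->
  expR (- (36 / 100 * (XX * v ^+ 2))) <= modulus d r L (kap * v / 3).
Proof.
move=> v0 v2; have k0 := kap_gt0 r01; have k1 := kap_10; case/andP: (d34) => d3 _.
set t := kap * v / 3.
rewrite /modulus ler_expR.
apply: (@le_trans _ _ (\sum_(m <- ms L) d / 2 * - (r ^+ m * (m%:R * t) ^+ 2 / (1 - 9 / 172)))); last first.
  rewrite big_seq [leRHS]big_seq; apply: ler_sum => m /ms_gt0 m0.
  rewrite ler_wpM2l //; first lra.
  apply: lnqq_ge; [exact: rm01 | | lra].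
  by apply: le_trans (decay_v m v) _; lra.
have k4 : kap <= 1 / 4 by lra.
have M := moment2_kap r01 L k4.
have -> : \sum_(m <- ms L) d / 2 * - (r ^+ m * (m%:R * t) ^+ 2 / (1 - 9 / 172)) =
   - (d / 2 * (172 / 163) * t ^+ 2 * \sum_(m <- ms L) m%:R ^+ 2 * r ^+ m).
  by rewrite mulr_sumr -sumrN; apply: eq_bigr => m _; field.
rewrite lerN2; apply: (@le_trans _ _ (d / 2 * (172 / 163) * t ^+ 2 * ((18 + 40 * kap ^+ 2) / kap ^+ 3))).
  by rewrite ler_wpM2l // mulr_ge0 ?sqr_ge0 //; lra.
have kn := lt0r_neq0 k0.
rewrite (_ : _ * (_ / _) = XX * v ^+ 2 * ((18 + 40 * kap ^+ 2) * (172 / 163 / 54))); last first.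
  by rewrite /XX /t; field.
rewrite [leRHS]mulrC ler_wpM2l //.
  by rewrite mulr_ge0 ?exprn_ge0 //; have := XX_ge; lra.
have : kap ^+ 2 <= 1 / 100 by nra.
lra.
Qed.

Lemma modulus_csum t : modulus d r L t <= expR (- (d / 2 * csum r L t) + d / 4 * csum (r ^+ 2) L t).
Proof.
case/andP: (d34) => d3 _.
rewrite /modulus ler_expR /csum !mulr_sumr -sumrN -big_split /= big_seq [leRHS]big_seq.
apply: ler_sum => m /ms_gt0 m0.
have := lnqq_le (m%:R * t) (rm01 m0).
move=> H; apply: (le_trans (ler_wpM2l _ H)); first lra.
by rewrite -exprM mulnC exprM le_eqVlt; apply/orP; left; apply/eqP; field.
Qed.

Lemma csum_r2 t : csum (r ^+ 2) L t <= csum r L t.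
Proof.
rewrite /csum big_seq [leRHS]big_seq; apply: ler_sum => m _.
rewrite ler_wpM2r ?subr_ge0 ?cos_le1 // -exprM mulnC exprM.
by case/andP: (x01 m) => x0 x1; rewrite expr2 ler_piMr // ltW.
Qed.

Lemma csum_low t c : kk r t <= c -> XX * c <= XX - 1 / 1000 -> (1 - c - eta) / kap <= csum r L t.
Proof.
move=> kc c1; have k0 := kap_gt0 r01; have [e0 e1] := eta_bound; have X1 := XX_ge.
have w : 0 <= 1 - c - eta.
  have X0 : 0 < XX by lra.
  rewrite -(pmulr_rge0 _ X0); lra.
apply: le_trans (csum_ge r01 L t); rewrite -/eta.
apply: (@le_trans _ _ (S0 r * (1 - c - eta))).
  have := ler_wpM2r w (S0_ge r01); lra.
apply: ler_wpM2l; last lra.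
by apply: le_trans (S0_ge r01); rewrite divr_ge0 // ltW.
Qed.

(** Bounding the sum in r^2 by the sum in r halves the exponent; [mod_near] keeps it whole at the
    cost of a correction quadratic in v. *)
Lemma mod_far t c : kk r t <= c -> XX * c <= XX - 1 / 1000 ->
  modulus d r L t <= expR (- (XX / 12 * (1 - c) - 1 / 100 / 100)).
Proof.
move=> kc c1; apply: (le_trans (modulus_csum t)); rewrite ler_expR.
have k0 := kap_gt0 r01; have [e0 e1] := eta_bound; case/andP: (d34) => d3 _.
have H := csum_low kc c1; have H2 := csum_r2 t.
have H3 := ler_wpM2l (_ : 0 <= d / 4) H2; have H4 := ler_wpM2l (_ : 0 <= d / 4) H.
have {}H3 := H3 ltac:(lra); have {}H4 := H4 ltac:(lra).
rewrite (_ : d / 4 * ((1 - c - eta) / kap) = XX / 12 * (1 - c - eta)) in H4; last first.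
  by rewrite /XX; field; exact: lt0r_neq0.
lra.
Qed.

(** The kappa of r^2 is between 2 and 2.01 times that of r, so the second moment drops by a factor
    of about 8. *)
Lemma csum2_up v : csum (r ^+ 2) L (kap * v / 3) <= 137 / 1000 * v ^+ 2 / kap.
Proof.
have k0 := kap_gt0 r01; have k1 := kap_10; case/andP: (r01) => r0 r1.
have r201 : 0 < r ^+ 2 < 1 by rewrite exprn_gt0 //= exprn_ilt1 // ltW.
set k2 := kappa (r ^+ 2).
have rn : r != 0 by exact: lt0r_neq0.
have k2E : k2 = kap * (r ^- 3 + r ^+ 3) by rewrite /k2 /kappa; field.
have s0 : 2 <= r ^- 3 + r ^+ 3 <= 201 / 100.
  have p3 : 0 < r ^+ 3 by rewrite exprn_gt0.
  have -> : r ^- 3 + r ^+ 3 = (1 + q) / r ^+ 3 by field.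
  rewrite ler_pdivlMr // ler_pdivrMr //; apply/andP; split.
    have := sqr_ge0 (1 - r ^+ 3); rewrite (_ : q = r ^+ 3 * r ^+ 3); last by ring.
    lra.
  apply: (le_trans (kap_q3 r01)); rewrite ler_pM2r //; nra.
case/andP: s0 => s1 s2.
have k2a : 2 * kap <= k2 by rewrite k2E mulrC ler_pM2l.
have k2b : k2 <= 201 / 1000 by rewrite k2E; nra.
set t := kap * v / 3.
have M := moment2_kap r201 L ltac:(rewrite -/k2; lra).
apply: (@le_trans _ _ (t ^+ 2 / 2 * \sum_(m <- ms L) m%:R ^+ 2 * (r ^+ 2) ^+ m)).
  rewrite /csum mulr_sumr; apply: ler_sum => m _.
  have -> : t ^+ 2 / 2 * (m%:R ^+ 2 * (r ^+ 2) ^+ m) = (r ^+ 2) ^+ m * ((m%:R * t) ^+ 2 / 2) by field.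
  by rewrite ler_wpM2l ?exprn_ge0 //; have := cos_geabs (m%:R * t); lra.
apply: (le_trans (ler_wpM2l _ M)); first by rewrite divr_ge0 ?sqr_ge0.
rewrite -/k2.
have k3 : 8 * kap ^+ 3 <= k2 ^+ 3.
  have : (2 * kap) ^+ 3 <= k2 ^+ 3 by rewrite lerXn2r ?nnegrE //; lra.
  by rewrite exprMn; lra.
have k30 : 0 < kap ^+ 3 by rewrite exprn_gt0.
have : (18 + 40 * k2 ^+ 2) / k2 ^+ 3 <= (197 / 10) / (8 * kap ^+ 3).
  apply: ler_pM.
  - have := sqr_ge0 k2; lra.
  - by rewrite invr_ge0; lra.
  - have : k2 * k2 <= 41 / 200 * (41 / 200) by apply: ler_pM; lra.
    rewrite expr2; lra.
  by rewrite lef_pV2 // posrE; lra.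
move=> H; apply: (le_trans (ler_wpM2l _ H)); first by rewrite divr_ge0 ?sqr_ge0.
rewrite (_ : t ^+ 2 / 2 * _ = 197 / 1440 * v ^+ 2 / kap); last first.
  by rewrite /t; field; exact: lt0r_neq0.
have : 0 <= v ^+ 2 / kap by rewrite divr_ge0 ?sqr_ge0 // ltW.
lra.
Qed.

Lemma mod_near v c : kk r (kap * v / 3) <= c -> XX * c <= XX - 1 / 1000 ->
  modulus d r L (kap * v / 3) <= expR (- (XX / 12 * (2 * (1 - c) - 137 / 1000 * v ^+ 2) - 1 / 50 / 100)).
Proof.
move=> kc c1; apply: (le_trans (modulus_csum _)); rewrite ler_expR.
have k0 := kap_gt0 r01; have [e0 e1] := eta_bound; case/andP: (d34) => d3 _.
have H := csum_low kc c1; have H2 := csum2_up v.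
have H3 := ler_wpM2l (_ : 0 <= d / 4) H2; have H4 := ler_wpM2l (_ : 0 <= d / 2) H.
have {}H3 := H3 ltac:(lra); have {}H4 := H4 ltac:(lra).
rewrite (_ : d / 2 * ((1 - c - eta) / kap) = XX / 6 * (1 - c - eta)) in H4; last first.
  by rewrite /XX; field; exact: lt0r_neq0.
rewrite (_ : d / 4 * (137 / 1000 * v ^+ 2 / kap) = XX / 12 * (137 / 1000 * v ^+ 2)) in H3; last first.
  by rewrite /XX; field; exact: lt0r_neq0.
lra.
Qed.

End SaddleBounds.

(** * Step functions assembled from negative pieces *)

Section Pieces.
Variable R : realType.
Implicit Types (p : R * R * R) (ps : seq (R * R * R)).

(* [(N, a, b)] stands for the step function [- N * 1_(a < t <= b)]. *)
Definition neg p : seq (R * R) := [:: (- p.1.1, p.2); (p.1.1, p.1.2)].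
Definition negs ps : seq (R * R) := flatten [seq neg p | p <- ps].

Lemma step_cat (s1 s2 : seq (R * R)) t : step (s1 ++ s2) t = step s1 t + step s2 t.
Proof. by rewrite /step big_cat. Qed.

Lemma area_cat (s1 s2 : seq (R * R)) : area (s1 ++ s2) = area s1 + area s2.
Proof. by rewrite /area big_cat. Qed.

Lemma area_negs ps : area (negs ps) = - \sum_(p <- ps) p.1.1 * (p.2 - p.1.2).
Proof.
elim: ps => [|p ps IH]; first by rewrite /area !big_nil oppr0.
by rewrite /negs /= -cat1s -[in LHS](cat1s (p.1.1, _)) catA area_cat IH big_cons /area !big_cons big_nil /=; ring.
Qed.

Lemma step_neg p t : 0 <= p.1.1 -> p.1.2 <= p.2 ->
  step (neg p) t <= (if p.1.2 < t <= p.2 then - p.1.1 else 0).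
Proof.
move=> N0 ab; rewrite /step /neg !big_cons big_nil /= addr0 ltNge.
have [ta|ta] /= := leP t p.1.2; first by rewrite (le_trans ta ab); lra.
by case: (t <= p.2); lra.
Qed.

Lemma negs_cons p ps : negs (p :: ps) = neg p ++ negs ps. Proof. by []. Qed.

Lemma step_negs ps t : all (fun p => (0 <= p.1.1) && (p.1.2 <= p.2)) ps ->
  step (negs ps) t <= 0.
Proof.
elim: ps => [|p ps IH] /=; first by rewrite /step big_nil.
move=> /andP[/andP[N0 ab] /IH H]; rewrite negs_cons step_cat.
have := step_neg t N0 ab; case: ifP => _; lra.
Qed.

Lemma step_negs_mem ps p t : all (fun p => (0 <= p.1.1) && (p.1.2 <= p.2)) ps ->
  p \in ps -> p.1.2 < t <= p.2 -> step (negs ps) t <= - p.1.1.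
Proof.
elim: ps => // p' ps IH /= /andP[/andP[N0 ab] H]; rewrite inE => /orP[/eqP->|pin] tp;
  rewrite negs_cons step_cat.
  by have := step_neg t N0 ab; rewrite tp; have := step_negs t H; lra.
have := step_neg t N0 ab; have := IH H pin tp; case: ifP => _; lra.
Qed.

Lemma negs_bounds ps M : all (fun p => (0 <= p.1.2 <= M) && (0 <= p.2 <= M)) ps ->
  all (fun cb => 0 <= cb.2 <= M) (negs ps).
Proof. by elim: ps => //= p ps IH /andP[/andP[-> ->]] /IH. Qed.

Lemma geom_le (q : R) I : 0 <= q < 1 -> \sum_(i < I) q ^+ i <= (1 - q)^-1.
Proof.
move=> /andP[q0 q1]; rewrite -[leRHS]mul1r ler_pdivlMr ?subr_gt0 // mulrC.
rewrite -(big_mkord xpredT (fun i => q ^+ i)) mulrC mulr_suml.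
elim: I => [|I IH]; first by rewrite big_geq.
rewrite big_nat_recr //=.
suff -> : \sum_(0 <= i < I) q ^+ i * (1 - q) = 1 - q ^+ I.
  have := exprn_ge0 I.+1 q0; rewrite exprS; lra.
elim: I {IH} => [|I IH]; first by rewrite big_geq // expr0 subrr.
by rewrite big_nat_recr //= IH exprS; ring.
Qed.

Lemma nat_below (y : R) : 0 < y -> exists j : nat, j%:R < y <= j.+1%:R.
Proof.
move=> y0; have /andP[l1 l2] := truncn_itv (ltW y0).
move: l1; rewrite le_eqVlt => /predU1P[E|lt]; last by exists (Num.truncn y); rewrite lt ltW.
move: E; case: (Num.truncn y) => [|j] E; first by rewrite -E ltxx in y0.
by exists j; rewrite -E lexx ltr_nat ltnSn.
Qed.

End Pieces.

(** * Upper bounds for [kk] *)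

Section Kernel.
Variables (R : realType) (r : R).
Hypotheses (r01 : 0 < r < 1) (k10 : kappa r <= 1 / 10).
Local Notation kap := (kappa r).

Lemma kap_sq_le : kap ^+ 2 <= 1 / 100.
Proof.
have k0 := kap_gt0 r01; have k1 := k10.
have : kap * kap <= 1 / 10 * (1 / 10) by apply: ler_pM; lra.
rewrite expr2; lra.
Qed.

Definition num t : R := (1 - pp r) * cos t + pp r * cos (5 * t).

Lemma num_le1 t : num t <= 1.
Proof.
case/andP: (pp01 r01) => p0 p1; rewrite /num.
have := ler_wpM2l p0 (cos_le1 (5 * t)).
have := ler_wpM2l (_ : 0 <= 1 - pp r) (cos_le1 t); move=> /(_ ltac:(lra)); lra.
Qed.

Lemma kk_le t B G : num t <= B -> 0 <= B -> 0 <= G -> G <= sin3q r t ^+ 2 -> kk r t <= B / (1 + G).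
Proof.
move=> nB B0 G0 Gg; rewrite /kk -/(num t).
have p : 0 < 1 + sin3q r t ^+ 2 by lra.
apply: (@le_trans _ _ (B / (1 + sin3q r t ^+ 2))); first by rewrite ler_wpM2r // invr_ge0 ltW.
by rewrite ler_wpM2l // lef_pV2 ?posrE //; lra.
Qed.

Lemma kk_le_cst t B G c : num t <= B -> 0 <= B -> 0 <= G -> G <= sin3q r t ^+ 2 ->
  B <= c * (1 + G) -> kk r t <= c.
Proof.
move=> nB B0 G0 Gg Bc; apply: (le_trans (kk_le nB B0 G0 Gg)).
by rewrite ler_pdivrMr //; lra.
Qed.

Lemma g_sq u1 u : 0 <= u1 -> u1 <= u -> u <= 53 / 10 ->
  (u1 * (1 - u1 ^+ 2 / 600)) ^+ 2 <= (sin (kap * u) / kap) ^+ 2.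
Proof.
move=> u10 u1u u53; have k0 := kap_gt0 r01; have u0 := le_trans u10 u1u.
have ku0 : 0 <= kap * u by rewrite mulr_ge0 // ltW.
have A : u * (1 - u ^+ 2 / 600) <= sin (kap * u) / kap.
  rewrite ler_pdivlMr //; apply: le_trans (sin_ge3 ku0).
  have k2 := kap_sq_le; have : (kap * u) ^+ 3 <= u ^+ 3 * kap * (1 / 100).
    rewrite (_ : (kap * u) ^+ 3 = u ^+ 3 * kap * kap ^+ 2); last by ring.
    apply: ler_wpM2l => //; apply: mulr_ge0; [exact: exprn_ge0 | exact: ltW].
  lra.
have B : u1 * (1 - u1 ^+ 2 / 600) <= u * (1 - u ^+ 2 / 600).
  have : 0 <= (u - u1) * (600 - (u ^+ 2 + u * u1 + u1 ^+ 2)) by apply: mulr_ge0; nra.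
  lra.
have C : 0 <= u1 * (1 - u1 ^+ 2 / 600) .
  have w : u1 * u1 <= 53 / 10 * (53 / 10) by apply: ler_pM; lra.
  by apply: mulr_ge0; [exact: u10 | rewrite expr2; lra].
by rewrite ler_sqr ?nnegrE ?(le_trans B A) //; exact: le_trans C (le_trans B A).
Qed.

Lemma gg_near u : sin3q r (kap * u / 3) = sin (kap * u) / kap.
Proof. by rewrite /sin3q; congr (sin _ / _); field. Qed.

Lemma gg_window t u : `|t - pi / 3| = kap * u / 3 -> sin3q r t ^+ 2 = (sin (kap * u) / kap) ^+ 2.
Proof.
move=> E; rewrite /sin3q; have E3 : kap * u = `|3 * t - pi|.
  rewrite (_ : 3 * t - pi = 3 * (t - pi / 3)); last by field.
  by rewrite normrM ger0_norm // E; field.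
rewrite E3; have -> : sin (3 * t) = - sin (3 * t - pi) by rewrite sinB cospi sinpi; ring.
by have [?|?] := leP 0 (3 * t - pi); [rewrite ger0_norm // mulNr sqrrN | rewrite ltr0_norm // sinN].
Qed.

Lemma cos_pi3 : cos (pi / 3) = 1 / 2 :> R.
Proof.
set c := cos (pi / 3); have c3 : 4 * c ^+ 3 - 3 * c = -1.
  have := cospi R; rewrite {1}(_ : pi = pi / 3 + (pi / 3 + pi / 3)); last by field.
  rewrite !cosD sinD -/c => <-; have := sin2cos2 (pi / 3 : R); rewrite -/c.
  move: (sin (pi / 3)) => s sE.
  transitivity (c * (c * c - s ^+ 2) - 2 * s ^+ 2 * c); last by ring.
  by rewrite sE; ring.
have c0 : 0 < c.
  apply: cos_gt0_pihalf; have := pi_gt0 R; lra.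
have : (c + 1) * (2 * c - 1) ^+ 2 = 0 by transitivity (4 * c ^+ 3 - 3 * c + 1); [ring | rewrite c3; ring].
move=> /eqP; rewrite mulf_eq0 sqrf_eq0 => /orP[] /eqP; lra.
Qed.

(** Both cosines equal 1/2 at pi / 3, and the Lipschitz constant is 1 + 4 [pp] <= 5/3. *)
Lemma num_window t : num t <= 1 / 2 + 5 / 3 * `|t - pi / 3|.
Proof.
case/andP: (pp01 r01) => p0 p1; rewrite /num.
have c1 := cos_lip t (pi / 3); have c5 := cos_lip (5 * t) (5 * (pi / 3)).
have e5 : cos (5 * (pi / 3)) = 1 / 2 :> R.
  rewrite (_ : 5 * (pi / 3) = - (pi / 3) + pi *+ 2); last by rewrite -mulr_natr; field.
  by rewrite cosD2pi cosN cos_pi3.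
have n5 : `|5 * t - 5 * (pi / 3)| = 5 * `|t - pi / 3| by rewrite -mulrBr normrM ger0_norm.
rewrite cos_pi3 in c1; rewrite e5 n5 in c5.
move: c1 c5; rewrite !ler_norml => /andP[_ c1] /andP[_ c5].
move: (normr_ge0 (t - pi / 3)) c1 c5; set w := `|_| => w0 c1 c5.
have := ler_wpM2l p0 c5; have := ler_wpM2l (_ : 0 <= 1 - pp r) c1; move=> /(_ ltac:(lra)).
have : pp r * w <= 1 / 6 * w by rewrite ler_wpM2r.
lra.
Qed.

Lemma sin_far a : 53 / 10 * kap <= a <= pi / 2 -> (5 * kap) <= sin a.
Proof.
move=> /andP[a1 a2]; have k0 := kap_gt0 r01.
have b0 : 0 <= 53 / 10 * kap by lra.
apply: (@le_trans _ _ (sin (53 / 10 * kap))).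
  apply: le_trans (sin_ge3 b0); have k2 := kap_sq_le.
  have : kap ^+ 3 <= kap * (1 / 100).
    rewrite (_ : kap ^+ 3 = kap * kap ^+ 2); last by ring.
    by apply: ler_wpM2l => //; exact: ltW.
  lra.
apply: (mvt_mono (df := @cos R)) => // x /andP[x1 x2].
apply: cos_ge0_pihalf; apply/andP; split; last exact: le_trans a2.
have := pi_gt0 R; lra.
Qed.

Lemma kk_far t : 0 < t < pi -> 53 / 10 * (kap / 3) < t ->
  53 / 10 * (kap / 3) <= `|t - pi / 3| -> kk r t <= 1 / 26.
Proof.
move=> /andP[t0 tpi] th tw; have k0 := kap_gt0 r01; case/andP: (pp01 r01) => p0 p1.
(* At this threshold the numerator is at most - (5/6) (1/5) + 1/6 = 0. *)
have [c2|c2] := leP (cos t) (- (1 / 5)).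
  apply: (@le_trans _ _ 0) => //; apply: mulr_le0_ge0; last by rewrite invr_ge0 addr_ge0 ?sqr_ge0.
  have := ler_wpM2l p0 (cos_le1 (5 * t)).
  have := ler_wpM2l (_ : 0 <= 1 - pp r) c2; move=> /(_ ltac:(lra)); lra.
suff g25 : 25 <= sin3q r t ^+ 2.
  have := kk_le (num_le1 t) ler01 (_ : 0 <= 25) g25; move=> /(_ ltac:(lra)).
  by rewrite (_ : 1 + 25 = 26 :> R); last by ring.
suff : (5 * kap) ^+ 2 <= sin (3 * t) ^+ 2.
  rewrite /sin3q expr_div_n => H; rewrite ler_pdivlMr ?exprn_gt0 //.
  by rewrite exprMn in H; lra.
have s3 : sin (3 * t) = sin t * (4 * cos t ^+ 2 - 1).
  rewrite (_ : 3 * t = t + (t + t)); last by ring.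
  rewrite !sinD cosD; have := sin2cos2 t; move: (sin t) (cos t) => s c sE.
  transitivity (s * (3 * c ^+ 2 - s ^+ 2)); first by ring.
  by rewrite sE; ring.
(* For |cos t| <= 1/5 the triple angle formula keeps sin 3t away from 0. Otherwise t < pi / 2, and
   3t is at least 53/10 kappa away from both zeros 0 and pi. *)
have [c3|c3] := leP (cos t) (1 / 5).
  rewrite s3 [(sin t * _) ^+ 2]exprMn sin2cos2.
  have cc : cos t ^+ 2 <= 1 / 25 by nra.
  have k2 := kap_sq_le.
  have := sqr_ge0 (cos t); move: (cos t ^+ 2) cc => w w1 w0.
  have : (24 / 25) * (84 / 100) ^+ 2 <= (1 - w) * (4 * w - 1) ^+ 2.
    apply: ler_pM; [lra | lra | lra | nra].
  rewrite exprMn; lra.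
have tp2 : t < pi / 2.
  rewrite ltNge; apply/negP => h.
  have : 0 <= cos (pi - t).
    apply: cos_ge0_pihalf; apply/andP; split; have := pi_gt0 R; lra.
  by rewrite cosB cospi sinpi; lra.
have sq (z : R) : 5 * kap <= z -> (5 * kap) ^+ 2 <= z ^+ 2.
  by move=> H; rewrite ler_sqr ?nnegrE //; lra.
have [w0|w0] := leP 0 (t - pi / 3).
  rewrite ger0_norm // in tw.
  have -> : sin (3 * t) ^+ 2 = sin (3 * t - pi) ^+ 2 by rewrite sinB cospi sinpi; ring.
  by apply: sq; apply: sin_far; apply/andP; split; lra.
rewrite ltr0_norm // in tw.
have [h|h] := leP (3 * t) (pi / 2).
  by apply: sq; apply: sin_far; apply/andP; split; lra.
have -> : sin (3 * t) = sin (pi - 3 * t) by rewrite sinB cospi sinpi; ring.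
by apply: sq; apply: sin_far; apply/andP; split; lra.
Qed.

End Kernel.

(** * Decay of the modulus in terms of X *)

Lemma near_inv (R : realFieldType) (a u : R) : 0 <= a <= 1 -> 0 <= u ->
  1 / (1 + a * u) <= 1 - a * u / (1 + u).
Proof.
move=> /andP[a0 a1] u0; have p1 : 0 < 1 + u by lra.
have p2 : 0 < 1 + a * u by rewrite ltr_wpDr // mulr_ge0.
rewrite -subr_ge0 (_ : _ - _ = a * (1 - a) * u ^+ 2 / ((1 + u) * (1 + a * u))).
  apply: divr_ge0; last by apply: mulr_ge0; exact: ltW.
  by apply: mulr_ge0; [apply: mulr_ge0; rewrite ?subr_ge0 | exact: sqr_ge0].
by field; rewrite !lt0r_neq0.
Qed.

(** With z = X u the right side is z X / (X + z). It increases with X, whence B at z = w, and its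
    chords for w, z <= X have slope at least 1/4. *)
Lemma near_chord (R : realFieldType) (X u w B : R) : 120 <= X -> 0 <= u <= 1 -> 1 <= w ->
  w <= X * u -> B * (120 + w) <= w * 120 -> B + (X * u - w) / 4 <= X * (u / (1 + u)).
Proof.
move=> X1 /andP[u0 u1] w1 wX HB.
have up : 0 < 1 + u by lra.
have Xw : 0 < X + w by lra.
have s1 : B <= w * X / (X + w).
  have wp : 0 < 120 + w by lra.
  apply: (@le_trans _ _ (w * 120 / (120 + w))); first by rewrite ler_pdivlMr.
  rewrite ler_pdivlMr // mulrAC ler_pdivrMr //.
  have : 0 <= w * w * (X - 120) by rewrite !mulr_ge0 ?subr_ge0 //; lra.
  by clear; lra.
have s2 : (X * u - w) / 4 <= X * (u / (1 + u)) - w * X / (X + w).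
  have Xu : X * u <= X by rewrite ler_piMr //; lra.
  rewrite (_ : X * (u / (1 + u)) - _ = (X * u - w) * (X / ((1 + u) * (X + w)))); last first.
    by field; rewrite !lt0r_neq0.
  apply: ler_wpM2l; first by rewrite subr_ge0.
  rewrite ler_pdivlMr; last exact: mulr_gt0.
  have : (1 + u) * (X + w) <= 2 * (2 * X) by apply: ler_pM; clear - u0 u1 Xu wX w1 X1 up Xw; lra.
  by clear; lra.
by clear - s1 s2; lra.
Qed.

Section Saddle.
Variables (R : realType) (d r : R) (n : nat).
Hypotheses (d34 : 3 <= d <= 4) (r01 : 0 < r < 1) (n_ge : (1610 <= n)%N).
Hypothesis mean :
  d * \sum_(m <- ms (3 * n)) m%:R * (r ^+ m / (1 + r ^+ m)) = n%:R.
Local Notation kap := (kappa r).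
Local Notation X := (XX d r).
Local Notation Phi := (modulus d r (3 * n)).

Let k0 : 0 < kap := kap_gt0 r01.
Let k10 : kap <= 1 / 10 := kap_10 d34 r01 n_ge mean.
Let X120 : 120 <= X := XX_ge d34 r01 n_ge mean.
Let X0 : 0 < X. Proof. by apply: lt_le_trans X120; rewrite ltr0n. Qed.

(** X e^(- a X) decreases for X >= 1 / a, and 1 / a <= 120: a bound at X = 120 extends with the
    factor 120 / X. *)
Lemma expR_scaled a M : 1 / 120 <= a -> expR (- (120 * a)) <= M ->
  expR (- (a * X)) <= M * (120 / X).
Proof.
move=> a0 HM; have X1 := X120; have X2 := X0; have -> : - (a * X) = - (120 * a) + - (a * (X - 120)) by ring.
have p : 0 < 120 / X by rewrite divr_gt0 // ltr0n.
rewrite expRD; apply: ler_pM HM _; [exact: expR_ge0 | exact: expR_ge0 |].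
rewrite expRN -[120 / X]invrK lef_pV2 ?posrE ?expR_gt0 ?invr_gt0 //.
apply: le_trans (expR_ge1Dx _); rewrite invf_div ler_pdivrMr //.
have : (a - 1 / 120) * (X - 120) >= 0 by apply: mulr_ge0; lra.
lra.
Qed.

Lemma Phi_far t c a M : kk r t <= c -> 0 <= c <= 99 / 100 -> 1 / 120 <= a ->
  12 * a + 1 / 200 / 400 <= 1 - c -> expR (- (120 * a)) <= M -> Phi t <= M * (120 / X).
Proof.
move=> kc /andP[c0 c1] a0 ac HM; have X1 := X120; have X2 := X0.
apply: le_trans (expR_scaled a0 HM); apply: (le_trans (mod_far d34 r01 n_ge mean kc _)).
  have : 0 <= (X - 120) * (1 - c - 1 / 100) by apply: mulr_ge0; lra.
  lra.
rewrite ler_expR lerN2.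
have : 0 <= (1 - c - 12 * a - 1 / 200 / 400) * X by apply: mulr_ge0; lra.
lra.
Qed.

(** The first bound is a constant for X v^2 >= w. The second, with 859 = 1992/2 - 137, serves the
    tail, whose number of pieces grows with X. *)
Lemma Phi_near v w B : 0 <= v <= 1 -> 0 <= w <= 120 -> 1 <= w -> w <= X * v ^+ 2 ->
  B * (120 + w) <= w * 120 ->
  Phi (kap * v / 3) <=
  expR (- ((1992 / 1000 * B - 137 / 1000 * w) / 12 - 1 / 50 / 100)) /\
  Phi (kap * v / 3) <= expR (- (859 / 1000 / 12 * (X * v ^+ 2) - 1 / 50 / 100)).
Proof.
move=> /andP[v0 v1] /andP[w0 w120] w1 wX HB; have X1 := X120; have X2 := X0.
set u := v ^+ 2 in wX *; have u0 : 0 <= u := sqr_ge0 v.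
have u1 : u <= 1 by rewrite /u exprn_ile1.
have up : 0 < 1 + u by clear -k0 k10 X120 X0 mean n_ge d34 r01 u0; lra.
have G : 996 / 1000 * u <= sin3q r (kap * v / 3) ^+ 2.
  rewrite gg_near; apply: le_trans (g_sq r01 k10 v0 (lexx v) _); last by clear -k0 k10 X120 X0 mean n_ge d34 r01 v1; lra.
  rewrite exprMn -/u [leRHS]mulrC; apply: ler_wpM2r; first exact: u0.
  have : (1 - 1 / 600) ^+ 2 <= (1 - u / 600) ^+ 2 by rewrite ler_sqr ?nnegrE; clear -k0 k10 X120 X0 mean n_ge d34 r01 u0 u1; lra.
  by lra.
pose c := 1 - 996 / 1000 * u / (1 + u).
have kc : kk r (kap * v / 3) <= c.
  apply: (@le_trans _ _ (1 / (1 + 996 / 1000 * u))); last first.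
    by apply: near_inv => //; clear -k0 k10 X120 X0 mean n_ge d34 r01; apply/andP; split; lra.
  apply: kk_le (num_le1 r01 _) ler01 _ G.
  by clear -k0 k10 X120 X0 mean n_ge d34 r01 u0; lra.
have half : u / 2 <= u / (1 + u) by rewrite ler_wpM2l // lef_pV2 ?posrE //; clear -k0 k10 X120 X0 mean n_ge d34 r01 u1; lra.
have Xhalf := ler_wpM2l (ltW X0) half.
have cX : X * c <= X - 1 / 1000.
  by rewrite /c; clear -k0 k10 X120 X0 mean n_ge d34 r01 Xhalf wX w1; lra.
have H := mod_near d34 r01 n_ge mean kc cX.
have E : X / 12 * (2 * (1 - c) - 137 / 1000 * u) =
   (1992 / 1000 * (X * (u / (1 + u))) - 137 / 1000 * (X * u)) / 12 by rewrite /c; field; exact: lt0r_neq0.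
rewrite -/u E in H.
have u01 : 0 <= u <= 1 by rewrite u0.
have K := near_chord X1 u01 w1 wX HB.
split; apply: (le_trans H); rewrite ler_expR lerN2 lerD2r.
  by rewrite ler_pM2r ?invr_gt0 //; clear -k0 k10 X120 X0 mean n_ge d34 r01 K wX; lra.
by clear -k0 k10 X120 X0 mean n_ge d34 r01 Xhalf; lra.
Qed.

End Saddle.

(** * Numerical values of exp *)

Section Numerics.
Variable R : realType.
Implicit Types x b y M : R.

Lemma expRN_num (k : nat) x b y M : 0 <= x -> 0 <= b -> b <= 1 + x + x ^+ 2 / 2 + x ^+ 3 / 6 ->
  0 <= M -> 1 <= M * b ^+ k -> k%:R * x <= y -> expR (- y) <= M.
Proof.
move=> x0 b0 bx M0 Mb kxy; apply: (expRN_le x0 kxy); apply: (le_trans Mb).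
by rewrite ler_wpM2l // lerXn2r ?nnegrE // (le_trans b0).
Qed.

Lemma near_num : [/\ expR (- (1791 / 1000)) <= 17 / 100 :> R, expR (- (1097 / 400)) <= 33 / 500 :> R,
  expR (- (837 / 200)) <= 155 / 100 / 100 :> R & expR (- (572 / 1000)) <= 57 / 100 :> R].
Proof.
split.
- by apply: (@expRN_num 3 (597 / 1000) (181 / 100)); lra.
- by apply: (@expRN_num 5 (1097 / 400 / 5) (863 / 500)); lra.
- by apply: (@expRN_num 10 (837 / 200 / 10) (1518 / 1000)); lra.
by apply: (@expRN_num 1 (572 / 1000) (883 / 500)); lra.
Qed.

Lemma far_num : [/\ expR (- (496 / 100)) <= 72 / 100 / 100 :> R, expR (- (797 / 100)) <= 37 / 100 / 100 / 10 :> R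
  & expR (- (2403 / 500)) <= 84 / 100 / 100 :> R].
Proof.
split.
- by apply: (@expRN_num 10 (496 / 1000) (1639 / 1000)); lra.
- by apply: (@expRN_num 12 (664 / 1000) (1933 / 1000)); lra.
by apply: (@expRN_num 10 (480 / 1000) (1613 / 1000)); lra.
Qed.

Lemma window_num : [/\ expR (- (472 / 100)) <= 92 / 100 / 100 :> R, expR (- (555 / 100)) <= 41 / 100 / 100 :> R,
  expR (- (693 / 100)) <= 105 / 100 / 100 / 10 :> R & expR (- (839 / 100)) <= 1 / 40 / 100 :> R].
Proof.
split.
- by apply: (@expRN_num 10 (472 / 1000) (8 / 5)); lra.
- by apply: (@expRN_num 10 (555 / 1000) (1737 / 1000)); lra.
- by apply: (@expRN_num 12 (231 / 400) (1776 / 1000)); lra.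
by apply: (@expRN_num 12 (699 / 1000) 2); lra.
Qed.

End Numerics.

(** * The step function and its area *)

Section StepFunction.
Variables (R : realType) (d r : R) (n : nat).
Hypotheses (d34 : 3 <= d <= 4) (r01 : 0 < r < 1) (n_ge : (1610 <= n)%N).
Hypothesis mean :
  d * \sum_(m <- ms (3 * n)) m%:R * (r ^+ m / (1 + r ^+ m)) = n%:R.
Local Notation kap := (kappa r).
Local Notation X := (XX d r).
Local Notation Phi := (modulus d r (3 * n)).
Local Notation theta t := (phase d r (3 * n) t - n%:R * t).

Definition sX : R := Num.sqrt X.
Definition hw : R := kap / 3.
Definition sg : R := hw / sX.
Definition TT : R := 120 / X.

Lemma sX_facts : [/\ 0 < sX, sX ^+ 2 = X & 219 / 20 <= sX].
Proof.
have X1 := XX_ge d34 r01 n_ge mean.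
have E : sX ^+ 2 = X by rewrite sqr_sqrtr //; lra.
have s0 : 0 <= sX by rewrite sqrtr_ge0.
have s1 : 219 / 20 <= sX by rewrite -ler_sqr ?nnegrE ?E //; clear -mean n_ge d34 r01 X1; lra.
split=> //; lra.
Qed.

Lemma Phi_ge0 t : 0 <= Phi t. Proof. exact: expR_ge0. Qed.

(** y is t in units of [sg]. 69/100 = 34/100 + 35/100 are the heights used in [steps]; up to y =
    36/10 the phase stays within 3/2 < pi / 2. *)
Lemma main_region v : 0 <= v -> let y := v * sX in let t := kap * v / 3 in
  [/\ y <= 1 -> 69 / 100 <= Phi t * cos (theta t),
      y <= 167 / 100 -> 35 / 100 <= Phi t * cos (theta t) &
      y <= 36 / 10 -> 0 <= Phi t * cos (theta t)].
Proof.
move=> v0 y t; have [s0 sE s1] := sX_facts; have X1 := XX_ge d34 r01 n_ge mean.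
have y0 : 0 <= y by rewrite mulr_ge0 // ltW.
have yE : X * v ^+ 2 = y ^+ 2 by rewrite -sE /y; ring.
have vy : 219 / 20 * v <= y by rewrite /y mulrC ler_wpM2l.
have v2 : 120 * v ^+ 2 <= y ^+ 2 by rewrite -yE ler_wpM2r // sqr_ge0.
have th : v ^+ 2 <= 2 / 9 -> `|theta t| <= 7 / 20 * (y ^+ 2 * v).
  move=> h; apply: (le_trans (phase_near d34 r01 n_ge mean v0 h)).
  have -> : 343 / 1000 * X * v ^+ 3 = 343 / 1000 * (y ^+ 2 * v) by rewrite -yE; ring.
  have p : 0 <= y ^+ 2 * v by rewrite mulr_ge0 ?sqr_ge0.
  by clear -mean n_ge d34 r01 p; apply: ler_wpM2r => //; lra.
have cosb b : 0 <= b -> `|theta t| <= b -> 1 - b ^+ 2 / 2 <= cos (theta t).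
  move=> b0 tb; apply: le_trans (cos_geabs _).
  have : theta t ^+ 2 <= b ^+ 2 by rewrite -real_normK ?num_real // ler_sqr ?nnegrE.
  lra.
split=> yb.
- have y2 : y ^+ 2 <= 1 by rewrite exprn_ile1.
  have t1 : `|theta t| <= 1 / 25.
    apply: le_trans (th _) _; first by clear -mean n_ge d34 r01 v2 y2; lra.
    have : y ^+ 2 * v <= 1 * (20 / 219) by apply: ler_pM; rewrite ?sqr_ge0 //; clear -mean n_ge d34 r01 vy yb; lra.
    clear -mean n_ge d34 r01; lra.
  have b0 : 0 <= 1 / 25 :> R by clear -mean n_ge d34 r01; lra.
  have c := cosb _ b0 t1.
  have P : 139 / 200 <= Phi t.
    apply: le_trans (modulus_lower d34 r01 n_ge mean v0 _); last by clear -mean n_ge d34 r01 v2 y2; lra.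
    apply: (@le_trans _ _ (expR (- (36 / 100)))); last by rewrite ler_expR yE; clear -mean n_ge d34 r01 y2; lra.
    apply: le_trans (expRN_ge3 (_ : 0 <= 36 / 100)); clear -mean n_ge d34 r01; lra.
  apply: (@le_trans _ _ (139 / 200 * (199 / 200))); first by clear -mean n_ge d34 r01; lra.
  by apply: ler_pM; [clear -mean n_ge d34 r01; lra | clear -mean n_ge d34 r01; lra | exact: P | clear -mean n_ge d34 r01 c; lra].
- have y2 : y * y <= 167 / 100 * (167 / 100) by apply: ler_pM.
  rewrite -expr2 in y2.
  have t1 : `|theta t| <= 3 / 20.
    apply: le_trans (th _) _; first by clear -mean n_ge d34 r01 v2 y2; lra.
    have : y ^+ 2 * v <= (167 / 100 * (167 / 100)) * (167 / 100 * (20 / 219)) by apply: ler_pM; rewrite ?sqr_ge0 //; clear -mean n_ge d34 r01 vy yb; lra.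
    clear -mean n_ge d34 r01; lra.
  have b0 : 0 <= 3 / 20 :> R by clear -mean n_ge d34 r01; lra.
  have c := cosb _ b0 t1.
  have P : 3 / 5 * (3 / 5) <= Phi t.
    apply: le_trans (modulus_lower d34 r01 n_ge mean v0 _); last by clear -mean n_ge d34 r01 v2 y2; lra.
    apply: (@le_trans _ _ (expR (- (101 / 200)) * expR (- (101 / 200)))).
      have e : 3 / 5 <= expR (- (101 / 200) : R) by apply: le_trans (expRN_ge3 (_ : 0 <= 101 / 200)); clear -mean n_ge d34 r01; lra.
      by apply: ler_pM; [clear -mean n_ge d34 r01; lra | clear -mean n_ge d34 r01; lra | exact: e | exact: e].
    by rewrite -expRD ler_expR yE; clear -mean n_ge d34 r01 y2; lra.
  apply: (@le_trans _ _ (3 / 5 * (3 / 5) * (49 / 50))); first by clear -mean n_ge d34 r01; lra.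
  by apply: ler_pM; [clear -mean n_ge d34 r01; lra | clear -mean n_ge d34 r01; lra | exact: P | clear -mean n_ge d34 r01 c; lra].
have y2 : y * y <= 36 / 10 * (36 / 10) by apply: ler_pM.
rewrite -expr2 in y2.
have t1 : `|theta t| <= 3 / 2.
  apply: le_trans (th _) _; first by clear -mean n_ge d34 r01 v2 y2; lra.
  have : y ^+ 2 * v <= (36 / 10 * (36 / 10)) * (36 / 10 * (20 / 219)) by apply: ler_pM; rewrite ?sqr_ge0 //; clear -mean n_ge d34 r01 vy yb; lra.
  clear -mean n_ge d34 r01; lra.
apply: mulr_ge0; first exact: Phi_ge0.
rewrite -cos_abs; apply: le_trans (cos_ge6 (normr_ge0 _)).
move: (normr_ge0 (theta t)) t1; move: `|theta t| => z z0 z1; clear -mean n_ge d34 r01 z0 z1.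
have z2 : z * z <= 3 / 2 * (3 / 2) by apply: ler_pM.
rewrite (_ : z ^+ 4 = (z * z) ^+ 2); last by ring.
rewrite (_ : z ^+ 6 = (z * z) ^+ 3); last by ring.
rewrite expr2; have : 0 <= z * z by rewrite mulr_ge0.
move: (z * z) z2 => w w1 w0; clear -mean n_ge d34 r01 w0 w1.
have : 0 <= (w - 2) ^+ 2 * (1 / 24 - w / 720) by apply: mulr_ge0; [exact: sqr_ge0 | lra].
nra.
Qed.

(* Upper bounds for the modulus beyond [36/10 sg], [sg] being the width of the peak at 0:
   first the tail of that peak, then (with a factor [TT], since the bounds are fitted at
   the extreme case [X = 120]) the windows around the secondary peak at [pi / 3], then
   everything else. *)
Definition pieces (I : nat) : seq (R * R * R) :=
  [:: (17 / 100, 36 / 10 * sg, 46 / 10 * sg);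
      (33 / 500, 46 / 10 * sg, 6 * sg);
      (155 / 100 / 100, 6 * sg, 8 * sg);
      (72 / 100 / 100 * TT, hw, 2 * hw);
      (37 / 100 / 100 / 10 * TT, 2 * hw, 53 / 10 * hw);
      (92 / 100 / 100 * TT, pi / 3 - hw / 2, pi / 3 + hw / 2);
      (41 / 100 / 100 * TT, pi / 3 - hw, pi / 3 + hw);
      (105 / 100 / 100 / 10 * TT, pi / 3 - 2 * hw, pi / 3 + 2 * hw);
      (1 / 40 / 100 * TT, pi / 3 - 53 / 10 * hw, pi / 3 + 53 / 10 * hw);
      ((84 / 100 / 100 * TT) ^+ 2, 0, pi)] ++
  [seq ((57 / 100) ^+ (8 + i), (8 + i)%:R * sg, (9 + i)%:R * sg) | i <- iota 0 I].

(** Enough pieces of width [sg] to reach t = [hw], which is y = [sX]. *)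
Definition II : nat := (Num.truncn sX).+1.

Lemma hs_facts : [/\ 0 < hw, hw <= 1 / 30, 0 < sg, sg * sX = hw & 0 < TT /\ 2 <= pi :> R].
Proof.
have [s0 sE s1] := sX_facts; have k0 := kap_gt0 r01; have k1 := kap_10 d34 r01 n_ge mean.
have X1 := XX_ge d34 r01 n_ge mean.
split; rewrite /hw /sg /TT.
- by lra.
- by lra.
- by apply: divr_gt0; [apply: divr_gt0; [exact: k0 | rewrite ltr0n] | exact: s0].
- by rewrite /hw mulfVK // lt0r_neq0.
split; first by rewrite divr_gt0 ?ltr0n //; lra.
have := pihalf_ge1 R; lra.
Qed.

Lemma pieces_ok : all (fun p => (0 <= p.1.1) && (p.1.2 <= p.2)) (pieces II).
Proof.
have [h0 h1 g0 gE [T0 p2]] := hs_facts.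
rewrite /pieces all_cat; apply/andP; split.
  rewrite /= sqr_ge0 /=; do ![apply/andP; split]; lra.
rewrite all_map; apply/allP => i _ /=; apply/andP; split; first by rewrite exprn_ge0 //; lra.
by rewrite ler_pM2r // ler_nat.
Qed.

Lemma II_bound i : (i < II)%N -> (9 + i)%:R * sg <= 2 * hw.
Proof.
have [h0 h1 g0 gE [T0 p2]] := hs_facts; have [s0 sE s1] := sX_facts.
rewrite /II ltnS => iI; rewrite -gE (_ : 2 * (sg * sX) = sg * (2 * sX)); last by ring.
rewrite [leLHS]mulrC ler_pM2l //.
have /andP[l1 _] := truncn_itv (ltW s0).
have : i%:R <= (Num.truncn sX)%:R :> R by rewrite ler_nat.
rewrite natrD; lra.
Qed.

Lemma pieces_in : all (fun p => (0 <= p.1.2 <= pi) && (0 <= p.2 <= pi)) (pieces II).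
Proof.
have [h0 h1 g0 gE [T0 p2]] := hs_facts; have [s0 sE s1] := sX_facts.
have gh : 219 / 20 * sg <= hw by rewrite -gE mulrC ler_pM2l.
rewrite /pieces all_cat; apply/andP; split.
  rewrite /= lexx /=; clear -mean n_ge d34 r01 h0 h1 g0 T0 p2 gh.
  by do ![apply/andP; split]; lra.
rewrite all_map; apply/allP => i; rewrite mem_iota add0n => /andP[_ /II_bound b] /=.
have p0 : 0 <= i%:R * sg by rewrite mulr_ge0 // ltW.
rewrite !natrD in b *; rewrite !mulrDl in b *.
by do ![apply/andP; split]; lra.
Qed.

Definition steps : seq (R * R) :=
  [:: (34 / 100, sg); (35 / 100, 167 / 100 * sg)] ++ negs (pieces II).

Lemma steps_in : all (fun cb => 0 <= cb.2 <= pi) steps.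
Proof.
have [h0 h1 g0 gE [T0 p2]] := hs_facts; have [s0 sE s1] := sX_facts.
have gh : 219 / 20 * sg <= hw by rewrite -gE mulrC ler_pM2l.
rewrite /steps all_cat (negs_bounds pieces_in) andbT /=.
by do ![apply/andP; split]; lra.
Qed.

Lemma area_steps : 0 < area steps.
Proof.
have [h0 h1 g0 gE [T0 p2]] := hs_facts; have [s0 sE s1] := sX_facts.
have X1 := XX_ge d34 r01 n_ge mean; have k0 := kap_gt0 r01.
have XT : X * TT = 120 by rewrite /TT mulrC mulfVK //; apply/lt0r_neq0; lra.
have A1 : TT * hw <= 274 / 25 * sg.
  have e : sX * (TT * hw) = 120 * sg by rewrite -gE -XT -sE; ring.
  have : 219 / 20 * (TT * hw) <= sX * (TT * hw) by rewrite ler_wpM2r // mulr_ge0 // ltW.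
  rewrite e; lra.
(* As X [sX] [sg] = d, the left side is 14400 pi / (d [sX]) in units of [sg]. A single factor [TT]
   would not do here, the length pi being unrelated to [sg]. *)
have A2 : TT ^+ 2 * pi <= 1760 * sg.
  have p4 : pi <= 4 :> R by have := pihalf_lt2 R; lra.
  have dX : 9 <= X * kap by rewrite (XX_kap d r01); case/andP: d34; lra.
  have e : X * sX * sg * 3 = X * kap by rewrite -[X * sX * sg]mulrA [sX * sg]mulrC gE /hw; field.
  have e2 : X * sX * (TT ^+ 2 * sX * sX) = 120 * 120 * sX by rewrite -expr2 -mulrA -mulrA -expr2 sE -XT; ring.
  have Xs0 : 0 < X * sX by apply: mulr_gt0 => //; lra.
  have e3 : X * (X * TT ^+ 2) = 120 * 120 by rewrite -XT; ring.
  have X20 : 0 < X * sX * sX by apply: mulr_gt0.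
  rewrite -(ler_pM2l X20).
  have -> : X * sX * sX * (TT ^+ 2 * pi) = 120 * 120 * pi by rewrite -e3 -{2}sE; ring.
  have -> : X * sX * sX * (1760 * sg) = 1760 / 3 * sX * (X * sX * sg * 3) by field.
  rewrite e.
  have : 1760 / 3 * (219 / 20) * 9 <= 1760 / 3 * sX * (X * kap).
    by apply: ler_pM; lra.
  lra.
have A3 : \sum_(i <- iota 0 II) (57 / 100) ^+ (8 + i) * ((9 + i)%:R * sg - (8 + i)%:R * sg) <= 13 / 500 * sg.
  have -> : \sum_(i <- iota 0 II) (57 / 100) ^+ (8 + i) * ((9 + i)%:R * sg - (8 + i)%:R * sg) =
     (57 / 100) ^+ 8 * sg * \sum_(i < II) (57 / 100) ^+ i.
    rewrite -(big_mkord xpredT (fun i => (57 / 100) ^+ i)) /index_iota subn0 mulr_sumr.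
    by apply: eq_bigr => i _; rewrite exprD !natrD; ring.
  have g := @geom_le R (57 / 100) II ltac:(lra).
  have q0 : 0 <= (57 / 100) ^+ 8 * sg by rewrite mulr_ge0 ?exprn_ge0 // ?ltW //; lra.
  apply: (le_trans (ler_wpM2l q0 g)).
  rewrite ler_pdivrMr; last lra.
  have : (57 / 100) ^+ 8 <= 13 / 500 * (1 - 57 / 100) :> R by lra.
  move=> h; have := ler_wpM2r (ltW g0) h; lra.
pose gs : seq (R * R * R) := [seq ((57 / 100) ^+ (8 + i), (8 + i)%:R * sg, (9 + i)%:R * sg) | i <- iota 0 II].
have AC : \sum_(p <- gs) p.1.1 * (p.2 - p.1.2) <= 13 / 500 * sg by rewrite /gs big_map.
rewrite /steps area_cat area_negs /pieces big_cat -/gs.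
move: AC; set C := \sum_(p <- gs) _; clearbody C => {}A3.
rewrite !big_cons big_nil /=.
rewrite /area !big_cons big_nil /=.
move: A1 A2 A3; set A := TT * hw; set B := TT ^+ 2 * pi.
have E7 : (84 / 100 / 100 * TT) ^+ 2 * (pi - 0) = 84 / 100 / 100 * (84 / 100 / 100) * B by rewrite /B; ring.
have E1 c : c * TT * (2 * hw - hw) = c * A by rewrite /A; ring.
have E2 c : c * TT * (53 / 10 * hw - 2 * hw) = 33 / 10 * (c * A) by rewrite /A; field.
have E3 c : c * TT * (pi / 3 + hw / 2 - (pi / 3 - hw / 2)) = c * A by rewrite /A; field.
have E4 c : c * TT * (pi / 3 + hw - (pi / 3 - hw)) = 2 * (c * A) by rewrite /A; ring.
have E5 c : c * TT * (pi / 3 + 2 * hw - (pi / 3 - 2 * hw)) = 4 * (c * A) by rewrite /A; ring.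
have E6 c : c * TT * (pi / 3 + 53 / 10 * hw - (pi / 3 - 53 / 10 * hw)) = 106 / 10 * (c * A) by rewrite /A; field.
rewrite E1 E2 E3 E4 E5 E6 E7; clear E1 E2 E3 E4 E5 E6 E7; clearbody A B => A1 A2 A3.
clear -mean n_ge d34 r01 A1 A2 A3 g0.
lra.
Qed.

End StepFunction.

(** * The step function lies below the integrand *)

Section StepBound.
Variables (R : realType) (d r : R) (n : nat).
Hypotheses (d34 : 3 <= d <= 4) (r01 : 0 < r < 1) (n_ge : (1610 <= n)%N).
Hypothesis mean :
  d * \sum_(m <- ms (3 * n)) m%:R * (r ^+ m / (1 + r ^+ m)) = n%:R.
Local Notation kap := (kappa r).
Local Notation X := (XX d r).
Local Notation Phi := (modulus d r (3 * n)).
Local Notation theta t := (phase d r (3 * n) t - n%:R * t).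

Local Notation sX := (sX d r).
Local Notation sg := (sg d r).
Local Notation TT := (TT d r).
Local Notation pieces := (pieces d r).
Local Notation II := (II d r).
Local Notation steps := (steps d r).
Local Notation sX_facts := (sX_facts d34 r01 n_ge mean).
Local Notation hs_facts := (hs_facts d34 r01 n_ge mean).
Local Notation main_region := (main_region d34 r01 n_ge mean).
Local Notation pieces_ok := (pieces_ok d34 r01 n_ge mean).
Local Notation steps_in := (steps_in d34 r01 n_ge mean).
Local Notation area_steps := (area_steps d34 r01 n_ge mean).
Local Notation Phi_ge0 := (Phi_ge0 d r n).

Lemma Phi_c t c a M : kk r t <= c -> 0 <= c <= 99 / 100 -> 1 <= a ->
  a / 10 + 1 / 200 / 400 <= 1 - c -> expR (- a) <= M -> Phi t <= M * TT.
Proof.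
move=> kc c01 a0 ac HM; apply: (Phi_far d34 r01 n_ge mean kc c01 (a := a / 120)).
- by clear -mean n_ge d34 r01 a0; lra.
- by clear -mean n_ge d34 r01 ac; lra.
by rewrite (_ : 120 * (a / 120) = a) //; field.
Qed.

Lemma Phi_window t B u1 c M a : 0 <= u1 -> u1 * (hw r) <= `|t - pi / 3| ->
  `|t - pi / 3| <= 53 / 10 * (hw r) -> 0 <= B -> 1 / 2 + 5 / 3 * `|t - pi / 3| <= B ->
  B <= c * (1 + (u1 * (1 - u1 ^+ 2 / 600)) ^+ 2) -> 0 <= c <= 99 / 100 ->
  1 <= a -> a / 10 + 1 / 200 / 400 <= 1 - c -> expR (- a) <= M -> Phi t <= M * TT.
Proof.
move=> u0 u1w w53 B0 wB Bc c01 a0 ac HM; have k0 := kap_gt0 r01; have k1 := kap_10 d34 r01 n_ge mean.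
apply: (Phi_c _ c01 a0 ac HM).
set u := 3 * `|t - pi / 3| / kap.
have uE : `|t - pi / 3| = kap * u / 3 by rewrite /u; field; exact: lt0r_neq0.
apply: (kk_le_cst (le_trans (num_window r01 t) wB) B0 (sqr_ge0 _) _ Bc).
rewrite (gg_window uE); apply: g_sq => //.
  by rewrite /u ler_pdivlMr //; move: u1w; rewrite /hw; clear -mean n_ge d34 r01; lra.
by rewrite /u ler_pdivrMr //; move: w53; rewrite /hw; clear -mean n_ge d34 r01; lra.
Qed.

Lemma steps_le t : 0 < t < pi -> step steps t <= Phi t * cos (theta t).
Proof.
move=> t0pi; case/andP: (t0pi) => t0 tpi.
have [h0 h1 g0 gE [T0 p2]] := hs_facts; have [s0 sE s1] := sX_facts.
have k0 := kap_gt0 r01; have k1 := kap_10 d34 r01 n_ge mean.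
set v := 3 * t / kap; set y := v * sX.
have kn := lt0r_neq0 k0.
have tv : t = kap * v / 3 by rewrite /v; field.
have ty : t = sg * y by rewrite /y mulrCA gE [LHS]tv /hw; field.
have v0 : 0 <= v.
  by rewrite /v; apply: divr_ge0; [apply: mulr_ge0; [exact: ler0n | exact: ltW] | exact: ltW].
have yE : X * v ^+ 2 = y ^+ 2 by rewrite -sE /y; ring.
have vh a : (t <= a * (hw r)) = (v <= a).
  by rewrite tv (_ : kap * v / 3 = v * (hw r)) ?ler_pM2r //; rewrite /hw; field.
have ya a : (t <= a * sg) = (y <= a) by rewrite ty mulrC ler_pM2r.
have [m1 m2 m3] := main_region v0; rewrite -tv -/y in m1 m2 m3.
have Sneg := step_negs t pieces_ok.
rewrite /steps step_cat.
set S1 := step _ t; have S1E : S1 = 34 / 100 * (if y <= 1 then 1 else 0) + 35 / 100 * (if y <= 167 / 100 then 1 else 0).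
  by rewrite /S1 /step !big_cons big_nil /= addr0 -(ya 1) mul1r ya.
clearbody S1.
have [y1|y1] := leP y 1.
  apply: le_trans (m1 y1); rewrite S1E y1; case: ifP => _; clear -mean n_ge d34 r01 Sneg; lra.
have [y2|y2] := leP y (167 / 100).
  apply: le_trans (m2 y2); rewrite S1E y2 [y <= 1]leNgt y1 /=; clear -mean n_ge d34 r01 Sneg; lra.
have {}S1E : S1 = 0 by rewrite S1E [y <= 1]leNgt y1 [y <= _]leNgt y2 /= !mulr0 addr0.
have [y3|y3] := leP y (36 / 10).
  by apply: le_trans (m3 y3); rewrite S1E add0r.
(* Since cos >= - 1 and all pieces are nonpositive, one piece covering t and at least as deep as the
   modulus is enough. *)
suff [p pin /andP[tp HN]] : exists2 p, p \in pieces II & (p.1.2 < t <= p.2) && (Phi t <= p.1.1).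
  have := step_negs_mem pieces_ok pin tp; have := ler_wpM2l (Phi_ge0 t) (cos_geN1 (theta t)).
  rewrite S1E; clear -mean n_ge d34 r01 HN; lra.
clear m1 m2 m3 Sneg S1 S1E y1 y2.
have lt_y a : (a * sg < t) = (a < y) by rewrite !ltNge ya.
have lt_h a : (a * (hw r) < t) = (a < v) by rewrite !ltNge vh.
have [n1 n2 n3 n4] := near_num R; have [f1 f2 f3] := far_num R; have [w1 w2 w3 w4] := window_num R.
have near w B : y <= sX -> 0 <= w <= 120 -> 1 <= w -> w <= y ^+ 2 -> B * (120 + w) <= w * 120 ->
    Phi t <= expR (- ((1992 / 1000 * B - 137 / 1000 * w) / 12 - 1 / 50 / 100)) /\
    Phi t <= expR (- (859 / 1000 / 12 * y ^+ 2 - 1 / 50 / 100)).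
  move=> ys wb w1' wy HB; rewrite -yE tv; apply: (Phi_near d34 r01 n_ge mean (B := B) _ wb w1') => //.
    by rewrite v0 /=; move: ys; rewrite /y ger_pMl.
  by rewrite yE.
have [y4|y4] := leP y (46 / 10).
  exists (17 / 100, 36 / 10 * sg, 46 / 10 * sg); first by rewrite /pieces mem_cat !inE eqxx ?orbT.
  rewrite /= lt_y y3 ya y4 /=; apply: le_trans n1.
  have yy : 36 / 10 * (36 / 10) <= y * y by clear -mean n_ge d34 r01 y3; apply: ler_pM; lra.
  (* w is the square of the left end of the piece, and B rounds down 120 w / (120 + w). *)
  have [|||||N _] := near (324 / 25) (1169 / 100); rewrite ?expr2; try by [clear -mean n_ge d34 r01 yy y4 s1; lra | clear -mean n_ge d34 r01 yy y4 s1; apply/andP; split; lra].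
  by apply: (le_trans N); rewrite ler_expR; clear -mean n_ge d34 r01; lra.
have [y5|y5] := leP y 6.
  exists (33 / 500, 46 / 10 * sg, 6 * sg); first by rewrite /pieces mem_cat !inE eqxx ?orbT.
  rewrite /= lt_y y4 ya y5 /=; apply: le_trans n2.
  have yy : 46 / 10 * (46 / 10) <= y * y by clear -mean n_ge d34 r01 y4; apply: ler_pM; lra.
  have [|||||N _] := near (529 / 25) (1798 / 100); rewrite ?expr2; try by [clear -mean n_ge d34 r01 yy y5 s1; lra | clear -mean n_ge d34 r01 yy y5 s1; apply/andP; split; lra].
  by apply: (le_trans N); rewrite ler_expR; clear -mean n_ge d34 r01; lra.
have [y6|y6] := leP y 8.
  exists (155 / 100 / 100, 6 * sg, 8 * sg); first by rewrite /pieces mem_cat !inE eqxx ?orbT.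
  rewrite /= lt_y y5 ya y6 /=; apply: le_trans n3.
  have yy : 6 * 6 <= y * y by clear -mean n_ge d34 r01 y5; apply: ler_pM; lra.
  have [|||||N _] := near 36 (2769 / 100); rewrite ?expr2; try by [clear -mean n_ge d34 r01 yy y6 s1; lra | clear -mean n_ge d34 r01 yy y6 s1; apply/andP; split; lra].
  by apply: (le_trans N); rewrite ler_expR; clear -mean n_ge d34 r01; lra.
have [v1|v1] := leP v 1.
  have ys : y <= sX by rewrite /y ger_pMl.
  have y0 : 0 < y by clear -mean n_ge d34 r01 y6; lra.
  have [j /andP[j1 j2]] := nat_below y0.
  have j8 : (8 <= j)%N.
    by rewrite -ltnS -(ltr_nat R); apply: lt_le_trans j2.
  have jI : (j - 8 < II)%N.
    rewrite /II ltnS; apply: leq_trans (leq_subr _ _) _.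
    by rewrite truncn_ge_nat ?(ltW s0) // ltW // (lt_le_trans j1 ys).
  exists ((57 / 100) ^+ (8 + (j - 8)), (8 + (j - 8))%:R * sg, (9 + (j - 8))%:R * sg).
    rewrite /pieces mem_cat; apply/orP; right; apply/mapP; exists (j - 8)%N => //.
    by rewrite mem_iota.
  rewrite /= (_ : 9 + (j - 8) = j.+1)%N; last by clear -mean n_ge d34 r01 j8; lia.
  rewrite subnKC // lt_y j1 ya j2 /=.
  (* y > 8 and y > j turn the Gaussian decay into a geometric one in j. *)
  have yy : 8 * j%:R <= y * y by clear -mean n_ge d34 r01 j1 y6; apply: ler_pM; rewrite ?ler0n //; lra.
  have j8R : 8 <= j%:R :> R by rewrite ler_nat.
  have [||||_ N] := near 36 (2769 / 100) ys; rewrite ?expr2; try by [clear -mean n_ge d34 r01 yy j8R; lra | clear -mean n_ge d34 r01; apply/andP; split; lra].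
  apply: (le_trans N); apply: (@le_trans _ _ (expR (- (572 / 1000)) ^+ j)).
    by rewrite -expRM_natl ler_expR expr2; clear -mean n_ge d34 r01 yy j8R; lra.
  by rewrite lerXn2r ?nnegrE ?expR_ge0 //; clear -mean n_ge d34 r01; lra.
have gn u1 : 0 <= u1 -> u1 <= v -> v <= 53 / 10 -> (u1 * (1 - u1 ^+ 2 / 600)) ^+ 2 <= sin3q r t ^+ 2.
  by move=> a b c; rewrite tv gg_near; apply: g_sq.
have [v2|v2] := leP v 2.
  exists (72 / 100 / 100 * TT, (hw r), 2 * (hw r)); first by rewrite /pieces mem_cat !inE eqxx ?orbT.
  rewrite /= -{1}[(hw r)]mul1r lt_h v1 vh v2 /=.
  (* 501/1000 rounds up 1 / (1 + (599/600)^2), the bound on [kk] for v >= 1. *)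
  apply: (@Phi_c t (501 / 1000) (496 / 100)) => //; try by [clear -mean n_ge d34 r01; lra | clear -mean n_ge d34 r01; apply/andP; split; lra].
  apply: (kk_le_cst (num_le1 r01 t) ler01 (sqr_ge0 _) (gn 1 _ (ltW v1) _)); clear -mean n_ge d34 r01 v2; lra.
have [v3|v3] := leP v (53 / 10).
  exists (37 / 100 / 100 / 10 * TT, 2 * (hw r), 53 / 10 * (hw r)); first by rewrite /pieces mem_cat !inE eqxx ?orbT.
  rewrite /= lt_h v2 vh v3 /=.
  apply: (@Phi_c t (2022 / 100 / 100) (797 / 100)) => //; try by [clear -mean n_ge d34 r01; lra | clear -mean n_ge d34 r01; apply/andP; split; lra].
  apply: (kk_le_cst (num_le1 r01 t) ler01 (sqr_ge0 _) (gn 2 _ (ltW v2) v3)); clear -mean n_ge d34 r01; lra.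
set w := `|t - pi / 3|.
have inw b : w < b -> pi / 3 - b < t <= pi / 3 + b.
  rewrite /w ltr_norml => /andP[l1 l2]; clear -mean n_ge d34 r01 l1 l2.
  by apply/andP; split; lra.
have [b1|b1] := ltP w ((hw r) / 2).
  exists (92 / 100 / 100 * TT, pi / 3 - (hw r) / 2, pi / 3 + (hw r) / 2); first by rewrite /pieces mem_cat !inE eqxx ?orbT.
  rewrite /= inw //=.
  (* 1/36 is 5/3 times the largest distance 1/60, as [hw] <= 1/30; the other windows likewise. *)
  apply: (@Phi_window t (1 / 2 + 1 / 36) 0 (5278 / 100 / 100) _ (472 / 100)) => //;
    rewrite -/w ?mul0r ?normr_ge0 //; try by [clear -mean n_ge d34 r01 b1 h1 h0; lra | clear -mean n_ge d34 r01; apply/andP; split; lra].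
have [b2|b2] := ltP w (hw r).
  exists (41 / 100 / 100 * TT, pi / 3 - (hw r), pi / 3 + (hw r)); first by rewrite /pieces mem_cat !inE eqxx ?orbT.
  rewrite /= inw //=.
  apply: (@Phi_window t (5 / 9) (1 / 2) (4446 / 100 / 100) _ (555 / 100)) => //;
    rewrite -/w; by [clear -mean n_ge d34 r01 b1 b2 h0 h1; lra | clear -mean n_ge d34 r01; apply/andP; split; lra].
have [b3|b3] := ltP w (2 * (hw r)).
  exists (105 / 100 / 100 / 10 * TT, pi / 3 - 2 * (hw r), pi / 3 + 2 * (hw r)); first by rewrite /pieces mem_cat !inE eqxx ?orbT.
  rewrite /= inw //=.
  apply: (@Phi_window t (11 / 18) 1 (3061 / 100 / 100) _ (693 / 100)) => //;
    rewrite -/w; by [clear -mean n_ge d34 r01 b2 b3 h0 h1; lra | clear -mean n_ge d34 r01; apply/andP; split; lra].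
have [b4|b4] := ltP w (53 / 10 * (hw r)).
  exists (1 / 40 / 100 * TT, pi / 3 - 53 / 10 * (hw r), pi / 3 + 53 / 10 * (hw r)); first by rewrite /pieces mem_cat !inE eqxx ?orbT.
  rewrite /= inw //=.
  apply: (@Phi_window t (143 / 180) 2 (1607 / 100 / 100) _ (839 / 100)) => //;
    rewrite -/w; by [clear -mean n_ge d34 r01 b3 b4 h0 h1; lra | clear -mean n_ge d34 r01; apply/andP; split; lra].
exists ((84 / 100 / 100 * TT) ^+ 2, 0, pi); first by rewrite /pieces mem_cat !inE eqxx ?orbT.
rewrite /= t0 (ltW tpi) /=.
have X1 := XX_ge d34 r01 n_ge mean.
have kc : kk r t <= 1 / 26 by apply: (kk_far r01 (kap_10 d34 r01 n_ge mean) t0pi) => //; rewrite -/hw lt_h.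
apply: (le_trans (mod_far d34 r01 n_ge mean kc _)); first by clear -mean n_ge d34 r01 X1; lra.
have a1 : 1 / 120 <= 2403 / 500 / 120 :> R by clear -mean n_ge d34 r01; lra.
have a2 : expR (- (120 * (2403 / 500 / 120))) <= 84 / 100 / 100 :> R.
  by rewrite (_ : 120 * (2403 / 500 / 120) = 2403 / 500) //; field.
have := expR_scaled d34 r01 n_ge mean a1 a2; rewrite -/TT => E.
(* The exponent, about (25/26) X / 12, is split into two equal parts, each of which yields a factor
   [TT]. *)
apply: (@le_trans _ _ (expR (- (2403 / 500 / 120 * X)) ^+ 2)).
  by rewrite -expRM_natl ler_expR; clear -mean n_ge d34 r01 X1; lra.
by rewrite ler_sqr ?nnegrE ?expR_ge0 //; apply: le_trans E; exact: expR_ge0.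
Qed.

Lemma saddle_nonneg : 0 <= (\prod_(m <- ms (3 * n)) bser d m : fps R) n.
Proof.
apply: (coef_nonneg_crit _ r01 steps_in area_steps); last exact: steps_le.
by case/andP: d34 => *; apply/andP; split; lra.
Qed.

End StepBound.

(** * Existence of the saddle point and conclusion *)

Section SaddlePoint.
Variable R : realType.

Lemma mean_derivable (s : seq nat) (x : R) : 0 <= x ->
  exists D, is_derive x 1 (fun y => \sum_(m <- s) m%:R * (y ^+ m / (1 + y ^+ m))) D.
Proof.
move=> x0; elim: s => [|m s [D HD]].
  by exists 0; apply: dv_ext (dvc 0 x) => y; rewrite big_nil.
have [E HE] : exists E, is_derive x 1 (fun y : R => y ^+ m) E.
  case: m => [|m]; first by exists 0; apply: dv_ext (dvc 1 x) => y; rewrite expr0.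
  by exists (m.+1%:R * x ^+ m); exact: dvXid.
have p : 1 + x ^+ m != 0 by apply: lt0r_neq0; rewrite ltr_wpDr ?exprn_ge0.
have H := dvD (dvM (dvc m%:R x) (dvM HE (dvV (f := fun y => 1 + y ^+ m) p (dvD (dvc 1 x) HE)))) HD.
by eexists; apply: dv_ext H => y; rewrite big_cons.
Qed.

(** Intermediate values on [0, 1]: at r = 1 every quotient is 1/2 and the mean is 27 d n^2 > n. *)
Lemma saddle_exists (d : R) n : 3 <= d -> (0 < n)%N -> exists2 r : R, 0 < r < 1 &
  d * \sum_(m <- ms (3 * n)) m%:R * (r ^+ m / (1 + r ^+ m)) = n%:R.
Proof.
move=> d3 n0; pose f y : R := d * \sum_(m <- ms (3 * n)) m%:R * (y ^+ m / (1 + y ^+ m)).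
have n1 : 1 <= n%:R :> R by rewrite ler1n.
have f0 : f 0 = 0.
  rewrite /f big_seq big1 ?mulr0 // => m /ms_gt0; rewrite lt0n => m0.
  by rewrite expr0n (negPf m0) mul0r mulr0.
have f1 : f 1 = 27 * d * n%:R ^+ 2.
  rewrite /f (eq_bigr (fun m => m%:R * (1 / 2))); last by move=> m _; rewrite expr1n.
  by rewrite -mulr_suml sum_ms_id natrM; field.
have fn : n%:R < f 1.
  rewrite f1; have : 1 * n%:R <= n%:R * n%:R :> R by rewrite ler_pM2r //; lra.
  nra.
have [||c] := @IVT R f 0 1 n%:R ler01.
- apply: derivable_within_continuous => x; rewrite in_itv /= => /andP[x0 _].
  have [D HD] := mean_derivable (ms (3 * n)) x0.
  by have [] := dvM (dvc d x) HD.
- by rewrite f0 ge_min le_max ler0n /= (ltW fn) orbT.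
rewrite in_itv /= => /andP[c0 c1] fc; exists c => //.
rewrite !lt_neqAle c0 c1 !andbT; apply/andP; split; apply/eqP => E.
  by move: fc; rewrite -E f0 => /eqP; rewrite lt_eqF //; lra.
by rewrite E in fc; rewrite fc ltxx in fn.
Qed.

Lemma rpow_Q6_nonneg34 (d : R) n : 3 <= d <= 4 -> 0 <= (-1) ^+ n * fps_rpow Q6 d n.
Proof.
move=> d34; have [lt|le] := ltnP n bnd.
  rewrite (@rpow_Q6_tw R d 269 n); last by move: lt; rewrite /bnd; lia.
  rewrite (_ : d = 3 + (d - 3)); last by ring.
  apply: low_nonneg => //.
  by case/andP: d34 => ? ?; apply/andP; split; lra.
have n0 : (0 < n)%N by apply: leq_trans le.
have [r r01 mean] := saddle_exists (proj1 (andP d34)) n0.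
rewrite (@rpow_Q6_tw R d (3 * n) n); last by lia.
exact: (saddle_nonneg d34 r01 le mean).
Qed.

Lemma rpow_Q6_nonneg_step (d : R) : (forall n, 0 <= (-1) ^+ n * fps_rpow Q6 d n) ->
  forall n, 0 <= (-1) ^+ n * fps_rpow Q6 (d + 1) n.
Proof.
move=> H n; rewrite (@rpow_Q6_tw R _ n n); last by lia.
have -> : \prod_(m <- ms n) bser (d + 1) m =
    \prod_(m <- ms n) (1 + fpsX ^+ m) * \prod_(m <- ms n) bser d m :> fps R.
  by rewrite -big_split big_seq [RHS]big_seq; apply: eq_bigr => m /ms_gt0 m0; exact: bserD1.
have X0 : nnfps (\prod_(m <- ms n) (1 + fpsX ^+ m) : fps R).
  by apply: nn_prod => m k; rewrite coefsD coefs1 coefs_fpsXn addr_ge0 ?ler0n.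
rewrite coefsM; apply: sumr_ge0 => i _; apply: mulr_ge0; first exact: X0.
by rewrite -rpow_Q6_tw //; lia.
Qed.

End SaddlePoint.

Theorem theorem9 (R : realType) (delta : R) (hdelta : 3 <= delta) :
  sign_pattern (alt_pattern 3) (fps_rpow Q6 delta).
Proof.
apply/alt_pattern3P.
have d0 : 0 <= delta - 3 by rewrite subr_ge0.
have /andP[l1 l2] := truncn_itv d0.
set k := Num.truncn (delta - 3) in l1 l2.
have -> : delta = (delta - k%:R) + k%:R by rewrite subrK.
have : 3 <= delta - k%:R <= 4.
  by move: l2; rewrite -natr1 => l2; apply/andP; split; lra.
move: (delta - k%:R) => e e34; elim: k {l1 l2} => [|k IH].
  by rewrite addr0 => n; exact: rpow_Q6_nonneg34.
by rewrite -natr1 addrA; exact: rpow_Q6_nonneg_step.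
Qed.
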